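(* Let $c>0$. If $1<p<\infty$ and $f\in L^p(\mathbb{R})$, then $\Psi_N f\to P_c f$ almost everywhere on $\mathbb{R}$ as $N\to\infty$. Moreover, for $p=1$, $\Psi_N f\to f$ almost everywhere for every $f\in PW_c^1$.
   Context: The Fourier transform is $\widehat f(\xi)=\int_{\mathbb{R}} f(t)e^{-2\pi i\xi t}\,dt$ for $f\in L^1(\mathbb{R})$, extended to $L^2(\mathbb{R})$ and to tempered distributions as usual. For $1\le p<\infty$, $PW_c^p=\{f\in L^p(\mathbb{R}):\ \operatorname{supp}\widehat f\subseteq[-c,c]\}$ (Fourier transform in the distributional sense when $p>2$). The projection is $P_cf=\mathcal F^{-1}(\chi_{[-c,c]}\mathcal F f)$, i.e. $P_cf(x)=\int_{\mathbb{R}} f(t)\frac{\sin(2\pi c(x-t))}{\pi(x-t)}\,dt$ (principal value sense), which extends to a bounded operator on $L^p(\mathbb{R})$ for $1<p<\infty$. The prolate spheroidal wave functions $(\psi_{n,c})_{n\ge0}$ are defined recursively by $\psi_{n,c}=\operatorname{argmax}\{\|f\|_{L^2(-1,1)}/\|f\|_{L^2(\mathbb{R})}:\ f\in PW_c^2,\ f\perp\psi_{k,c}\ \text{for all } k<n\}$ (normalized in $L^2(\mathbb{R})$); they form an orthonormal basis of $PW_c^2$ and belong to $L^q(\mathbb{R})$ for every $1<q\le\infty$. For $f\in L^p(\mathbb{R})$, $\Psi_Nf:=\sum_{n=0}^N\langle f,\psi_{n,c}\rangle\psi_{n,c}$, where $\langle f,g\rangle=\int_{\mathbb{R}} f\overline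 g$. *)

(* Defs.v *)
From HB Require Import structures.
From mathcomp Require Import all_boot all_order all_algebra.
From mathcomp Require Import all_classical all_reals all_analysis.
From mathcomp Require Import complex.
Set Implicit Arguments. Unset Strict Implicit. Unset Printing Implicit Defensive.
Import Order.TTheory GRing.Theory Num.Theory.
Import numFieldNormedType.Exports.
Local Open Scope classical_set_scope.
Local Open Scope ring_scope.
Local Open Scope complex_scope.

Section Defs.
Variable R : realType.
Local Notation mu := (@lebesgue_measure R).

Definition cabs (z : R[i]) : R := Num.sqrt (complex.Re z ^+ 2 + complex.Im z ^+ 2).

Definition cexpi (t : R) : R[i] := (cos t)%:C + 'i * (sin t)%:C.

Definition cmeasurable (f : R -> R[i]) : Prop :=
  measurable_fun setT (fun x => complex.Re (f x)) /\ measurable_fun setT (fun x => complex.Im (f x)).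

Definition Lp (p : R) (f : R -> R[i]) : Prop :=
  cmeasurable f /\ (\int[mu]_x ((cabs (f x)) `^ p)%:E < +oo)%E.

(* Lebesgue integral over A of a complex-valued function (meaningful when integrable) *)
Definition cint (A : set R) (f : R -> R[i]) : R[i] :=
  (Rintegral mu A (fun x => complex.Re (f x)))%:C + 'i * (Rintegral mu A (fun x => complex.Im (f x)))%:C.

Definition fourier (f : R -> R[i]) (xi : R) : R[i] :=
  cint setT (fun t => f t * cexpi (- (2 * pi * xi * t))).

Definition l2sq (A : set R) (f : R -> R[i]) : \bar R :=
  (\int[mu]_(x in A) ((cabs (f x)) ^+ 2)%:E)%E.
Definition l2norm (A : set R) (f : R -> R[i]) : R := Num.sqrt (fine (l2sq A f)).

Definition fourierL2 (f g : R -> R[i]) : Prop :=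
  Lp 2 g /\
  (fun n : nat => l2sq setT
     (fun xi => cint `[- (n%:R), n%:R] (fun t => f t * cexpi (- (2 * pi * xi * t))) - g xi))
    @ \oo --> 0%E.

Definition PW2 (c : R) (f : R -> R[i]) : Prop :=
  Lp 2 f /\ exists g, fourierL2 f g /\ {ae mu, forall xi, c < `|xi| -> g xi = 0}.

(* PW_c^1 : f in L^1 and supp \hat f contained in [-c,c] (\hat f is continuous) *)
Definition PW1 (c : R) (f : R -> R[i]) : Prop :=
  Lp 1 f /\ forall xi, c < `|xi| -> fourier f xi = 0.

Definition inner (f g : R -> R[i]) : R[i] := cint setT (fun t => f t * conjc (g t)).

(* psi is a sequence of prolate spheroidal wave functions with bandwidth c:
   psi_n = argmax { ||f||_{L^2(-1,1)} / ||f||_{L^2(R)} : f in PW_c^2, f _|_ psi_k (k<n) },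
   normalized in L^2(R). *)
Definition PSWF (c : R) (psi : nat -> R -> R[i]) : Prop :=
  forall n : nat,
    [/\ PW2 c (psi n),
        l2norm setT (psi n) = 1,
        (forall k, (k < n)%N -> inner (psi n) (psi k) = 0) &
        (forall f, PW2 c f -> (forall k, (k < n)%N -> inner f (psi k) = 0) ->
           l2norm setT f != 0 ->
           l2norm `]-1, 1[ f / l2norm setT f <=
           l2norm `]-1, 1[ (psi n) / l2norm setT (psi n))].

Definition PsiN (psi : nat -> R -> R[i]) (N : nat) (f : R -> R[i]) (x : R) : R[i] :=
  \sum_(n < N.+1) inner f (psi n) * psi n x.

(* kernel sin(2 pi c u) / (pi u), with its continuous value 2c at u = 0 *)
Definition sinc_kernel (c u : R) : R :=
  if u == 0 then 2 * c else sin (2 * pi * c * u) / (pi * u).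

Definition Pc (c : R) (f : R -> R[i]) (x : R) : R[i] :=
  cint setT (fun t => f t * (sinc_kernel c (x - t))%:C).

End Defs.

Definition ccvg (R : realType) (u : nat -> R[i]) (l : R[i]) : Prop :=
  (fun n => cabs (u n - l)) @ \oo --> 0.

(* Main.v *)
(** Let lam n be the energy of psi n on ]-1, 1[. Varying the maximum shows that the psi n are
    orthogonal on ]-1, 1[ too and are eigenfunctions there of the sinc kernel, for the
    eigenvalue lam n; hence psi n decays at least like (lam n)^(-1/2) / |t|. Comparison with a
    combination of psi 0, ..., psi n whose Fourier transform has n vanishing moments shows that
    lam n tends to 0 faster than any geometric sequence. Finally, a function with spectrum in
    [-c, c] extrapolates from ]-1, 1[ along an arithmetic progression by finite differences, so
    the L^1 norm of psi n on any bounded set is O((lam n)^((1 - e) / 2)) for every e > 0.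

    The decay, interpolated with the uniform bound, and the extrapolation bound together give,
    for almost every x, a dominating function S(x) w(t) of the partial sums of
    psi n x * conj (psi n t), where w(t) is a power of 1 / (1 + |t|) with exponent as close to 1
    as needed for |f| w to be integrable. Extrapolating the remainder of the expansion of the
    sinc kernel shows that these sums converge to the kernel, and dominated convergence
    concludes. On the Fourier side only Bessel's inequality and an a.e. inversion formula are
    needed; both come from smoothing by the Poisson kernel. *)
Require Import Defs.
From HB Require Import structures.
From mathcomp Require Import all_boot all_order all_algebra.
From mathcomp Require Import all_classical all_reals all_analysis.
From mathcomp Require Import complex measurable_realfun.
From mathcomp Require Import ring lra.
Set Implicit Arguments. Unset Strict Implicit. Unset Printing Implicit Defensive.
Import Order.TTheory GRing.Theory Num.Theory.
Import numFieldNormedType.Exports.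
Local Open Scope classical_set_scope.
Local Open Scope ring_scope.
Local Open Scope complex_scope.

(** What decides is a balance of exponents. A decay [|t|^(- theta)] of [psi n] costs a factor
    [(lam n)^(- theta / 2)], extrapolation to bounded sets returns [(lam n)^((1 - e) / 2)], and the
    product is summable as soon as [theta < 1 - e], because [lam] decays superexponentially. Duality
    with L^p asks for [theta > 1 - 1 / p], which leaves room for every finite p > 1; for p = 1 the
    choice [theta = 0] does. The integer [q] encodes [theta = q / (q + 2)] and [e = 1 / (q + 2)].
    Membership in L^2 fixes a function up to null sets only, whereas the kernel sums must be bounded
    at points. The pointwise estimates therefore concern [Uop c g], the inverse Fourier integral of
    a transform [g] that vanishes off the band, which has a value everywhere. On ]-1, 1[ only the
    energy of [psi n] is known, not its point values, so extrapolation is averaged over its starting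
    point; this yields L^1 bounds on cells, and monotone convergence turns them into the pointwise
    bound S(x). *)

Section ComplexModulus.
Context {R : realType}.
Implicit Types z w : R[i].

Lemma cabs_normc z : cabs z = ComplexField.Normc.normc z.
Proof. by case: z. Qed.

Lemma cabs_ge0 z : 0 <= cabs z.
Proof. exact: sqrtr_ge0. Qed.

Lemma cabs_sqr z : cabs z ^+ 2 = complex.Re z ^+ 2 + complex.Im z ^+ 2.
Proof. by rewrite sqr_sqrtr// addr_ge0 ?sqr_ge0. Qed.

Lemma cabsM z w : cabs (z * w) = cabs z * cabs w.
Proof. by rewrite !cabs_normc ComplexField.Normc.normcM. Qed.

Lemma cabsX z n : cabs (z ^+ n) = cabs z ^+ n.
Proof.
elim: n => [|n IH]; last by rewrite !exprS cabsM IH.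
by rewrite !expr0 cabs_normc ComplexField.Normc.normc1.
Qed.

Lemma ler_cabsD z w : cabs (z + w) <= cabs z + cabs w.
Proof. by rewrite !cabs_normc le_normcD. Qed.

Lemma cabsN z : cabs (- z) = cabs z.
Proof. by rewrite !cabs_normc normcN. Qed.

Lemma cabs0 : cabs (0 : R[i]) = 0.
Proof. by rewrite cabs_normc ComplexField.Normc.normc0. Qed.

Lemma cabs1 : cabs (1 : R[i]) = 1.
Proof. by rewrite cabs_normc ComplexField.Normc.normc1. Qed.

Lemma cabs_eq0 z : cabs z = 0 -> z = 0.
Proof. by rewrite cabs_normc => /ComplexField.Normc.eq0_normc. Qed.

Lemma ler_cabsB z w : cabs (z - w) <= cabs z + cabs w.
Proof. by rewrite (le_trans (ler_cabsD _ _))// cabsN. Qed.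

Lemma cabs_real (x : R) : cabs x%:C = `|x|.
Proof. by rewrite /cabs /= expr0n /= addr0 sqrtr_sqr. Qed.

Lemma cabs_conj z : cabs (conjc z) = cabs z.
Proof. by case: z => a b; rewrite /cabs /= sqrrN. Qed.

Lemma ler_Re_cabs z : `|complex.Re z| <= cabs z.
Proof. by rewrite -sqrtr_sqr ler_wsqrtr// lerDl sqr_ge0. Qed.

Lemma ler_Im_cabs z : `|complex.Im z| <= cabs z.
Proof. by rewrite -sqrtr_sqr ler_wsqrtr// lerDr sqr_ge0. Qed.

Lemma ler_cabs_ReIm z : cabs z <= `|complex.Re z| + `|complex.Im z|.
Proof.
rewrite -(@ler_pXn2r _ 2) ?nnegrE ?cabs_ge0 ?addr_ge0//.
have h : 0 <= `|complex.Re z| * `|complex.Im z| by rewrite mulr_ge0.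
by rewrite cabs_sqr sqrrD !real_normK ?num_real// mulr2n; lra.
Qed.

Lemma mulc_conj z : z * conjc z = (cabs z ^+ 2)%:C.
Proof. by case: z => a b; rewrite cabs_sqr; apply/eqP; rewrite eq_complex /=; apply/andP; split; apply/eqP; ring. Qed.

Lemma ler_cabs_sum (I : Type) (r : seq I) (P : pred I) (F : I -> R[i]) :
  cabs (\sum_(i <- r | P i) F i) <= \sum_(i <- r | P i) cabs (F i).
Proof.
elim/big_rec2: _ => [|i a b _ h]; first by rewrite cabs0.
by rewrite (le_trans (ler_cabsD _ _))// lerD2l.
Qed.

Lemma cabs_cexpi (t : R) : cabs (cexpi t) = 1.
Proof.
by rewrite /cabs /cexpi /= !(mul0r, mul1r, add0r, addr0, subr0) cos2Dsin2 sqrtr1.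
Qed.

Lemma cexpiE (t : R) : cexpi t = cos t +i* sin t.
Proof. by rewrite /cexpi; apply/eqP; rewrite eq_complex /= !(mul0r, mul1r, add0r, addr0, subr0) !eqxx. Qed.

Lemma cexpiD (s t : R) : cexpi (s + t) = cexpi s * cexpi t.
Proof.
by rewrite !cexpiE cosD sinD; apply/eqP; rewrite eq_complex /= eqxx addrC mulrC
  [in X in _ == X]mulrC; apply/eqP; ring.
Qed.

Lemma cexpi0 : cexpi (0 : R) = 1.
Proof. by rewrite cexpiE cos0 sin0. Qed.

Lemma cexpiN (t : R) : cexpi (- t) = conjc (cexpi t).
Proof. by rewrite !cexpiE cosN sinN. Qed.

Lemma conjcM z w : conjc (z * w) = conjc z * conjc w.
Proof. exact: (rmorphM (@conjc R)). Qed.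

Lemma conjcD z w : conjc (z + w) = conjc z + conjc w.
Proof. exact: (raddfD (@conjc R)). Qed.

Lemma conjcB z w : conjc (z - w) = conjc z - conjc w.
Proof. exact: (raddfB (@conjc R)). Qed.

Lemma conjc_real (x : R) : conjc x%:C = x%:C.
Proof. by rewrite conjc_real. Qed.

Lemma Re_real (x : R) : complex.Re x%:C = x. Proof. by []. Qed.

Lemma ReD z w : complex.Re (z + w) = complex.Re z + complex.Re w.
Proof. by case: z; case: w. Qed.
Lemma ImD z w : complex.Im (z + w) = complex.Im z + complex.Im w.
Proof. by case: z; case: w. Qed.
Lemma ReN z : complex.Re (- z) = - complex.Re z.
Proof. by case: z. Qed.
Lemma ImN z : complex.Im (- z) = - complex.Im z.
Proof. by case: z. Qed.
Lemma ReM z w : complex.Re (z * w) =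
  complex.Re z * complex.Re w - complex.Im z * complex.Im w.
Proof. by case: z; case: w. Qed.
Lemma ImM z w : complex.Im (z * w) =
  complex.Re z * complex.Im w + complex.Im z * complex.Re w.
Proof. by case: z; case: w. Qed.

Lemma Re_conj z : complex.Re (conjc z) = complex.Re z.
Proof. by case: z. Qed.
Lemma Im_conj z : complex.Im (conjc z) = - complex.Im z.
Proof. by case: z. Qed.

Lemma complex_eq z w : complex.Re z = complex.Re w ->
  complex.Im z = complex.Im w -> z = w.
Proof. by case: z; case: w => a b c d /= -> ->. Qed.

End ComplexModulus.

(** * Measurability of complex-valued functions *)

Section ComplexMeasurable.
Context {d : measure_display} {T : measurableType d} {R : realType}.
Implicit Types f g : T -> R[i].

(** [cmeasurable] over an arbitrary measurable space, so that it also covers kernels on [R * R]. *)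
Definition cmeas f := measurable_fun setT (fun x => complex.Re (f x)) /\
  measurable_fun setT (fun x => complex.Im (f x)).

Lemma eq_cmeas f g : f =1 g -> cmeas f -> cmeas g.
Proof. by move=> /funext ->. Qed.

Lemma cmeasD f g : cmeas f -> cmeas g -> cmeas (fun x => f x + g x).
Proof.
move=> [f1 f2] [g1 g2]; split.
- by under eq_fun do rewrite ReD; exact: measurable_funD.
- by under eq_fun do rewrite ImD; exact: measurable_funD.
Qed.

Lemma cmeasM f g : cmeas f -> cmeas g -> cmeas (fun x => f x * g x).
Proof.
move=> [f1 f2] [g1 g2]; split.
- by under eq_fun do rewrite ReM; apply: measurable_funB; exact: measurable_funM.
- by under eq_fun do rewrite ImM; apply: measurable_funD; exact: measurable_funM.
Qed.

Lemma cmeas_cst z : cmeas (fun=> z).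
Proof. by split; exact: measurable_cst. Qed.

Lemma cmeasN f : cmeas f -> cmeas (fun x => - f x).
Proof.
move=> [f1 f2]; split.
- by under eq_fun do rewrite ReN; exact: measurableT_comp.
- by under eq_fun do rewrite ImN; exact: measurableT_comp.
Qed.

Lemma cmeasB f g : cmeas f -> cmeas g -> cmeas (fun x => f x - g x).
Proof. by move=> mf mg; apply: cmeasD => //; exact: cmeasN. Qed.

Lemma cmeas_conj f : cmeas f -> cmeas (fun x => conjc (f x)).
Proof.
move=> [f1 f2]; split.
- by under eq_fun do rewrite Re_conj.
- by under eq_fun do rewrite Im_conj; exact: measurableT_comp.
Qed.

Lemma cmeas_real (h : T -> R) : measurable_fun setT h -> cmeas (fun x => (h x)%:C).
Proof. by move=> mh; split => //=; exact: measurable_cst. Qed.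

Lemma cmeas_cexpi (h : T -> R) : measurable_fun setT h -> cmeas (fun x => cexpi (h x)).
Proof.
move=> mh; split; under eq_fun do rewrite cexpiE /=.
- apply: measurableT_comp mh; apply: continuous_measurable_fun; exact: continuous_cos.
- apply: measurableT_comp mh; apply: continuous_measurable_fun; exact: continuous_sin.
Qed.

Lemma cmeas_sum (I : Type) (r : seq I) (F : I -> T -> R[i]) :
  (forall i, cmeas (F i)) -> cmeas (fun x => \sum_(i <- r) F i x).
Proof.
move=> mF; elim: r => [|i r IH].
  by apply: (@eq_cmeas (fun=> 0)); [move=> x; rewrite big_nil|exact: cmeas_cst].
apply: (@eq_cmeas (fun x => F i x + \sum_(i <- r) F i x)).
  by move=> x; rewrite big_cons.
exact: cmeasD.
Qed.

Lemma measurable_cabs f : cmeas f -> measurable_fun setT (fun x => cabs (f x)).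
Proof.
move=> [f1 f2]; rewrite /cabs.
apply: (@measurableT_comp _ _ _ _ _ _ (@Num.sqrt R)) => //.
  by apply: continuous_measurable_fun; exact: sqrt_continuous.
by apply: measurable_funD; exact: measurable_funX.
Qed.

End ComplexMeasurable.

Lemma cmeas_comp {d d' : measure_display} {T : measurableType d} {T' : measurableType d'}
  {R : realType} (f : T' -> R[i]) (h : T -> T') :
  cmeas f -> measurable_fun setT h -> cmeas (fun x => f (h x)).
Proof.
move=> [f1 f2] mh; split.
- exact: (measurableT_comp f1 mh).
- exact: (measurableT_comp f2 mh).
Qed.
(** * Integrals of complex functions *)

Section ComplexIntegral.
Context {R : realType}.
Local Notation mu := (@lebesgue_measure R).
Implicit Types (A B : set R) (f g : R -> R[i]) (h b : R -> R).

Definition rintegrable A h := mu.-integrable A (EFin \o h).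

Definition cintegrable A f := rintegrable A (fun x => complex.Re (f x)) /\
  rintegrable A (fun x => complex.Im (f x)).

Lemma rintegrable_le A h b : measurable A -> measurable_fun setT h ->
  rintegrable A b -> (forall x, A x -> `|h x| <= b x) -> rintegrable A h.
Proof.
move=> mA mh ib hb; apply: (@le_integrable _ _ _ mu A mA _ (EFin \o b)) => //.
  by apply/measurable_EFinP; exact: measurable_funTS.
by move=> x Ax /=; rewrite lee_fin (le_trans (hb x Ax))// ler_norm.
Qed.

Lemma rintegrableD A h b : measurable A -> rintegrable A h -> rintegrable A b ->
  rintegrable A (fun x => h x + b x).
Proof. by move=> mA ih ib; exact: (@integrableD _ _ _ mu A mA (EFin \o h) (EFin \o b)). Qed.

Lemma rintegrableZl A (k : R) h : measurable A -> rintegrable A h ->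
  rintegrable A (fun x => k * h x).
Proof. by move=> mA ih; exact: (@integrableZl _ _ _ mu A mA k (EFin \o h)). Qed.

Lemma rintegrableN A h : measurable A -> rintegrable A h ->
  rintegrable A (fun x => - h x).
Proof. by move=> mA ih; exact: (@integrableN _ _ _ mu A (EFin \o h)). Qed.

Lemma rintegrableB A h b : measurable A -> rintegrable A h -> rintegrable A b ->
  rintegrable A (fun x => h x - b x).
Proof. by move=> mA ih ib; apply: rintegrableD => //; exact: rintegrableN. Qed.

Lemma rintegrable_mkcond A h : measurable A ->
  rintegrable A h <-> rintegrable setT (h \_ A).
Proof.
by move=> mA; rewrite /rintegrable (@integrable_mkcond _ _ _ mu A (EFin \o h) mA) restrict_EFin.
Qed.

Lemma ler_norm_Rintegral A h : measurable A -> rintegrable A h ->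
  `|\int[mu]_(x in A) h x| <= \int[mu]_(x in A) `|h x|.
Proof. by move=> mA ih; exact: le_normr_Rintegral. Qed.

Lemma rintegrable_norm A h : rintegrable A h -> rintegrable A (fun x => `|h x|).
Proof. exact: integrable_norm. Qed.

Lemma rintegrableS A B h : measurable A -> measurable B -> A `<=` B ->
  rintegrable B h -> rintegrable A h.
Proof. by move=> mA mB AB; exact: integrableS. Qed.

Lemma cintegrable_le A f b : measurable A -> cmeas f -> rintegrable A b ->
  (forall x, A x -> cabs (f x) <= b x) -> cintegrable A f.
Proof.
move=> mA [f1 f2] ib fb; split; apply: (rintegrable_le mA _ ib) => // x Ax.
- exact: le_trans (ler_Re_cabs _) (fb x Ax).
- exact: le_trans (ler_Im_cabs _) (fb x Ax).
Qed.

Lemma cintegrable_cabs A f : measurable A -> cmeas f -> cintegrable A f ->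
  rintegrable A (fun x => cabs (f x)).
Proof.
move=> mA mf [i1 i2].
have := rintegrableD mA (rintegrable_norm i1) (rintegrable_norm i2).
move=> /(rintegrable_le mA); apply; first exact: measurable_cabs.
by move=> x _; rewrite ger0_norm ?cabs_ge0// ler_cabs_ReIm.
Qed.

Lemma cintegrableP A f : measurable A -> cmeas f ->
  cintegrable A f <-> rintegrable A (fun x => cabs (f x)).
Proof.
move=> mA mf; split=> [|i]; first exact: cintegrable_cabs.
exact: (cintegrable_le mA mf i).
Qed.

Lemma cintegrableD A f g : measurable A -> cintegrable A f -> cintegrable A g ->
  cintegrable A (fun x => f x + g x).
Proof.
move=> mA [f1 f2] [g1 g2]; split.
- by under eq_fun do rewrite ReD; exact: rintegrableD.
- by under eq_fun do rewrite ImD; exact: rintegrableD.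
Qed.

Lemma cintegrableZl A z f : measurable A -> cintegrable A f ->
  cintegrable A (fun x => z * f x).
Proof.
move=> mA [f1 f2]; split.
- by under eq_fun do rewrite ReM; apply: rintegrableB => //; exact: rintegrableZl.
- by under eq_fun do rewrite ImM; apply: rintegrableD => //; exact: rintegrableZl.
Qed.

Lemma cintegrableZr A z f : measurable A -> cintegrable A f ->
  cintegrable A (fun x => f x * z).
Proof. by move=> mA i; under eq_fun do rewrite mulrC; exact: cintegrableZl. Qed.

Lemma cintegrableN A f : measurable A -> cintegrable A f ->
  cintegrable A (fun x => - f x).
Proof.
move=> mA [f1 f2]; split.
- by under eq_fun do rewrite ReN; exact: rintegrableN.
- by under eq_fun do rewrite ImN; exact: rintegrableN.
Qed.

Lemma cintegrableB A f g : measurable A -> cintegrable A f -> cintegrable A g ->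
  cintegrable A (fun x => f x - g x).
Proof. by move=> mA fi gi; apply: cintegrableD => //; exact: cintegrableN. Qed.

Lemma cintegrable0 A : measurable A -> cintegrable A (fun=> 0).
Proof. by move=> mA; split; apply: integrable0. Qed.

Lemma cintegrable_sum A (I : Type) (r : seq I) (F : I -> R -> R[i]) :
  measurable A -> (forall i, cintegrable A (F i)) ->
  cintegrable A (fun x => \sum_(i <- r) F i x).
Proof.
move=> mA iF; elim: r => [|i r IH].
  by under eq_fun do rewrite big_nil; exact: cintegrable0.
by under eq_fun do rewrite big_cons; exact: cintegrableD.
Qed.

Lemma cintegrable_conj A f : measurable A -> cintegrable A f ->
  cintegrable A (fun x => conjc (f x)).
Proof.
move=> mA [f1 f2]; split.
- by under eq_fun do rewrite Re_conj.
- by under eq_fun do rewrite Im_conj; exact: rintegrableN.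
Qed.

Lemma cintegrable_real A h : measurable A -> rintegrable A h ->
  cintegrable A (fun x => (h x)%:C).
Proof. by move=> mA ih; split => //; exact: integrable0. Qed.

Lemma Re_cint A f : complex.Re (cint A f) = \int[mu]_(x in A) complex.Re (f x).
Proof. by rewrite /cint /= mul0r mul1r subr0 addr0. Qed.

Lemma Im_cint A f : complex.Im (cint A f) = \int[mu]_(x in A) complex.Im (f x).
Proof. by rewrite /cint /= !(mul0r, mul1r, addr0, add0r). Qed.

Lemma eq_cint A f g : (forall x, A x -> f x = g x) -> cint A f = cint A g.
Proof.
by move=> fg; apply: complex_eq; rewrite !(Re_cint, Im_cint);
  apply: eq_Rintegral => x /set_mem Ax; rewrite fg.
Qed.

Lemma cintD A f g : measurable A -> cintegrable A f -> cintegrable A g ->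
  cint A (fun x => f x + g x) = cint A f + cint A g.
Proof.
move=> mA [f1 f2] [g1 g2]; apply: complex_eq;
  [rewrite Re_cint ReD !Re_cint|rewrite Im_cint ImD !Im_cint].
- by under eq_Rintegral do rewrite ReD; rewrite RintegralD.
- by under eq_Rintegral do rewrite ImD; rewrite RintegralD.
Qed.

Lemma cintZl A z f : measurable A -> cintegrable A f ->
  cint A (fun x => z * f x) = z * cint A f.
Proof.
move=> mA [f1 f2]; apply: complex_eq;
  [rewrite Re_cint ReM Re_cint Im_cint|rewrite Im_cint ImM Re_cint Im_cint].
- under eq_Rintegral do rewrite ReM.
  by rewrite RintegralB ?RintegralZl//; exact: rintegrableZl.
- under eq_Rintegral do rewrite ImM.
  by rewrite RintegralD ?RintegralZl//; exact: rintegrableZl.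
Qed.

Lemma cintZr A z f : measurable A -> cintegrable A f ->
  cint A (fun x => f x * z) = cint A f * z.
Proof.
by move=> mA fi; rewrite mulrC -cintZl//; apply: eq_cint => x _; rewrite mulrC.
Qed.

Lemma cintN A f : measurable A -> cintegrable A f ->
  cint A (fun x => - f x) = - cint A f.
Proof.
move=> mA fi; rewrite -mulN1r -cintZl//.
by apply: eq_cint => x _; rewrite mulN1r.
Qed.

Lemma cintB A f g : measurable A -> cintegrable A f -> cintegrable A g ->
  cint A (fun x => f x - g x) = cint A f - cint A g.
Proof.
by move=> mA fi gi; rewrite cintD ?cintN//; exact: cintegrableN.
Qed.

Lemma cint0 A : cint A (fun=> 0) = 0.
Proof. by apply: complex_eq; rewrite !(Re_cint, Im_cint) /Rintegral integral0. Qed.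

Lemma cint_sum A (I : Type) (r : seq I) (F : I -> R -> R[i]) :
  measurable A -> (forall i, cintegrable A (F i)) ->
  cint A (fun x => \sum_(i <- r) F i x) = \sum_(i <- r) cint A (F i).
Proof.
move=> mA iF; elim: r => [|i r IH].
  by rewrite big_nil (eq_cint (g := fun=> 0)) ?cint0// => x _; rewrite big_nil.
rewrite big_cons -IH -cintD//; last exact: cintegrable_sum.
by apply: eq_cint => x _; rewrite big_cons.
Qed.

Lemma cint_conj A f : measurable A -> cintegrable A f ->
  cint A (fun x => conjc (f x)) = conjc (cint A f).
Proof.
move=> mA [f1 f2]; apply: complex_eq.
- by rewrite Re_cint Re_conj Re_cint; apply: eq_Rintegral => x _; rewrite Re_conj.
- rewrite Im_cint Im_conj Im_cint -mulN1r -RintegralZl//.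
  by apply: eq_Rintegral => x _; rewrite Im_conj mulN1r.
Qed.

Lemma cint_real A h : cint A (fun x => (h x)%:C) = (\int[mu]_(x in A) h x)%:C.
Proof.
by apply: complex_eq; rewrite !(Re_cint, Im_cint)//= /Rintegral integral0.
Qed.

Lemma ler_Rintegral A h b : measurable A -> rintegrable A h -> rintegrable A b ->
  (forall x, A x -> h x <= b x) ->
  \int[mu]_(x in A) h x <= \int[mu]_(x in A) b x.
Proof. by move=> mA ih ib hb; exact: le_Rintegral. Qed.

(* With [z] the integral, [|z|^2] is the integral of [Re (conj z f)], which is
   at most [|z|] times the integral of [|f|]. *)
Lemma ler_cabs_cint A f : measurable A -> cmeas f -> cintegrable A f ->
  cabs (cint A f) <= \int[mu]_(x in A) cabs (f x).
Proof.
move=> mA mf fi; set z := cint A f.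
have ic := cintegrable_cabs mA mf fi.
have [->|z0] := eqVneq (cabs z) 0; first by apply: Rintegral_ge0 => x _; exact: cabs_ge0.
have zp : 0 < cabs z by rewrite lt0r z0 cabs_ge0.
rewrite -(ler_pM2l zp) -RintegralZl// -expr2.
have -> : cabs z ^+ 2 = complex.Re (conjc z * z) by rewrite mulrC mulc_conj.
rewrite -cintZl// Re_cint; apply: ler_Rintegral => //.
- by have [] := cintegrableZl (conjc z) mA fi.
- exact: rintegrableZl.
- by move=> x _; rewrite -(cabs_conj z) -cabsM (le_trans (ler_norm _))// ler_Re_cabs.
Qed.

Lemma ler_cabs_cint_bound A f b : measurable A -> cmeas f -> rintegrable A b ->
  (forall x, A x -> cabs (f x) <= b x) ->
  cabs (cint A f) <= \int[mu]_(x in A) b x.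
Proof.
move=> mA mf ib fb; have fi := cintegrable_le mA mf ib fb.
apply: (le_trans (ler_cabs_cint mA mf fi)); apply: ler_Rintegral => //.
exact: cintegrable_cabs.
Qed.

End ComplexIntegral.

(** * Fubini's theorem for kernels dominated by a product *)

Section FubiniDominated.
Context {R : realType}.
Local Notation mu := (@lebesgue_measure R).
Implicit Types (A B : set R).

Definition jmeas (k : R -> R -> R) :=
  measurable_fun [set: R * R] (fun z => k z.1 z.2).

Definition jcmeas (K : R -> R -> R[i]) := cmeas (fun z : R * R => K z.1 z.2).

Lemma jmeas1 k x : jmeas k -> measurable_fun setT (k x).
Proof. by move=> mk; exact: (measurable_fun_pair2 x mk). Qed.

Lemma jmeas2 k y : jmeas k -> measurable_fun setT (k^~ y).
Proof. by move=> mk; exact: (measurable_fun_pair1 y mk). Qed.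

Lemma jmeas_flip k : jmeas k -> jmeas (fun x y => k y x).
Proof.
move=> mk; apply: (measurableT_comp mk (measurable_fun_pair _ _)).
- exact: measurable_snd.
- exact: measurable_fst.
Qed.

Lemma jcmeas1 K x : jcmeas K -> cmeas (K x).
Proof. by move=> [m1 m2]; split; [exact: (measurable_fun_pair2 x m1)|exact: (measurable_fun_pair2 x m2)]. Qed.

Lemma jmeas_fst (h : R -> R) : measurable_fun setT h -> jmeas (fun x _ => h x).
Proof. by move=> mh; apply: (measurableT_comp mh); exact: measurable_fst. Qed.

Lemma jmeas_snd (h : R -> R) : measurable_fun setT h -> jmeas (fun _ y => h y).
Proof. by move=> mh; apply: (measurableT_comp mh); exact: measurable_snd. Qed.

Lemma jcmeas_fst (h : R -> R[i]) : cmeas h -> jcmeas (fun x _ => h x).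
Proof. by move=> mh; apply: (cmeas_comp mh); exact: measurable_fst. Qed.

Lemma jcmeas_snd (h : R -> R[i]) : cmeas h -> jcmeas (fun _ y => h y).
Proof. by move=> mh; apply: (cmeas_comp mh); exact: measurable_snd. Qed.

(** Tonelli covers nonnegative functions only, so the positive and negative parts are treated
    separately. *)
Lemma measurable_integral_section (f : R * R -> \bar R) : measurable_fun setT f ->
  measurable_fun setT (fun x => \int[mu]_y f (x, y))%E.
Proof.
move=> mf; rewrite (_ : (fun x => _) =
    fubini_F mu f^\+ \- fubini_F mu f^\-)%E; last first.
  apply/funext=> x; rewrite [LHS]integralE.
  under eq_integral do rewrite funepos_comp/=.
  by under [X in (_ - X)%E = _]eq_integral do rewrite funeneg_comp/=.
apply: emeasurable_funB.
- apply: (measurable_fun_fubini_tonelli_F (m2 := mu)) => //.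
  exact: measurable_funepos.
- apply: (measurable_fun_fubini_tonelli_F (m2 := mu)) => //.
  exact: measurable_funeneg.
Qed.

Lemma measurable_Rintegral (k : R -> R -> R) B : jmeas k -> measurable B ->
  measurable_fun setT (fun x => \int[mu]_(y in B) k x y).
Proof.
move=> mk mB.
pose k' (z : R * R) := (\1_B z.2 * k z.1 z.2)%R.
have mk' : measurable_fun setT k'.
  apply: measurable_funM => //.
  by apply: (measurableT_comp _ measurable_snd); exact: measurable_indic.
have mE : measurable_fun setT (EFin \o k') by exact/measurable_EFinP.
rewrite (_ : (fun x => _) = fun x => fine (\int[mu]_y (k' (x, y))%:E)); last first.
  apply/funext => x; rewrite Rintegral_mkcond; congr fine.
  apply: eq_integral => y _; congr (_%:E); rewrite /k' /= patchE indicE.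
  by case: ifP => _; rewrite ?mul1r ?mul0r.
apply: (measurableT_comp (fine_measurable _)) => //.
exact: (measurable_integral_section mE).
Qed.

Lemma cmeas_cint (K : R -> R -> R[i]) B : jcmeas K -> measurable B ->
  cmeas (fun x => cint B (K x)).
Proof.
move=> [m1 m2] mB; split.
- by under eq_fun do rewrite Re_cint; exact: (@measurable_Rintegral (fun x y => complex.Re (K x y))).
- by under eq_fun do rewrite Im_cint; exact: (@measurable_Rintegral (fun x y => complex.Im (K x y))).
Qed.

Lemma rintegrable_Rintegral A B (k : R -> R -> R) (a b : R -> R) :
  measurable A -> measurable B -> jmeas k -> rintegrable A a -> rintegrable B b ->
  (forall x y, A x -> B y -> `|k x y| <= a x * b y) ->
  rintegrable A (fun x => \int[mu]_(y in B) k x y).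
Proof.
move=> mA mB mk ia ib kab.
have ic : rintegrable A (fun x => (\int[mu]_(y in B) b y) * a x) by exact: rintegrableZl.
apply: (rintegrable_le mA _ ic); first exact: measurable_Rintegral.
move=> x Ax; have iab : rintegrable B (fun y => a x * b y) by exact: rintegrableZl.
have ik : rintegrable B (k x).
  by apply: (rintegrable_le mB _ iab) => [|y By]; [exact: jmeas1|exact: kab].
apply: (le_trans (ler_norm_Rintegral mB ik)).
rewrite mulrC -RintegralZl//; apply: ler_Rintegral => //; first exact: rintegrable_norm.
by move=> y By; exact: kab.
Qed.

(** The product bound makes the kernel integrable on the plane: its double integral is at most the
    integral of [|a|] times that of [|b|]. *)
Lemma Fubini_dominated A B (k : R -> R -> R) (a b : R -> R) :
  measurable A -> measurable B -> jmeas k -> rintegrable A a -> rintegrable B b ->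
  (forall x y, A x -> B y -> `|k x y| <= a x * b y) ->
  \int[mu]_(x in A) \int[mu]_(y in B) k x y = \int[mu]_(y in B) \int[mu]_(x in A) k x y.
Proof.
move=> mA mB mk ia ib kab.
(* The domains enter as indicators, which turns both iterated integrals into integrals over the
   whole line. *)
pose k' (z : R * R) : R := \1_A z.1 * (\1_B z.2 * k z.1 z.2).
have mk' : measurable_fun setT k'.
  apply: measurable_funM; last apply: measurable_funM => //.
  - by apply: (measurableT_comp _ measurable_fst); exact: measurable_indic.
  - by apply: (measurableT_comp _ measurable_snd); exact: measurable_indic.
have mE : measurable_fun setT (EFin \o k') by exact/measurable_EFinP.
pose a' := (fun x => `|a x|) \_ A; pose b' := (fun x => `|b x|) \_ B.
have a'0 x : 0 <= a' x by rewrite /a' patchE; case: ifP.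
have b'0 x : 0 <= b' x by rewrite /b' patchE; case: ifP.
have ia' : mu.-integrable setT (EFin \o a').
  by apply/(rintegrable_mkcond _ mA); exact: (rintegrable_norm ia).
have ib' : mu.-integrable setT (EFin \o b').
  by apply/(rintegrable_mkcond _ mB); exact: (rintegrable_norm ib).
have k'le x y : `|k' (x, y)| <= a' x * b' y.
  rewrite /k' /a' /b' !patchE !indicE /=.
  have [xA|] := boolP (x \in A); last by rewrite !mul0r normr0.
  have [yB|] := boolP (y \in B); last by rewrite !(mul0r,mulr0) normr0.
  rewrite !mul1r -normrM (le_trans (kab _ _ (set_mem xA) (set_mem yB)))//.
  exact: ler_norm.
have ik' : (mu \x mu)%E.-integrable setT (EFin \o k').
  apply/(integrable12ltyP mu mu mE).
  apply: (@le_lt_trans _ _ (\int[mu]_x ((a' x)%:E * \int[mu]_y (b' y)%:E))%E).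
    apply: ge0_le_integral => //.
    - by move=> x _; exact: integral_ge0.
    - apply: (measurable_fun_fubini_tonelli_F (m2 := mu) (abse \o (EFin \o k'))) => //=.
      exact: measurableT_comp.
    - apply: emeasurable_funM => //; first exact: measurable_int ia'.
    - move=> x _; rewrite -ge0_integralZl//; last 3 first.
      + exact: measurable_int ib'.
      + by move=> y _; rewrite lee_fin.
      + by rewrite lee_fin.
      apply: ge0_le_integral => //=.
      + apply/measurable_EFinP; apply: measurableT_comp => //.
        exact: (measurable_fun_pair2 x mk').
      + apply: emeasurable_funM => //; exact: measurable_int ib'.
      + by move=> y _; rewrite -EFinM lee_fin k'le.
  rewrite ge0_integralZr//; last 3 first.
  - exact: measurable_int ia'.
  - by move=> x _; rewrite lee_fin.
  - by apply: integral_ge0 => y _; rewrite lee_fin.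
  rewrite lte_mul_pinfty//.
  - by apply: integral_ge0 => y _; rewrite lee_fin.
  - exact: (integrable_fin_num measurableT ia').
  - have := integrable_fin_num measurableT ib'.
    by rewrite ge0_fin_numE// integral_ge0// => y _; rewrite lee_fin.
have fx x : A x -> (\int[mu]_y (k' (x, y))%:E = (\int[mu]_(y in B) k x y)%:E)%E.
  move=> Ax; have ik : rintegrable B (k x).
    have iab : rintegrable B (fun y => a x * b y) by exact: rintegrableZl.
    by apply: (rintegrable_le mB _ iab) => [|y By]; [exact: jmeas1|exact: kab].
  rewrite /Rintegral fineK ?integrable_fin_num// integral_mkcond.
  apply: eq_integral => y _; rewrite /k' /= patchE !indicE mem_set// mul1r.
  by case: ifP; rewrite ?mul1r ?mul0r.
have fy y : B y -> (\int[mu]_x (k' (x, y))%:E = (\int[mu]_(x in A) k x y)%:E)%E.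
  move=> By; have ik : rintegrable A (k^~ y).
    have iab : rintegrable A (fun x => b y * a x) by exact: rintegrableZl.
    apply: (rintegrable_le mA _ iab) => [|x Ax]; [exact: jmeas2|].
    by rewrite mulrC; exact: kab.
  rewrite /Rintegral fineK ?integrable_fin_num// integral_mkcond.
  apply: eq_integral => x _; rewrite /k' /= patchE !indicE (mem_set By) mul1r.
  by case: ifP; rewrite ?mul1r ?mul0r.
have := Fubini ik' => H.
rewrite /Rintegral; congr fine.
transitivity (\int[mu]_x \int[mu]_y (EFin \o k') (x, y))%E; last rewrite H.
- rewrite integral_mkcond; apply: eq_integral => x _; rewrite patchE.
  case: ifPn => [/set_mem/fx <-//|xA].
  by rewrite integral0_eq// => y _; rewrite /k' /= indicE (negbTE xA) mul0r.
- rewrite [RHS]integral_mkcond; apply: eq_integral => y _; rewrite patchE.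
  case: ifPn => [/set_mem/fy <-//|yB].
  by rewrite integral0_eq// => x _; rewrite /k' /= !indicE (negbTE yB) mul0r mulr0.
Qed.

Lemma cFubini A B (K : R -> R -> R[i]) (a b : R -> R) :
  measurable A -> measurable B -> jcmeas K -> rintegrable A a -> rintegrable B b ->
  (forall x y, A x -> B y -> cabs (K x y) <= a x * b y) ->
  cint A (fun x => cint B (K x)) = cint B (fun y => cint A (K^~ y)).
Proof.
move=> mA mB [m1 m2] ia ib Kab; apply: complex_eq.
- have H := @Fubini_dominated A B (fun x y => complex.Re (K x y)) a b mA mB m1 ia ib.
  rewrite [LHS]Re_cint [RHS]Re_cint.
  rewrite (@eq_Rintegral _ _ _ mu A (fun x => \int[mu]_(y in B) complex.Re (K x y))); last first.
    by move=> x _; rewrite Re_cint.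
  rewrite H => [|x y Ax By]; last exact: le_trans (ler_Re_cabs _) (Kab _ _ Ax By).
  by apply: eq_Rintegral => y _; rewrite [RHS]Re_cint.
- have H := @Fubini_dominated A B (fun x y => complex.Im (K x y)) a b mA mB m2 ia ib.
  rewrite [LHS]Im_cint [RHS]Im_cint.
  rewrite (@eq_Rintegral _ _ _ mu A (fun x => \int[mu]_(y in B) complex.Im (K x y))); last first.
    by move=> x _; rewrite Im_cint.
  rewrite H => [|x y Ax By]; last exact: le_trans (ler_Im_cabs _) (Kab _ _ Ax By).
  by apply: eq_Rintegral => y _; rewrite [RHS]Im_cint.
Qed.

End FubiniDominated.
(** * Convergence *)

#[global] Instance lebesgue_ae_filter (R : realType) :
  Filter (nbhs (almost_everywhere (@lebesgue_measure R))).
Proof. exact: (ae_filter_ringOfSetsType (@lebesgue_measure R)). Qed.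

Section Limits.
Context {R : realType}.
Local Notation mu := (@lebesgue_measure R).
Implicit Types (A B : set R) (f g : R -> R[i]) (h b : R -> R).

Lemma measurable_segment (a b : R) : measurable (`[a, b]%classic : set R).
Proof. exact: measurable_itv. Qed.

Lemma EFin_Rintegral A h : measurable A -> rintegrable A h ->
  (\int[mu]_(x in A) (h x)%:E = (\int[mu]_(x in A) h x)%:E)%E.
Proof. by move=> mA ih; rewrite /Rintegral fineK//; exact: integrable_fin_num ih. Qed.

Lemma cvg_le_dist (u e : nat -> R) (l : R) :
  (forall n, `|u n - l| <= e n) -> e @ \oo --> 0 -> u @ \oo --> l.
Proof.
move=> ue e0; apply/subr_cvg0/norm_cvg0P.
apply: (squeeze_cvgr _ (cvg_cst 0) e0).
by apply: nearW => n; rewrite normr_ge0 ue.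
Qed.

Lemma ccvg_le (u : nat -> R[i]) l (e : nat -> R) :
  (forall n, cabs (u n - l) <= e n) -> e @ \oo --> 0 -> ccvg u l.
Proof.
move=> ue e0; apply: (cvg_le_dist _ e0) => n.
by rewrite subr0 ger0_norm ?cabs_ge0.
Qed.

Lemma ccvgP (u : nat -> R[i]) l : ccvg u l <->
  (fun n => complex.Re (u n)) @ \oo --> complex.Re l /\
  (fun n => complex.Im (u n)) @ \oo --> complex.Im l.
Proof.
split=> [ul|[ul1 ul2]].
- split; apply: (cvg_le_dist _ ul) => n.
  + by rewrite -ReN -ReD ler_Re_cabs.
  + by rewrite -ImN -ImD ler_Im_cabs.
- have h1 : (fun n => `|complex.Re (u n) - complex.Re l|) @ \oo --> 0.
    by apply/norm_cvg0P/subr_cvg0.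
  have h2 : (fun n => `|complex.Im (u n) - complex.Im l|) @ \oo --> 0.
    by apply/norm_cvg0P/subr_cvg0.
  have e0 : (fun n => `|complex.Re (u n) - complex.Re l| + `|complex.Im (u n) - complex.Im l|)
      @ \oo --> 0 by rewrite -(addr0 0); exact: cvgD h1 h2.
  apply: (ccvg_le _ e0) => n.
  by rewrite (le_trans (ler_cabs_ReIm _))// ReD ImD ReN ImN.
Qed.

Lemma ccvgZ (u : nat -> R[i]) z l : ccvg u l -> ccvg (fun n => z * u n) (z * l).
Proof.
move=> ul; have e0 : (fun n => cabs z * cabs (u n - l)) @ \oo --> 0.
  by rewrite -(mulr0 (cabs z)); exact: cvgMr ul.
apply: (ccvg_le _ e0) => n.
by rewrite -mulrBr cabsM.
Qed.

Lemma ccvg_unique (u : nat -> R[i]) k l : ccvg u k -> ccvg u l -> k = l.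
Proof.
move=> /ccvgP[a1 a2] /ccvgP[b1 b2]; apply: complex_eq.
- exact: (cvg_unique _ a1 b1).
- exact: (cvg_unique _ a2 b2).
Qed.

Lemma eq_ccvg (u v : nat -> R[i]) l : (forall n, u n = v n) -> ccvg u l -> ccvg v l.
Proof. by move=> /funext ->. Qed.

Lemma dominated_cvg_real A (h_ : nat -> R -> R) h b : measurable A ->
  (forall n, measurable_fun setT (h_ n)) -> measurable_fun setT h ->
  {ae mu, forall x, A x -> (fun n => h_ n x) @ \oo --> h x} ->
  rintegrable A b ->
  {ae mu, forall x, forall n, A x -> `|h_ n x| <= b x} ->
  rintegrable A h /\
  (fun n => \int[mu]_(x in A) h_ n x) @ \oo --> \int[mu]_(x in A) h x.
Proof.
move=> mA mh_ mh cvgh ib hb.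
have [||||ih _ c] := @dominated_convergence _ _ _ mu A mA
   (fun n => EFin \o h_ n) (EFin \o h) (EFin \o b) _ _ _ ib.
- by move=> n; apply/measurable_EFinP; exact: (measurable_funTS (mh_ n)).
- by apply/measurable_EFinP; exact: measurable_funTS.
- by apply: filterS cvgh => x /= H Ax; apply: cvg_EFin; [exact: nearW|exact: H].
- by apply: filterS hb => x /= H n Ax; rewrite lee_fin; exact: H.
split => //; apply: fine_cvg; rewrite /Rintegral fineK//.
exact: integrable_fin_num.
Qed.

Lemma dominated_ccvg A (f_ : nat -> R -> R[i]) f b : measurable A ->
  (forall n, cmeas (f_ n)) -> cmeas f ->
  {ae mu, forall x, A x -> ccvg (fun n => f_ n x) (f x)} ->
  rintegrable A b ->
  {ae mu, forall x, forall n, A x -> cabs (f_ n x) <= b x} ->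
  cintegrable A f /\ ccvg (fun n => cint A (f_ n)) (cint A f).
Proof.
move=> mA mf_ mf cf ib fb.
have [|||||i1 c1] := @dominated_cvg_real A (fun n x => complex.Re (f_ n x))
  (fun x => complex.Re (f x)) b mA.
- by move=> n; have [] := mf_ n.
- by have [] := mf.
- by apply: filterS cf => x H Ax; have /ccvgP[] := H Ax.
- by [].
- by apply: filterS fb => x H n Ax; rewrite (le_trans (ler_Re_cabs _))// H.
have [|||||i2 c2] := @dominated_cvg_real A (fun n x => complex.Im (f_ n x))
  (fun x => complex.Im (f x)) b mA.
- by move=> n; have [] := mf_ n.
- by have [] := mf.
- by apply: filterS cf => x H Ax; have /ccvgP[] := H Ax.
- by [].
- by apply: filterS fb => x H n Ax; rewrite (le_trans (ler_Im_cabs _))// H.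
split; first by split.
apply/ccvgP; split.
- by under eq_fun do rewrite Re_cint; rewrite Re_cint.
- by under eq_fun do rewrite Im_cint; rewrite Im_cint.
Qed.

Lemma near_itvnn (x : R) : \forall n \near \oo, (- n%:R <= x <= n%:R).
Proof.
near=> n; have : `|x| <= n%:R by near: n; exact: nbhs_infty_ger.
by rewrite ler_norml.
Unshelve. all: by end_near. Qed.

Lemma cvg_Rintegral_itvnn h : measurable_fun setT h -> rintegrable setT h ->
  (fun n : nat => \int[mu]_(x in `[- n%:R, n%:R]) h x) @ \oo --> \int[mu]_x h x.
Proof.
move=> mh ih; under eq_fun do rewrite Rintegral_mkcond.
have [|||||] // := @dominated_cvg_real setT (fun n : nat => h \_ `[- n%:R, n%:R])
  h (fun x => `|h x|) measurableT.
- move=> n; apply/(measurable_restrictT _ _).1 => //.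
  exact: measurable_funTS.
- apply: aeW => x _; apply: cvg_near_cst; apply: filterS (near_itvnn x) => n hn.
  by rewrite patchE mem_set//= in_itv.
- exact: rintegrable_norm.
- by apply: aeW => x n _; rewrite patchE; case: ifP => //; rewrite normr0.
Qed.

Lemma ccvg_cint_itvnn f : cmeas f -> cintegrable setT f ->
  ccvg (fun n : nat => cint `[- n%:R, n%:R] f) (cint setT f).
Proof.
move=> [m1 m2] [i1 i2]; apply/ccvgP; split.
- by under eq_fun do rewrite Re_cint; rewrite Re_cint; exact: cvg_Rintegral_itvnn.
- by under eq_fun do rewrite Im_cint; rewrite Im_cint; exact: cvg_Rintegral_itvnn.
Qed.

Lemma Rintegral_eq0_ae A h : measurable A -> measurable_fun setT h ->
  (forall x, 0 <= h x) -> rintegrable A h -> \int[mu]_(x in A) h x = 0 ->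
  {ae mu, forall x, A x -> h x = 0}.
Proof.
move=> mA mh h0 ih ih0.
have mE : measurable_fun A (EFin \o h).
  by apply/measurable_EFinP; exact: measurable_funTS.
have /(ae_eq_integral_abs mu mA mE) : (\int[mu]_(x in A) `|(EFin \o h) x| = 0)%E.
  under eq_integral do rewrite /= ger0_norm//.
  by rewrite EFin_Rintegral// ih0.
by apply: filterS => x /= H Ax; have := H Ax => -[].
Qed.

(** By monotone convergence the series of the [F n] has integral at most [M], hence is finite almost
    everywhere, and its value serves as [S]. This is the passage from L^1 bounds to pointwise
    bounds, used both for domination and for convergence to 0. *)
Lemma ae_bounded_partial_sums A (F : nat -> R -> R) (M : R) : measurable A ->
  (forall n, measurable_fun setT (F n)) -> (forall n x, 0 <= F n x) ->
  (forall n, rintegrable A (F n)) ->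
  (forall N, \sum_(n < N) \int[mu]_(x in A) F n x <= M) ->
  {ae mu, forall x, A x -> exists S, forall N, \sum_(n < N) F n x <= S}.
Proof.
move=> mA mF F0 iF FM.
pose G x := (\sum_(0 <= n <oo) (F n x)%:E)%E.
have mE n : measurable_fun A (EFin \o F n).
  by apply/measurable_EFinP; exact: (measurable_funTS (mF n)).
have F0E n x : A x -> (0 <= (EFin \o F n) x)%E by move=> _; rewrite lee_fin.
have G0 x : (0 <= G x)%E by apply: nneseries_ge0 => n _ _; rewrite lee_fin.
have iG : mu.-integrable A G.
  apply/integrableP; split.
    by apply: (@ge0_emeasurable_sum _ _ _ _ (fun n => EFin \o F n)) => // n x Ax _; exact: F0E.
  under eq_integral do rewrite gee0_abs//.
  rewrite (integral_nneseries mu mA mE F0E).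
  apply: (@le_lt_trans _ _ M%:E); last by rewrite ltry.
  apply: lime_le; first by apply: is_cvg_nneseries => n _ _; apply: integral_ge0 => x; exact: F0E.
  apply: nearW => N; rewrite big_mkord.
  apply: le_trans (_ : ((\sum_(n < N) \int[mu]_(x in A) F n x)%:E <= _)%E); last by rewrite lee_fin.
  by rewrite -sumEFin lee_sum// => i _; rewrite EFin_Rintegral.
have aG : {ae mu, forall x : R, A x -> G x \is a fin_num} :=
  @integrable_ae _ _ _ mu A mA G iG.
apply: filterS aG => x H Ax.
have Gf := H Ax; exists (fine (G x)) => N.
rewrite -lee_fin fineK// -sumEFin -(big_mkord xpredT (fun n => (F n x)%:E)).
by apply: nneseries_lim_ge => n _ _; rewrite lee_fin.
Qed.

Lemma measurable_shift (a : R) : measurable_fun setT (fun x : R => x + a).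
Proof. by apply: measurable_funD => //; exact: measurable_cst. Qed.

(** The shifted measure agrees with Lebesgue measure on half-open intervals, and these determine
    it. *)
Lemma lebesgue_measure_shift (a : R) (A : set R) : measurable A ->
  pushforward mu ((fun x => x + a) : _ -> measurableTypeR R) A = mu A.
Proof.
move=> mA; apply/esym/lebesgue_measure_unique => //=.
  exact: measurable_shift.
move=> _ _ [[x y]] _ <-.
rewrite /pushforward /= (_ : _ @^-1` _ = `]x - a, y - a]%classic); last first.
  by apply/seteqP; split => z /=; rewrite !in_itv/= ltrBlDr lerBrDr.
by rewrite !lebesgue_measure_itv/= !lte_fin ltrD2r; case: ifP => // _; rewrite -!EFinB; congr (_%:E); ring.
Qed.

Lemma ge0_integral_shift (h : R -> \bar R) (a : R) : measurable_fun setT h ->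
  (forall x, 0 <= h x)%E -> (\int[mu]_x h (x + a)%R = \int[mu]_x h x)%E.
Proof.
move=> mh h0.
have := @ge0_integral_pushforward _ _ (measurableTypeR R) (measurableTypeR R) R
  (fun x => x + a) (measurable_shift a) mu setT h measurableT mh (fun y _ => h0 y).
rewrite preimage_setT => <-; apply: eq_measure_integral => /=; first exact: measurable_shift.
by move=> _ B mB _; exact: lebesgue_measure_shift.
Qed.

Lemma ge0_Rintegral_shift h (a : R) : measurable_fun setT h ->
  (forall x, 0 <= h x) -> \int[mu]_x h (x + a) = \int[mu]_x h x.
Proof.
move=> mh h0; congr fine; apply: (@ge0_integral_shift (EFin \o h)).
- exact/measurable_EFinP.
- by move=> x; rewrite lee_fin.
Qed.

Lemma ge0_rintegrable_shift h (a : R) : measurable_fun setT h ->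
  (forall x, 0 <= h x) -> rintegrable setT h -> rintegrable setT (fun x => h (x + a)).
Proof.
move=> mh h0 /integrableP[_ ih]; apply/integrableP; split.
  by apply/measurable_EFinP; exact: (measurableT_comp mh (measurable_shift a)).
rewrite (@ge0_integral_shift (fun x => `|(EFin \o h) x|%E))//.
by apply: measurableT_comp => //; exact/measurable_EFinP.
Qed.

Lemma eq_ae_Rintegral A h b : measurable A -> measurable_fun setT h -> measurable_fun setT b ->
  {ae mu, forall x, A x -> h x = b x} ->
  \int[mu]_(x in A) h x = \int[mu]_(x in A) b x.
Proof.
move=> mA mh mb hb; congr fine; apply: ae_eq_integral => //.
- by apply/measurable_EFinP; exact: measurable_funTS.
- by apply/measurable_EFinP; exact: measurable_funTS.
- by apply: filterS hb => x /= H Ax; rewrite H.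
Qed.

Lemma eq_ae_cint A f g : measurable A -> cmeas f -> cmeas g ->
  {ae mu, forall x, A x -> f x = g x} -> cint A f = cint A g.
Proof.
move=> mA [f1 f2] [g1 g2] fg; apply: complex_eq; rewrite !(Re_cint, Im_cint);
  by apply: eq_ae_Rintegral => //; apply: filterS fg => x H Ax; rewrite H.
Qed.

Definition crestrict A f x : R[i] := if x \in A then f x else 0.

Lemma cint_mkcond A f : cint A f = cint setT (crestrict A f).
Proof.
apply: complex_eq; rewrite !(Re_cint, Im_cint) Rintegral_mkcond;
  by apply: eq_Rintegral => x _; rewrite !patchE /crestrict; case: ifP.
Qed.

Lemma measurable_restrictR A h : measurable A -> measurable_fun setT h ->
  measurable_fun setT (h \_ A).
Proof.
by move=> mA mh; apply/(measurable_restrictT _ _).1 => //; exact: measurable_funTS.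
Qed.

Lemma cmeas_restrict A f : measurable A -> cmeas f -> cmeas (crestrict A f).
Proof.
move=> mA [f1 f2]; split.
- rewrite (_ : (fun x => _) = (fun x => complex.Re (f x)) \_ A); first exact: measurable_restrictR.
  by apply/funext => x; rewrite !patchE /crestrict; case: ifP.
- rewrite (_ : (fun x => _) = (fun x => complex.Im (f x)) \_ A); first exact: measurable_restrictR.
  by apply/funext => x; rewrite !patchE /crestrict; case: ifP.
Qed.

Lemma cintegrable_mkcond A f : measurable A ->
  cintegrable A f <-> cintegrable setT (crestrict A f).
Proof.
move=> mA; rewrite /cintegrable !(rintegrable_mkcond _ mA).
suff [-> ->] : (fun x => complex.Re (f x)) \_ A = (fun x => complex.Re (crestrict A f x)) /\
   (fun x => complex.Im (f x)) \_ A = (fun x => complex.Im (crestrict A f x)) by [].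
by split; apply/funext => x; rewrite patchE /crestrict; case: ifP.
Qed.

End Limits.
(** * Square-integrable functions *)

Section SquareIntegrable.
Context {R : realType}.
Local Notation mu := (@lebesgue_measure R).
Implicit Types (A B : set R) (f g : R -> R[i]) (u v : R -> R).

(** Squared norm as a real number. By the default of [Rintegral] it would be 0 for infinite energy,
    so it goes together with [L2]. *)
Definition nrm2 A f : R := \int[mu]_(x in A) cabs (f x) ^+ 2.

(** [inner] is the case [A = setT]; the case [A = ]-1, 1[] is the second product for which the
    [psi n] are orthogonal. *)
Definition ip A f g : R[i] := cint A (fun t => f t * conjc (g t)).

Definition L2 f := cmeas f /\ rintegrable setT (fun x => cabs (f x) ^+ 2).

Lemma measurable_cabs2 f : cmeas f -> measurable_fun setT (fun x => cabs (f x) ^+ 2).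
Proof. by move=> mf; apply: measurable_funX; exact: measurable_cabs. Qed.

Lemma Lp2E f : Lp 2 f <-> L2 f.
Proof.
have e : (\int[mu]_x `|(cabs (f x) ^+ 2)%:E| = \int[mu]_x ((cabs (f x)) `^ 2)%:E)%E.
  apply: eq_integral => x _; rewrite -[2]/(2%:R) powR_mulrn ?cabs_ge0//.
  by rewrite abse_EFin ger0_norm ?sqr_ge0.
split=> -[mf fi]; split => //.
- apply/integrableP; split; last by rewrite e.
  by apply/measurable_EFinP; exact: measurable_cabs2.
- by rewrite -e; case/integrableP: fi.
Qed.

Lemma L2_meas f : L2 f -> cmeas f. Proof. by case. Qed.

Lemma L2_sqr A f : measurable A -> L2 f -> rintegrable A (fun x => cabs (f x) ^+ 2).
Proof. by move=> mA [_]; exact: rintegrableS. Qed.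

Lemma l2sqE A f : measurable A -> L2 f -> l2sq A f = (nrm2 A f)%:E.
Proof. by move=> mA fL; rewrite /l2sq EFin_Rintegral//; exact: L2_sqr. Qed.

Lemma nrm2_ge0 A f : 0 <= nrm2 A f.
Proof. by apply: Rintegral_ge0 => x _; exact: sqr_ge0. Qed.

Lemma l2normE A f : measurable A -> L2 f -> l2norm A f = Num.sqrt (nrm2 A f).
Proof. by move=> mA fL; rewrite /l2norm l2sqE. Qed.

Lemma L2_mul A f g : measurable A -> L2 f -> L2 g ->
  rintegrable A (fun x => cabs (f x) * cabs (g x)).
Proof.
move=> mA fL gL.
have ii := rintegrableD mA (L2_sqr mA fL) (L2_sqr mA gL).
apply: (rintegrable_le mA _ ii) => [|x _].
  by apply: measurable_funM; apply: measurable_cabs; [case: fL|case: gL].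
rewrite ger0_norm ?mulr_ge0 ?cabs_ge0//.
have h := sqr_ge0 (cabs (f x) - cabs (g x)).
by have := cabs_ge0 (f x); have := cabs_ge0 (g x); nra.
Qed.

Lemma L2_ip A f g : measurable A -> L2 f -> L2 g ->
  cintegrable A (fun x => f x * conjc (g x)).
Proof.
move=> mA fL gL; apply: (cintegrable_le mA _ (L2_mul mA fL gL)).
- by apply: cmeasM; [case: fL|apply: cmeas_conj; case: gL].
- by move=> x _; rewrite cabsM cabs_conj.
Qed.

Lemma L2D f g : L2 f -> L2 g -> L2 (fun x => f x + g x).
Proof.
move=> fL gL; split; first by apply: cmeasD; [case: fL|case: gL].
have ii := rintegrableZl 2 measurableT (rintegrableD measurableT fL.2 gL.2).
apply: (rintegrable_le measurableT _ ii) => [|x _].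
  by apply: measurable_cabs2; apply: cmeasD; [case: fL|case: gL].
rewrite ger0_norm ?sqr_ge0//.
have h := ler_cabsD (f x) (g x); have h1 := cabs_ge0 (f x + g x).
have h2 := sqr_ge0 (cabs (f x) - cabs (g x)).
have h3 : cabs (f x + g x) ^+ 2 <= (cabs (f x) + cabs (g x)) ^+ 2.
  by rewrite ler_pXn2r// nnegrE// addr_ge0 ?cabs_ge0.
by nra.
Qed.

Lemma L2Z z f : L2 f -> L2 (fun x => z * f x).
Proof.
move=> [mf fi]; split; first by apply: cmeasM => //; exact: cmeas_cst.
under eq_fun do rewrite cabsM exprMn.
exact: rintegrableZl.
Qed.

Lemma L2N f : L2 f -> L2 (fun x => - f x).
Proof.
by move=> [mf fi]; split; [exact: cmeasN|under eq_fun do rewrite cabsN].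
Qed.

Lemma L2B f g : L2 f -> L2 g -> L2 (fun x => f x - g x).
Proof. by move=> fL gL; apply: L2D => //; exact: L2N. Qed.

Lemma L20 : L2 (fun=> 0 : R[i]).
Proof.
by split; [exact: cmeas_cst|under eq_fun do rewrite cabs0 expr0n /=; exact: integrable0].
Qed.

Lemma L2_sum (I : Type) (r : seq I) (F : I -> R -> R[i]) :
  (forall i, L2 (F i)) -> L2 (fun x => \sum_(i <- r) F i x).
Proof.
move=> FL; elim: r => [|i r IH]; first by under eq_fun do rewrite big_nil; exact: L20.
by under eq_fun do rewrite big_cons; exact: L2D.
Qed.

Lemma L2_le f g : cmeas f -> L2 g -> (forall x, cabs (f x) <= cabs (g x)) -> L2 f.
Proof.
move=> mf [mg gi] fg; split => //.
apply: (rintegrable_le measurableT _ gi) => [|x _]; first exact: measurable_cabs2.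
by rewrite ger0_norm ?sqr_ge0// ler_pXn2r ?nnegrE ?cabs_ge0.
Qed.

Lemma L2_restrict A f : measurable A -> L2 f -> L2 (crestrict A f).
Proof.
move=> mA [mf fi]; apply: (@L2_le _ f) => //; first exact: cmeas_restrict.
by move=> x; rewrite /crestrict; case: ifP; rewrite ?cabs0 ?cabs_ge0.
Qed.

Lemma nrm2S A B f : measurable A -> measurable B -> A `<=` B -> L2 f ->
  nrm2 A f <= nrm2 B f.
Proof.
move=> mA mB AB fL; rewrite -lee_fin -!l2sqE//.
apply: ge0_subset_integral => //.
- by apply/measurable_EFinP; exact: (measurable_funTS (measurable_cabs2 (L2_meas fL))).
- by move=> x _; rewrite lee_fin sqr_ge0.
Qed.

Lemma ipDl A f g h : measurable A -> L2 f -> L2 g -> L2 h ->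
  ip A (fun x => f x + g x) h = ip A f h + ip A g h.
Proof.
move=> mA fL gL hL; rewrite /ip -cintD//; try exact: L2_ip.
by apply: eq_cint => x _; rewrite mulrDl.
Qed.

Lemma ipZl A z f g : measurable A -> L2 f -> L2 g ->
  ip A (fun x => z * f x) g = z * ip A f g.
Proof.
move=> mA fL gL; rewrite /ip -cintZl//; try exact: L2_ip.
by apply: eq_cint => x _; rewrite mulrA.
Qed.

Lemma ipC A f g : measurable A -> L2 f -> L2 g -> ip A g f = conjc (ip A f g).
Proof.
move=> mA fL gL; rewrite /ip -cint_conj//; try exact: L2_ip.
by apply: eq_cint => x _; rewrite conjcM conjcK mulrC.
Qed.

Lemma ipNl A f g : measurable A -> L2 f -> L2 g -> ip A (fun x => - f x) g = - ip A f g.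
Proof.
move=> mA fL gL; rewrite -mulN1r -ipZl//.
by apply: eq_cint => x _; rewrite mulN1r.
Qed.

Lemma ipBl A f g h : measurable A -> L2 f -> L2 g -> L2 h ->
  ip A (fun x => f x - g x) h = ip A f h - ip A g h.
Proof. by move=> mA fL gL hL; rewrite ipDl ?ipNl//; exact: L2N. Qed.

Lemma ip_suml A (I : Type) (r : seq I) (F : I -> R -> R[i]) g : measurable A ->
  (forall i, L2 (F i)) -> L2 g ->
  ip A (fun x => \sum_(i <- r) F i x) g = \sum_(i <- r) ip A (F i) g.
Proof.
move=> mA FL gL; rewrite /ip -cint_sum//; last by move=> i; exact: L2_ip.
by apply: eq_cint => x _; rewrite mulr_suml.
Qed.

Lemma ipDr A f g h : measurable A -> L2 f -> L2 g -> L2 h ->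
  ip A h (fun x => f x + g x) = ip A h f + ip A h g.
Proof.
move=> mA fL gL hL.
by rewrite (ipC mA (L2D fL gL) hL) ipDl// conjcD -(ipC mA fL hL) -(ipC mA gL hL).
Qed.

Lemma ipBr A f g h : measurable A -> L2 f -> L2 g -> L2 h ->
  ip A h (fun x => f x - g x) = ip A h f - ip A h g.
Proof.
move=> mA fL gL hL.
by rewrite (ipC mA (L2B fL gL) hL) ipBl// conjcB -(ipC mA fL hL) -(ipC mA gL hL).
Qed.

Lemma ipZr A z f g : measurable A -> L2 f -> L2 g ->
  ip A f (fun x => z * g x) = conjc z * ip A f g.
Proof.
by move=> mA fL gL; rewrite (ipC mA (L2Z z gL) fL) ipZl// conjcM -(ipC mA gL fL).
Qed.

Lemma ip_self A f : ip A f f = (nrm2 A f)%:C.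
Proof.
by rewrite /ip /nrm2 -cint_real; apply: eq_cint => x _; rewrite mulc_conj.
Qed.

Lemma nrm2E A f : nrm2 A f = complex.Re (ip A f f).
Proof. by rewrite ip_self. Qed.

Lemma nrm2D A f g : measurable A -> L2 f -> L2 g ->
  nrm2 A (fun x => f x + g x) = nrm2 A f + 2 * complex.Re (ip A f g) + nrm2 A g.
Proof.
move=> mA fL gL; have fgL := L2D fL gL.
rewrite nrm2E ipDl// !ipDr// !ip_self (ipC mA fL gL).
by move: (ip A f g) => z; rewrite !ReD Re_conj /=; ring.
Qed.

Lemma nrm2B A f g : measurable A -> L2 f -> L2 g ->
  nrm2 A (fun x => f x - g x) = nrm2 A f - 2 * complex.Re (ip A f g) + nrm2 A g.
Proof.
move=> mA fL gL; have fgL := L2B fL gL.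
rewrite nrm2E ipBl// !ipBr// !ip_self (ipC mA fL gL).
by move: (ip A f g) => z; rewrite !(ReD, ReN) Re_conj /=; ring.
Qed.

Lemma nrm2Z A z f : measurable A -> L2 f ->
  nrm2 A (fun x => z * f x) = cabs z ^+ 2 * nrm2 A f.
Proof.
move=> mA fL; rewrite /nrm2 -RintegralZl//; last exact: L2_sqr.
by apply: eq_Rintegral => x _; rewrite cabsM exprMn.
Qed.

Lemma nrm2D_le A f g : measurable A -> L2 f -> L2 g ->
  nrm2 A (fun x => f x + g x) <= 2 * nrm2 A f + 2 * nrm2 A g.
Proof.
move=> mA fL gL; have := nrm2_ge0 A (fun x => f x - g x).
by rewrite nrm2B// nrm2D//; lra.
Qed.

(* The discriminant of the nonnegative quadratic [t |-> \int (u - t v)^2]. *)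
Lemma CauchySchwarz_real A u v : measurable A ->
  measurable_fun setT u -> measurable_fun setT v ->
  (forall x, 0 <= u x) -> (forall x, 0 <= v x) ->
  rintegrable A (fun x => u x ^+ 2) -> rintegrable A (fun x => v x ^+ 2) ->
  rintegrable A (fun x => u x * v x) /\
  (\int[mu]_(x in A) (u x * v x)) ^+ 2 <=
  \int[mu]_(x in A) u x ^+ 2 * \int[mu]_(x in A) v x ^+ 2.
Proof.
move=> mA mu_ mv u0 v0 iu iv.
have iuv : rintegrable A (fun x => u x * v x).
  apply: (rintegrable_le mA _ (rintegrableD mA iu iv)) => [|x _].
    exact: measurable_funM.
  rewrite ger0_norm ?mulr_ge0//.
  by have := sqr_ge0 (u x - v x); have := u0 x; have := v0 x; nra.
split => //; set C := \int[mu]_(x in A) (u x * v x).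
set U := \int[mu]_(x in A) _; set V := \int[mu]_(x in A) _.
have key t : 0 < t -> 2 * t * C <= U + t ^+ 2 * V.
  move=> t0; rewrite -!RintegralZl// -RintegralD//; last exact: rintegrableZl.
  apply: ler_Rintegral => //; first exact: rintegrableZl.
    by apply: rintegrableD => //; exact: rintegrableZl.
  by move=> x _; have := sqr_ge0 (u x - t * v x); nra.
have C0 : 0 <= C by apply: Rintegral_ge0 => x _; rewrite mulr_ge0.
have U0 : 0 <= U by apply: Rintegral_ge0 => x _; rewrite sqr_ge0.
have V0 : 0 <= V by apply: Rintegral_ge0 => x _; rewrite sqr_ge0.
have [VE|Vn] := eqVneq V 0.
  have [->|Cn] := eqVneq C 0; first by rewrite expr0n mulr_ge0.
  have Cp : 0 < C by rewrite lt0r Cn.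
  (* With [V = 0] the bound [key] is linear in [t], and this value turns it into
     [2 (U + 1) <= U]. *)
  have := key ((U + 1) / C) (divr_gt0 _ Cp).
  rewrite VE mulr0 addr0 -mulrA divfK//.
  have : 0 < U + 1 by lra.
  by move=> /[swap] /[apply]; lra.
have Vp : 0 < V by rewrite lt0r Vn.
have [->|Cn] := eqVneq C 0; first by rewrite expr0n mulr_ge0.
have Cp : 0 < C by rewrite lt0r Cn.
have := key (C / V) (divr_gt0 Cp Vp).
rewrite -(ler_pM2r Vp).
have -> : 2 * (C / V) * C * V = 2 * C ^+ 2 by field.
have -> : (U + (C / V) ^+ 2 * V) * V = U * V + C ^+ 2 by field.
lra.
Qed.

Lemma CauchySchwarz A f g : measurable A -> L2 f -> L2 g ->
  cabs (ip A f g) ^+ 2 <= nrm2 A f * nrm2 A g.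
Proof.
move=> mA fL gL.
have mfg : cmeas (fun x => f x * conjc (g x)).
  by apply: cmeasM; [case: fL|apply: cmeas_conj; case: gL].
have h := ler_cabs_cint mA mfg (L2_ip mA fL gL).
have [] := @CauchySchwarz_real A (fun x => cabs (f x)) (fun x => cabs (g x)) mA.
- by apply: measurable_cabs; case: fL.
- by apply: measurable_cabs; case: gL.
- by move=> x; exact: cabs_ge0.
- by move=> x; exact: cabs_ge0.
- exact: L2_sqr.
- exact: L2_sqr.
move=> _; apply: le_trans.
rewrite ler_pXn2r ?nnegrE ?cabs_ge0//; last first.
- by apply: Rintegral_ge0 => x _; rewrite mulr_ge0 ?cabs_ge0.
- apply: (le_trans h); rewrite le_eqVlt; apply/orP; left; apply/eqP.
  by apply: eq_Rintegral => x _; rewrite cabsM cabs_conj.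
Qed.

Lemma eq_ae_nrm2 A f g : measurable A -> cmeas f -> cmeas g ->
  {ae mu, forall x, A x -> f x = g x} -> nrm2 A f = nrm2 A g.
Proof.
move=> mA mf mg fg; apply: eq_ae_Rintegral => //; try exact: measurable_cabs2.
by apply: filterS fg => x H Ax; rewrite H.
Qed.

Lemma rintegrable_cst A (k : R) : measurable A -> (mu A < +oo)%E -> rintegrable A (fun=> k).
Proof.
move=> mA Aoo; apply/integrableP; split.
  by apply/measurable_EFinP; exact: measurable_cst.
by rewrite /= integral_cst// lte_mul_pinfty.
Qed.

Lemma L2_bounded A f M : measurable A -> (mu A < +oo)%E -> cmeas f ->
  (forall x, A x -> cabs (f x) <= M) -> (forall x, ~ A x -> f x = 0) -> L2 f.
Proof.
move=> mA Aoo mf fM f0; split => //.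
have e : (fun x => cabs (f x) ^+ 2) = (fun x => cabs (f x) ^+ 2) \_ A.
  apply/funext => x; rewrite patchE; case: ifPn => // /negP xA.
  by rewrite f0 ?cabs0 ?expr0n// => Ax; apply: xA; rewrite inE.
rewrite e; apply/(rintegrable_mkcond _ mA).
apply: (@rintegrable_le _ _ _ (cst (M ^+ 2))) => //.
- exact: measurable_cabs2.
- exact: rintegrable_cst.
- move=> x Ax; rewrite ger0_norm ?sqr_ge0// ler_pXn2r ?nnegrE ?cabs_ge0 ?fM//.
  exact: le_trans (cabs_ge0 (f x)) (fM x Ax).
Qed.

End SquareIntegrable.
Opaque cint cexpi.

(** * The Poisson kernel and Bessel's inequality *)

Section PoissonKernel.
Context {R : realType}.
Local Notation mu := (@lebesgue_measure R).
Implicit Types (f F h g G : R -> R).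

(** A derivative valid on the whole line: the differentiation rules then compose as terms, and a
    final [der_eq] brings the result to the wanted form. *)
Definition der F f := forall x : R, is_derive x (1 : R) F (f x).

Lemma der_eq F f h : der F f -> (forall x, f x = h x) -> der F h.
Proof. by move=> dF fh x; rewrite -fh. Qed.

Lemma derD F G f g : der F f -> der G g -> der (fun x => F x + G x) (fun x => f x + g x).
Proof. by move=> dF dG x; exact: is_deriveD. Qed.

Lemma derM F G f g : der F f -> der G g ->
  der (fun x => F x * G x) (fun x => F x * g x + G x * f x).
Proof. by move=> dF dG x; exact: is_deriveM. Qed.

Lemma derZ (k : R) F f : der F f -> der (fun x => k * F x) (fun x => k * f x).
Proof. by move=> dF x; exact: is_deriveZ. Qed.

Lemma der_comp F G f g : der F f -> der G g ->
  der (fun x => F (G x)) (fun x => f (G x) * g x).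
Proof. by move=> dF dG x; exact: is_derive1_comp. Qed.

Lemma der_id : der id (fun=> 1).
Proof. by move=> x; exact: is_derive_id. Qed.

Lemma der_cst (k : R) : der (fun=> k) (fun=> 0).
Proof. by move=> x; exact: is_derive_cst. Qed.

Lemma der_linear (k : R) : der (fun x => k * x) (fun=> k).
Proof. by apply: der_eq (derZ k der_id) _ => x; rewrite mulr1. Qed.

Lemma is_derive_continuous F f : der F f -> continuous F.
Proof. by move=> dF x; apply/differentiable_continuous/derivable1_diffP; case: (dF x). Qed.

Lemma FTC_halfline f F (l : R) : (forall x, 0 <= f x) -> continuous f ->
  der F f -> F x @[x --> +oo] --> l ->
  (\int[mu]_(x in `[0%R, +oo[) (f x)%:E = (l - F 0)%:E)%E.
Proof.
move=> f0 cf dF Fl; rewrite (@ge0_continuous_FTC2y R f F 0 l)//.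
- exact: continuous_subspaceT.
- by move=> x _; case: (dF x).
- by apply: cvg_at_right_filter; exact: (is_derive_continuous dF).
- by move=> x _; rewrite derive1E; exact: derive_val.
Qed.

Lemma FTC_itv f F (a b : R) : a <= b -> continuous f ->
  der F f -> \int[mu]_(x in `[a, b]) f x = F b - F a.
Proof.
move=> ab cf dF; have cF := is_derive_continuous dF.
have [->|aDb] := eqVneq a b.
  by rewrite set_itv1 Rintegral_set1 subrr.
have altb : a < b by rewrite lt_neqAle aDb.
rewrite /Rintegral (@continuous_FTC2 R f F a b altb)//.
- exact: continuous_subspaceT.
- split => //.
  + by move=> x _; case: (dF x).
  + by apply: cvg_at_right_filter; exact: cF.
  + by apply: cvg_at_left_filter; exact: cF.
- by move=> x _; rewrite derive1E; exact: derive_val.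
Qed.

Lemma continuous_rintegrable_itv f (a b : R) : continuous f -> rintegrable `[a, b] f.
Proof.
move=> cf; apply: continuous_compact_integrable; first exact: segment_compact.
exact: continuous_subspaceT.
Qed.

Lemma ge0_Rintegral_even f : (forall x, 0 <= f x) -> continuous f ->
  (forall x, f (- x) = f x) ->
  (\int[mu]_x (f x)%:E = 2%:E * \int[mu]_(x in `[0%R, +oo[) (f x)%:E)%E.
Proof.
move=> f0 cf ef; rewrite ge0_symfun_integralT//; last by move=> x /=; rewrite ef.
by rewrite -set_itvcy.
Qed.

Lemma ge0_integral_reflect (h : R -> \bar R) : measurable_fun setT h ->
  (forall x, 0 <= h x)%E -> (\int[mu]_x h (- x)%R = \int[mu]_x h x)%E.
Proof.
move=> mh h0; have mN : measurable_fun setT (fun x : measurableTypeR R => (- x : measurableTypeR R)).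
  exact: oppr_measurable.
have := @ge0_integral_pushforward _ _ (measurableTypeR R) (measurableTypeR R) R
  (fun x => - x) mN mu setT h measurableT mh (fun y _ => h0 y).
rewrite preimage_setT => <-; apply: eq_measure_integral => /=.
by move=> B mB _; exact: lebesgue_measureN.
Qed.

Definition wexp (e x : R) : R := expR (- (e * `|x|)).

(** Fourier transform of the damping factor [wexp e], of total mass 1 and concentrating at 0 as [e]
    tends to 0. Both functions have elementary primitives, that of [poisson e] being an arctangent,
    so every integral below is explicit. *)
Definition poisson (e u : R) : R := 2 * e / (e ^+ 2 + (2 * pi * u) ^+ 2).

Lemma wexp_ge0 e x : 0 <= wexp e x. Proof. exact: expR_ge0. Qed.

Lemma wexp_le1 e x : 0 <= e -> wexp e x <= 1.
Proof. by move=> e0; rewrite -expR0 ler_expR oppr_le0 mulr_ge0. Qed.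

Lemma continuous_wexp e : continuous (wexp e).
Proof.
move=> x; rewrite /wexp; apply: continuous_comp; last exact: continuous_expR.
apply: continuousN; apply: continuousM; first exact: cvg_cst.
exact: norm_continuous.
Qed.

Lemma measurable_wexp e : measurable_fun setT (wexp e).
Proof. by apply: continuous_measurable_fun; exact: continuous_wexp. Qed.

Lemma cvg_expR_scale (e : R) : 0 < e -> expR (- (e * x)) @[x --> +oo] --> (0 : R).
Proof.
move=> e0; apply: (@cvg_comp _ _ _ (fun x => e * x) (fun x => expR (- x)) _ (pinfty_nbhs R)).
  exact: gt0_cvgMry.
exact: cvgr_expR.
Qed.

Lemma der_expRscale (e : R) :
  der (fun x => expR (- (e * x))) (fun x => - e * expR (- (e * x))).
Proof.
rewrite (_ : (fun x => expR _) = (fun x => expR (- e * x))); last first.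
  by apply/funext => x; rewrite mulNr.
apply: der_eq (der_comp (@is_derive_expR R) (der_linear (- e))) _ => x.
by rewrite mulrC -mulNr.
Qed.

Lemma der_sinscale (a : R) : der (fun x => sin (a * x)) (fun x => a * cos (a * x)).
Proof.
by apply: der_eq (der_comp (@is_derive_sin R) (der_linear a)) _ => x; rewrite mulrC.
Qed.

Lemma der_cosscale (a : R) : der (fun x => cos (a * x)) (fun x => - a * sin (a * x)).
Proof.
by apply: der_eq (der_comp (@is_derive_cos R) (der_linear a)) _ => x; rewrite mulrC mulrN mulNr.
Qed.

Lemma cvg_expR_bounded (e : R) (h : R -> R) (M : R) : 0 < e ->
  (forall x, `|h x| <= M) -> expR (- (e * x)) * h x @[x --> +oo] --> (0 : R).
Proof.
move=> e0 hM; apply/norm_cvg0P.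
have lim : M * expR (- (e * x)) @[x --> +oo] --> (0 : R).
  by rewrite -(mulr0 M); apply: cvgMr; exact: cvg_expR_scale.
apply: (squeeze_cvgr _ (cvg_cst 0) lim); apply: nearW => x.
by rewrite normr_ge0 /= normrM ger0_norm ?expR_ge0// mulrC ler_wpM2r ?expR_ge0.
Qed.

(** The constant [k] makes the integrand nonnegative, as the fundamental theorem on a half-line
    requires. Comparing [k = 1] with [k = 2] later separates the cosine integral from that of
    [wexp e]. *)
Lemma integral_wexp_cos (e a k : R) : 0 < e -> 1 <= k ->
  (\int[mu]_x (wexp e x * (k + cos (a * x)))%:E =
   (2 * k / e + 2 * e / (e ^+ 2 + a ^+ 2))%:E)%E.
Proof.
move=> e0 k1; have D0 : e ^+ 2 + a ^+ 2 != 0.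
  by rewrite gt_eqF// ltr_pwDl ?exprn_gt0 ?sqr_ge0.
have kc x : 0 <= k + cos (a * x) by have := @cos_geN1 R (a * x); lra.
rewrite ge0_Rintegral_even; last 3 first.
- by move=> x; rewrite mulr_ge0 ?wexp_ge0.
- move=> x; apply: continuousM; first exact: continuous_wexp.
  apply: continuousD; first exact: cvg_cst.
  exact: (is_derive_continuous (der_cosscale a)).
- by move=> x; rewrite /wexp normrN mulrN cosN.
pose f x := expR (- (e * x)) * (k + cos (a * x)).
pose F x := expR (- (e * x)) * (- (k / e) + (e ^+ 2 + a ^+ 2)^-1 * (a * sin (a * x) + - e * cos (a * x))).
have dF : der F f.
  apply: der_eq (derM (der_expRscale e) (derD (der_cst _)
    (derZ _ (derD (derZ a (der_sinscale a)) (derZ (- e) (der_cosscale a)))))) _ => x.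
  by rewrite /f; field; rewrite D0 gt_eqF.
have -> : (\int[mu]_(x in `[0%R, +oo[) (wexp e x * (k + cos (a * x)))%:E =
          \int[mu]_(x in `[0%R, +oo[) (f x)%:E)%E.
  apply: eq_integral => x; rewrite inE/= in_itv/= andbT => x0.
  by rewrite /f /wexp ger0_norm.
rewrite (@FTC_halfline f F 0)//.
- rewrite -EFinM /F !mulr0 oppr0 expR0 sin0 cos0; congr (_%:E).
  by field; rewrite D0 gt_eqF.
- by move=> x; rewrite mulr_ge0 ?expR_ge0.
- exact: (is_derive_continuous (derM (der_expRscale e) (derD (der_cst k) (der_cosscale a)))).
- apply: (@cvg_expR_bounded e _ (`|k / e| + `|(e ^+ 2 + a ^+ 2)^-1| * (`|a| + `|e|))) => // x.
  rewrite (le_trans (ler_normD _ _))// normrN lerD2l normrM ler_wpM2l//.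
  rewrite (le_trans (ler_normD _ _))// !normrM normrN lerD//.
  + by rewrite ler_piMr// ler_norml sin_geN1 sin_le1.
  + by rewrite ler_piMr// ler_norml cos_geN1 cos_le1.
Qed.

Lemma rintegrable_wexp (e : R) : 0 < e -> rintegrable setT (wexp e).
Proof.
move=> e0; have h : rintegrable setT (fun x => wexp e x * (1 + cos (0 * x))).
  apply/integrableP; split.
    apply/measurable_EFinP; apply: measurable_funM; first exact: measurable_wexp.
    apply: continuous_measurable_fun => x; apply: continuousD; first exact: cvg_cst.
    exact: (is_derive_continuous (der_cosscale 0)).
  rewrite (_ : integral _ _ _ = \int[mu]_x (wexp e x * (1 + cos (0 * x)))%:E)%E.
    by rewrite integral_wexp_cos// ltry.
  apply: eq_integral => x _; rewrite /= ger0_norm//.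
  by rewrite mulr_ge0 ?wexp_ge0// mul0r cos0; lra.
apply: (rintegrable_le measurableT (measurable_wexp e) h) => x _.
rewrite ger0_norm ?wexp_ge0// mul0r cos0; have := wexp_ge0 e x; lra.
Qed.

Lemma rintegrable_wexpM (e : R) h : 0 < e -> measurable_fun setT h -> (forall x, `|h x| <= 1) ->
  rintegrable setT (fun x => wexp e x * h x).
Proof.
move=> e0 mh h1; apply: (rintegrable_le measurableT _ (rintegrable_wexp e0)).
  by apply: measurable_funM => //; exact: measurable_wexp.
by move=> x _; rewrite normrM ger0_norm ?wexp_ge0// ler_piMr ?wexp_ge0.
Qed.

Lemma measurable_cosscale (a : R) : measurable_fun setT (fun x => cos (a * x)).
Proof. by apply: continuous_measurable_fun; exact: (is_derive_continuous (der_cosscale a)). Qed.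

Lemma measurable_sinscale (a : R) : measurable_fun setT (fun x => sin (a * x)).
Proof. by apply: continuous_measurable_fun; exact: (is_derive_continuous (der_sinscale a)). Qed.

Lemma norm_cos_le1 (x : R) : `|cos x| <= 1.
Proof. by rewrite ler_norml cos_geN1 cos_le1. Qed.

Lemma norm_sin_le1 (x : R) : `|sin x| <= 1.
Proof. by rewrite ler_norml sin_geN1 sin_le1. Qed.

Lemma Rintegral_wexp_cos (e a : R) : 0 < e ->
  \int[mu]_x (wexp e x * cos (a * x)) = 2 * e / (e ^+ 2 + a ^+ 2).
Proof.
move=> e0; have ic := rintegrable_wexpM e0 (measurable_cosscale a) (fun x => norm_cos_le1 _).
have i1 := rintegrable_wexp e0.
have H (k : R) : 1 <= k -> k * \int[mu]_x wexp e x + \int[mu]_x (wexp e x * cos (a * x)) =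
    2 * k / e + 2 * e / (e ^+ 2 + a ^+ 2).
  move=> k1; rewrite -RintegralZl// -RintegralD//; last exact: rintegrableZl.
  have := @integral_wexp_cos e a k e0 k1 => /(congr1 fine) /= <-.
  by apply: eq_Rintegral => x _; ring.
have := H 1 (lexx _); have := H 2 (ler1n _ 2).
move: (\int[mu]_x wexp e x) (\int[mu]_x (wexp e x * cos (a * x))) => I1 I2.
by move: (2 * e / _) => P; move: e^-1 => e'; lra.
Qed.

Lemma Rintegral_wexp_sin (e a : R) : 0 < e -> \int[mu]_x (wexp e x * sin (a * x)) = 0.
Proof.
move=> e0; have ic := rintegrable_wexpM e0 (measurable_sinscale a) (fun x => norm_sin_le1 _).
have i1 := rintegrable_wexp e0.
(* Adding [wexp e] to the odd integrand makes it nonnegative, so that invariance under reflection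
   applies; it reads [I1 - I2 = I1 + I2]. *)
pose h x := wexp e x + wexp e x * sin (a * x).
have mh : measurable_fun setT h.
  apply: measurable_funD; first exact: measurable_wexp.
  by apply: measurable_funM; [exact: measurable_wexp|exact: measurable_sinscale].
have h0 x : 0 <= h x.
  have := norm_sin_le1 (a * x); rewrite ler_norml => /andP[+ _].
  by have := wexp_ge0 e x; rewrite /h; nra.
have : \int[mu]_x h (- x) = \int[mu]_x h x.
  congr fine; apply: (@ge0_integral_reflect (EFin \o h)); first exact/measurable_EFinP.
  by move=> x; rewrite lee_fin.
rewrite (_ : (fun x => h (- x)) = (fun x => wexp e x - wexp e x * sin (a * x))); last first.
  by apply/funext => x; rewrite /h /wexp normrN mulrN sinN mulrN.
rewrite RintegralB// RintegralD//.
move: (\int[mu]_x wexp e x) (\int[mu]_x (wexp e x * sin (a * x))) => I1 I2.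
lra.
Qed.

Lemma cint_wexp_cexpi (e u : R) : 0 < e ->
  cintegrable setT (fun x => (wexp e x)%:C * cexpi (2 * pi * u * x)) /\
  cint setT (fun x => (wexp e x)%:C * cexpi (2 * pi * u * x)) = (poisson e u)%:C.
Proof.
move=> e0; split.
  apply: (cintegrable_le measurableT _ (rintegrable_wexp e0)) => [|x _].
    apply: cmeasM; first by apply: cmeas_real; exact: measurable_wexp.
    by apply: cmeas_cexpi; exact: mulrl_measurable.
  by rewrite cabsM cabs_cexpi mulr1 cabs_real ger0_norm ?wexp_ge0.
apply: complex_eq.
- rewrite Re_cint (@eq_Rintegral _ _ _ mu setT (fun x => wexp e x * cos (2 * pi * u * x))).
    by rewrite Rintegral_wexp_cos.
  by move=> x _; rewrite ReM cexpiE /= mul0r subr0.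
- rewrite Im_cint (@eq_Rintegral _ _ _ mu setT (fun x => wexp e x * sin (2 * pi * u * x))).
    by rewrite Rintegral_wexp_sin.
  by move=> x _; rewrite ImM cexpiE /= mul0r addr0.
Qed.

End PoissonKernel.

(** * Poisson smoothing of truncated Fourier integrals *)

Section PoissonSummability.
Context {R : realType}.
Local Notation mu := (@lebesgue_measure R).
Implicit Types (A B : set R) (F G : R -> R[i]) (e : R).

Lemma poisson_den e (u : R) : 0 < e -> 0 < e ^+ 2 + (2 * pi * u) ^+ 2.
Proof. by move=> e0; rewrite ltr_pwDl ?exprn_gt0 ?sqr_ge0. Qed.

Lemma poisson_ge0 e u : 0 < e -> 0 <= poisson e u.
Proof. by move=> e0; rewrite divr_ge0 ?mulr_ge0 ?(ltW e0) ?(ltW (poisson_den _ _)). Qed.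

Lemma poisson_le e u : 0 < e -> poisson e u <= 2 / e.
Proof.
move=> e0; rewrite ler_pdivrMr ?poisson_den//.
have -> : 2 * e = 2 / e * e ^+ 2 by field; rewrite gt_eqF.
by rewrite ler_pM2l ?divr_gt0// lerDl sqr_ge0.
Qed.

Lemma poissonN e (u : R) : poisson e (- u) = poisson e u.
Proof. by rewrite /poisson mulrN sqrrN. Qed.

Lemma poissonBC e (s t : R) : poisson e (s - t) = poisson e (t - s).
Proof. by rewrite -opprB poissonN. Qed.

Lemma der_atan_poisson e (s : R) : 0 < e ->
  der (fun t : R => pi^-1 * atan (2 * pi / e * (t + - s))) (fun t : R => poisson e (t - s)).
Proof.
move=> e0; apply: der_eq (derZ pi^-1 (der_comp (@is_derive1_atan R)
  (derZ (2 * pi / e) (derD der_id (der_cst (- s)))))) _ => t.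
rewrite /poisson; have := poisson_den (t - s) e0; move: (t - s) => u Hu.
have := @pi_gt0 R; move: (@pi R) Hu => q Hu q0.
have Hu' : e ^+ 2 + (2 * q * u) ^+ 2 != 0 by rewrite gt_eqF.
have e0' : e != 0 by rewrite gt_eqF.
have q0' : q != 0 by rewrite gt_eqF.
have Hu2 : 1 + (2 * q / e * u) ^+ 2 != 0 by rewrite gt_eqF// ltr_pwDl// sqr_ge0.
by field; rewrite e0' q0' Hu'.
Qed.

Lemma continuous_poisson e (s : R) : 0 < e -> continuous (fun t : R => poisson e (t - s)).
Proof.
move=> e0 t; rewrite /poisson.
apply: (@continuousM R R (fun=> 2 * e) (fun t : R => (e ^+ 2 + (2 * pi * (t - s)) ^+ 2)^-1)).
  exact: cvg_cst.
apply: (@continuousV R R (fun t : R => e ^+ 2 + (2 * pi * (t - s)) ^+ 2)).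
  by rewrite gt_eqF// poisson_den.
have d : der (fun t : R => 2 * pi * (t + - s)) (fun=> 2 * pi * (1 + 0)).
  exact: derZ (derD der_id (der_cst _)).
exact: (is_derive_continuous (derD (der_cst (e ^+ 2)) (derM d d))).
Qed.

Lemma measurable_poisson e (s : R) : 0 < e -> measurable_fun setT (fun t : R => poisson e (t - s)).
Proof. by move=> e0; apply: continuous_measurable_fun; exact: continuous_poisson. Qed.

Lemma jmeas_poisson e : 0 < e -> jmeas (fun s t : R => poisson e (s - t)).
Proof.
move=> e0; have mp : measurable_fun setT (fun u : R => poisson e u).
  by have := measurable_poisson 0 e0; under eq_fun do rewrite subr0.
apply: (measurableT_comp mp).
by apply: measurable_funB; [exact: measurable_fst|exact: measurable_snd].
Qed.

Lemma Rintegral_poisson e (a b s : R) : 0 < e -> a <= b ->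
  \int[mu]_(t in `[a, b]) poisson e (t - s) =
  pi^-1 * atan (2 * pi / e * (b - s)) - pi^-1 * atan (2 * pi / e * (a - s)).
Proof.
by move=> e0 ab; rewrite (FTC_itv ab (@continuous_poisson e s e0) (@der_atan_poisson e s e0)).
Qed.

Lemma Rintegral_poisson_le1 e (a b s : R) : 0 < e -> a <= b ->
  \int[mu]_(t in `[a, b]) poisson e (t - s) <= 1.
Proof.
move=> e0 ab; rewrite Rintegral_poisson// -mulrBr ler_pdivrMl ?pi_gt0// mulr1.
have h1 := @atan_ltpi2 R (2 * pi / e * (b - s)).
have h2 := @atan_gtNpi2 R (2 * pi / e * (a - s)); lra.
Qed.

(** The Fourier integral truncated to [A]: [fourier] is the case [A = setT], and the L^2 transform
    is the limit along [A = [-n, n]]. *)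
Definition fint A F (xi : R) : R[i] := cint A (fun t => F t * cexpi (- (2 * pi * xi * t))).

Lemma jcmeas_cexpi (k : R) : jcmeas (fun x y : R => cexpi (k * x * y)).
Proof.
apply: cmeas_cexpi; apply: measurable_funM; last exact: measurable_snd.
by apply: measurable_funM; [exact: measurable_cst|exact: measurable_fst].
Qed.

Lemma jcmeasM (K L : R -> R -> R[i]) : jcmeas K -> jcmeas L -> jcmeas (fun x y => K x y * L x y).
Proof. exact: cmeasM. Qed.

Lemma jcmeas_fint F : cmeas F -> jcmeas (fun xi t : R => F t * cexpi (- (2 * pi * xi * t))).
Proof.
move=> mF; apply: jcmeasM; first exact: jcmeas_snd.
by apply: eq_cmeas (jcmeas_cexpi (- (2 * pi))) => z; rewrite !mulNr.
Qed.

Lemma cmeas_fint A F : measurable A -> cmeas F -> cmeas (fint A F).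
Proof. by move=> mA mF; apply: cmeas_cint => //; exact: jcmeas_fint. Qed.

Lemma cintegrable_fint A F (xi : R) : measurable A -> cmeas F -> cintegrable A F ->
  cintegrable A (fun t => F t * cexpi (- (2 * pi * xi * t))).
Proof.
move=> mA mF iF; apply: (cintegrable_le mA _ (cintegrable_cabs mA mF iF)).
- exact: (jcmeas1 xi (jcmeas_fint mF)).
- by move=> t _; rewrite cabsM cabs_cexpi mulr1.
Qed.

Lemma cabs_fint_le A F (xi : R) : measurable A -> cmeas F -> cintegrable A F ->
  cabs (fint A F xi) <= \int[mu]_(t in A) cabs (F t).
Proof.
move=> mA mF iF; apply: ler_cabs_cint_bound => //.
- exact: (jcmeas1 xi (jcmeas_fint mF)).
- exact: cintegrable_cabs.
- by move=> t _; rewrite cabsM cabs_cexpi mulr1.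
Qed.

(** Fubini is legitimate because [wexp e] is integrable, and the inner integral is then the
    transform of [wexp e]. Damping on the frequency side is thus convolution with [poisson e]: an
    inversion formula before the limit [e -> 0]. *)
Lemma fint_poisson A F e (b : R) : measurable A -> cmeas F -> cintegrable A F -> 0 < e ->
  cint setT (fun xi => (wexp e xi)%:C * (fint A F xi * cexpi (2 * pi * b * xi))) =
  cint A (fun t => F t * (poisson e (b - t))%:C).
Proof.
move=> mA mF iF e0.
pose K xi t := (wexp e xi)%:C * (F t * cexpi (- (2 * pi * xi * t)) * cexpi (2 * pi * b * xi)).
have mK : jcmeas K.
  apply: jcmeasM; first by apply: jcmeas_fst; apply: cmeas_real; exact: measurable_wexp.
  apply: jcmeasM; first exact: jcmeas_fint.
  by apply: jcmeas_fst; apply: cmeas_cexpi; exact: mulrl_measurable.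
have Kle x y : setT x -> A y -> cabs (K x y) <= wexp e x * cabs (F y).
  by move=> _ _; rewrite /K !cabsM !cabs_cexpi !mulr1 cabs_real ger0_norm ?wexp_ge0.
have FK := cFubini measurableT mA mK (rintegrable_wexp e0) (cintegrable_cabs mA mF iF) Kle.
transitivity (cint setT (fun x => cint A (K x))).
  apply: eq_cint => xi _; have i1 := cintegrable_fint xi mA mF iF.
  by rewrite /fint -(cintZr (cexpi (2 * pi * b * xi)) mA i1)
    -(cintZl (wexp e xi)%:C mA (cintegrableZr _ mA i1)).
rewrite FK; apply: eq_cint => t _.
have [i1 e1] := @cint_wexp_cexpi R e (b - t) e0.
rewrite -e1 -(cintZl (F t) measurableT i1).
apply: eq_cint => xi _; rewrite /K -[F t * _ * _]mulrA -cexpiD mulrCA.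
by congr (_ * (_ * cexpi _)); ring.
Qed.

End PoissonSummability.

(** * Bessel's inequality for truncated Fourier integrals *)

Section Bessel.
Context {R : realType}.
Local Notation mu := (@lebesgue_measure R).
Implicit Types (A B : set R) (F G : R -> R[i]) (e : R).

Lemma ler_half_sqr (x y : R) : x * y <= 2^-1 * (x ^+ 2 + y ^+ 2).
Proof. by have := sqr_ge0 (x - y); nra. Qed.

Lemma itv_measure_lty (a b : R) : (mu `[a, b] < +oo)%E.
Proof. by rewrite lebesgue_measure_itv /=; case: ifP => _; rewrite ?ltry// -EFinB ltry. Qed.

Lemma L2_cintegrable A F : measurable A -> (mu A < +oo)%E -> L2 F -> cintegrable A F.
Proof.
move=> mA Aoo FL; have mF := L2_meas FL.
have i1 := rintegrableD mA (L2_sqr mA FL) (rintegrable_cst 1 mA Aoo).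
apply: (cintegrable_le mA mF i1) => x _.
by have := sqr_ge0 (cabs (F x) - 1); have := sqr_ge0 (cabs (F x)); nra.
Qed.

Lemma cintegrable_wexp_fint A F e (b : R) : measurable A -> cmeas F -> cintegrable A F -> 0 < e ->
  cintegrable setT (fun xi => (wexp e xi)%:C * (fint A F xi * cexpi (2 * pi * b * xi))).
Proof.
move=> mA mF iF e0.
apply: (cintegrable_le measurableT _ (rintegrableZl (\int[mu]_(t in A) cabs (F t)) measurableT (rintegrable_wexp e0))).
- apply: cmeasM; first by apply: cmeas_real; exact: measurable_wexp.
  by apply: cmeasM; [exact: cmeas_fint|apply: cmeas_cexpi; exact: mulrl_measurable].
- move=> x _; rewrite !cabsM cabs_cexpi mulr1 cabs_real ger0_norm ?wexp_ge0// mulrC.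
  by rewrite ler_wpM2r ?wexp_ge0// cabs_fint_le.
Qed.

Lemma conjc_fint A F (xi : R) : measurable A -> cmeas F -> cintegrable A F ->
  conjc (fint A F xi) = cint A (fun s => conjc (F s) * cexpi (2 * pi * xi * s)).
Proof.
move=> mA mF iF; have i1 := cintegrable_fint xi mA mF iF.
rewrite /fint -(cint_conj mA i1); apply: eq_cint => s _.
by rewrite conjcM -cexpiN opprK.
Qed.

(** Writing one factor of [|fint A F|^2] as an integral and exchanging the integrals leaves, by
    [fint_poisson], the quadratic form of the Poisson kernel. *)
Lemma wexp_fint_sqr A F e : measurable A -> cmeas F -> cintegrable A F -> 0 < e ->
  (\int[mu]_xi (wexp e xi * cabs (fint A F xi) ^+ 2))%:C =
  cint A (fun s => conjc (F s) * cint A (fun t => F t * (poisson e (s - t))%:C)).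
Proof.
move=> mA mF iF e0; have iC := cintegrable_cabs mA mF iF.
set M := \int[mu]_(t in A) cabs (F t).
have mC : cmeas (fun s => conjc (F s)) := cmeas_conj mF.
pose K xi s := (wexp e xi)%:C * fint A F xi * (conjc (F s) * cexpi (2 * pi * xi * s)).
have mK : jcmeas K.
  apply: jcmeasM.
    apply: jcmeas_fst; apply: cmeasM; last exact: cmeas_fint.
    by apply: cmeas_real; exact: measurable_wexp.
  by apply: jcmeasM; [exact: jcmeas_snd|exact: jcmeas_cexpi].
have Kle x y : setT x -> A y -> cabs (K x y) <= (M * wexp e x) * cabs (F y).
  move=> _ _; rewrite /K !cabsM !cabs_cexpi mulr1 cabs_real cabs_conj ger0_norm ?wexp_ge0//.
  rewrite ler_wpM2r ?cabs_ge0// mulrC ler_wpM2r ?wexp_ge0//.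
  exact: cabs_fint_le.
have FK := cFubini measurableT mA mK (rintegrableZl M measurableT (rintegrable_wexp e0)) iC Kle.
rewrite -cint_real.
transitivity (cint setT (fun x => cint A (K x))).
  apply: eq_cint => xi _; rewrite rmorphM /= -mulc_conj (conjc_fint xi mA mF iF) mulrA.
  have i2 : cintegrable A (fun s => conjc (F s) * cexpi (2 * pi * xi * s)).
    apply: (cintegrable_le mA _ iC).
    - by apply: cmeasM; [exact: mC|apply: cmeas_cexpi; exact: mulrl_measurable].
    - by move=> s _; rewrite cabsM cabs_cexpi mulr1 cabs_conj.
  exact: esym (cintZl _ mA i2).
rewrite FK; apply: eq_cint => s _.
have i1 := cintegrable_wexp_fint s mA mF iF e0.
rewrite -(fint_poisson s mA mF iF e0) -(cintZl _ measurableT i1).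
apply: eq_cint => xi _; rewrite /K.
rewrite [2 * pi * xi * s](_ : _ = 2 * pi * s * xi); last by ring.
ring.
Qed.

(** Schur's test: [|F s| |F t|] is at most half of [|F s|^2 + |F t|^2], and the symmetric kernel has
    mass at most 1 in each variable. The two halves are the integrals of [k1] and [k2]. *)
Lemma poisson_form_le F e (a : R) : 0 <= a -> L2 F -> 0 < e ->
  cabs (cint `[- a, a] (fun s => conjc (F s) *
    cint `[- a, a] (fun t => F t * (poisson e (s - t))%:C))) <= nrm2 `[- a, a] F.
Proof.
move=> a0 FL e0; set A := `[- a, a]%classic.
have mA : measurable A by exact: measurable_itv.
have Aoo : (mu A < +oo)%E := itv_measure_lty _ _.
have mF := L2_meas FL; have iF := L2_cintegrable mA Aoo FL.
have iC := cintegrable_cabs mA mF iF.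
have aa : - a <= a by lra.
have mp (s : R) : measurable_fun setT (fun t : R => poisson e (s - t)) := jmeas1 s (jmeas_poisson e0).
have mc : measurable_fun setT (fun s => cabs (F s)) := measurable_cabs mF.
have mc2 := measurable_cabs2 mF.
have isq := L2_sqr mA FL.
have icst := rintegrable_cst (2 / e) mA Aoo.
have ple (s t : R) : `|poisson e (s - t)| <= 2 / e.
  by rewrite ger0_norm ?poisson_ge0 ?poisson_le.
pose k1 (s t : R) := cabs (F s) ^+ 2 * poisson e (s - t).
pose k2 (s t : R) := cabs (F t) ^+ 2 * poisson e (s - t).
have mk1 : jmeas k1 by apply: measurable_funM; [exact: (jmeas_fst mc2)|exact: (jmeas_poisson e0)].
have mk2 : jmeas k2 by apply: measurable_funM; [exact: (jmeas_snd mc2)|exact: (jmeas_poisson e0)].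
have k1le s t : A s -> A t -> `|k1 s t| <= cabs (F s) ^+ 2 * (2 / e).
  by move=> _ _; rewrite normrM ger0_norm ?sqr_ge0// ler_wpM2l ?sqr_ge0.
have k2le s t : A s -> A t -> `|k2 s t| <= (2 / e) * cabs (F t) ^+ 2.
  by move=> _ _; rewrite normrM ger0_norm ?sqr_ge0// mulrC ler_wpM2r ?sqr_ge0.
have ik1 := rintegrable_Rintegral mA mA mk1 isq icst k1le.
have ik2 := rintegrable_Rintegral mA mA mk2 icst isq k2le.
have ip1 (s : R) : rintegrable A (fun t : R => poisson e (s - t)).
  by apply: (rintegrable_le mA (mp s) icst) => t _.
have b1 : \int[mu]_(s in A) \int[mu]_(t in A) k1 s t <= nrm2 A F.
  apply: ler_Rintegral => // s As; rewrite /k1 RintegralZl//; last exact: ip1.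
  rewrite ler_piMr ?sqr_ge0//.
  under eq_Rintegral do rewrite poissonBC.
  exact: Rintegral_poisson_le1.
have b2 : \int[mu]_(s in A) \int[mu]_(t in A) k2 s t <= nrm2 A F.
  rewrite (Fubini_dominated mA mA mk2 icst isq k2le).
  have k2le' t s : A t -> A s -> `|k2 s t| <= cabs (F t) ^+ 2 * (2 / e).
    by move=> At As; rewrite mulrC; exact: k2le.
  have ik2' := rintegrable_Rintegral mA mA (jmeas_flip mk2) isq icst k2le'.
  apply: ler_Rintegral => // t At; rewrite /k2 RintegralZl//; last first.
    by apply: (rintegrable_le mA (jmeas2 t (jmeas_poisson e0)) icst) => s _.
  by rewrite ler_piMr ?sqr_ge0// Rintegral_poisson_le1.
apply: (@le_trans _ _ (\int[mu]_(s in A) (2^-1 * \int[mu]_(t in A) k1 s t + 2^-1 * \int[mu]_(t in A) k2 s t))).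
  apply: ler_cabs_cint_bound => //.
  - apply: cmeasM; first exact: cmeas_conj.
    apply: cmeas_cint => //; apply: jcmeasM; first exact: jcmeas_snd.
    by apply: cmeas_real; exact: jmeas_poisson.
  - by apply: rintegrableD => //; exact: rintegrableZl.
  - move=> s As; rewrite cabsM cabs_conj.
    have ik1s : rintegrable A (k1 s) by exact: rintegrableZl.
    have ik2s : rintegrable A (k2 s).
      apply: (rintegrable_le mA (jmeas1 s mk2) (rintegrableZl (2 / e) mA isq)) => t At.
      exact: k2le.
    have iFp : rintegrable A (fun t => cabs (F t) * poisson e (s - t)).
      apply: (rintegrable_le mA _ (rintegrableZl (2 / e) mA iC)) => [|t At].
        exact: measurable_funM.
      by rewrite normrM ger0_norm ?cabs_ge0// mulrC ler_wpM2r ?cabs_ge0.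
    apply: (@le_trans _ _ (cabs (F s) * \int[mu]_(t in A) (cabs (F t) * poisson e (s - t)))).
      rewrite ler_wpM2l ?cabs_ge0//; apply: ler_cabs_cint_bound => //.
      - by apply: cmeasM => //; apply: cmeas_real.
      - by move=> t _; rewrite cabsM cabs_real ger0_norm ?poisson_ge0.
    rewrite -RintegralZl// -!RintegralZl// -RintegralD//; try exact: rintegrableZl.
    apply: ler_Rintegral => //; first exact: rintegrableZl.
      by apply: rintegrableD => //; exact: rintegrableZl.
    move=> t _; rewrite /k1 /k2 -!mulrDr mulrA -mulrDl mulrA ler_wpM2r ?poisson_ge0//.
    exact: ler_half_sqr.
rewrite RintegralD//; try exact: rintegrableZl.
rewrite (@RintegralZl _ _ _ mu A (fun s => \int[mu]_(t in A) k1 s t) _ mA ik1).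
rewrite (@RintegralZl _ _ _ mu A (fun s => \int[mu]_(t in A) k2 s t) _ mA ik2).
move: (\int[mu]_(s in A) _) b1 (\int[mu]_(s in A) _) b2.
clear; move: (nrm2 _ F) => N I1 b1 I2 b2; lra.
Qed.

Lemma wexp_fint_le F e (a : R) : 0 <= a -> L2 F -> 0 < e ->
  \int[mu]_xi (wexp e xi * cabs (fint `[- a, a] F xi) ^+ 2) <= nrm2 `[- a, a] F.
Proof.
move=> a0 FL e0; have := poisson_form_le a0 FL e0.
rewrite -wexp_fint_sqr//; last 2 first.
- exact: L2_meas.
- by apply: L2_cintegrable => //; exact: itv_measure_lty.
by apply: le_trans; rewrite cabs_real ler_norm.
Qed.

Lemma cvg_wexp (x : R) : (fun n : nat => wexp (n.+1%:R^-1 : R) x) @ \oo --> (1 : R).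
Proof.
have c0 := is_derive_continuous (der_expRscale `|x|) (x := 0 : R).
have H := cvg_comp _ _ (@cvg_harmonic R) c0.
rewrite mulr0 oppr0 expR0 in H; rewrite (_ : (fun n => _) =
    (fun y => expR (- (`|x| * y))) \o harmonic)//.
by apply/funext => n; rewrite /wexp /= mulrC.
Qed.

(** [wexp_fint_le] holds uniformly in [e]. Along [e = 1 / (n + 1)] the damping factors increase to
    1, and monotone convergence removes them; integrability of the limit is part of the
    conclusion. *)
Lemma Bessel F (a : R) : 0 <= a -> L2 F ->
  L2 (fint `[- a, a] F) /\ nrm2 setT (fint `[- a, a] F) <= nrm2 `[- a, a] F.
Proof.
move=> a0 FL; set A := `[- a, a]%classic.
have mA : measurable A by exact: measurable_itv.
have Aoo : (mu A < +oo)%E := itv_measure_lty _ _.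
have mF := L2_meas FL; have iF := L2_cintegrable mA Aoo FL.
have mf := cmeas_fint mA mF.
set f := fint A F.
pose g n x := wexp (n.+1%:R^-1 : R) x * cabs (f x) ^+ 2.
have e0 (n : nat) : 0 < n.+1%:R^-1 :> R by rewrite invr_gt0.
have g0 n x : 0 <= g n x by rewrite mulr_ge0 ?wexp_ge0 ?sqr_ge0.
have mg n : measurable_fun setT (g n).
  by apply: measurable_funM; [exact: measurable_wexp|exact: measurable_cabs2].
have ig n : rintegrable setT (g n).
  have M0 : 0 <= \int[mu]_(t in A) cabs (F t) by apply: Rintegral_ge0 => x _; exact: cabs_ge0.
  apply: (rintegrable_le measurableT (mg n)
    (rintegrableZl ((\int[mu]_(t in A) cabs (F t)) ^+ 2) measurableT (rintegrable_wexp (e0 n)))).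
  move=> x _; rewrite ger0_norm// /g mulrC ler_wpM2r ?wexp_ge0//.
  by rewrite ler_pXn2r ?nnegrE ?cabs_ge0// cabs_fint_le.
have gle n : (\int[mu]_x (g n x)%:E <= (nrm2 A F)%:E)%E.
  by rewrite EFin_Rintegral// lee_fin wexp_fint_le.
have cg x : (fun n => (g n x)%:E) @ \oo --> (cabs (f x) ^+ 2)%:E.
  apply: cvg_EFin; first exact: nearW.
  by rewrite -[X in _ --> X]mul1r; apply: cvgMl; exact: cvg_wexp.
have E : (\int[mu]_x (cabs (f x) ^+ 2)%:E <= (nrm2 A F)%:E)%E.
  rewrite (_ : integral _ _ _ = \int[mu]_x limn (fun n => (g n x)%:E))%E; last first.
    by apply: eq_integral => x _; apply/esym/cvg_lim => //; exact: cg.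
  have H := @cvg_monotone_convergence _ _ _ mu setT measurableT (fun n x => (g n x)%:E).
  have {}H := H (fun n => (measurable_EFinP _ _).2 (mg n)) (fun n x _ => ltac:(by rewrite lee_fin)).
  have {}H : (fun n => \int[mu]_x (g n x)%:E)%E @ \oo --> (\int[mu]_x limn (fun n => (g n x)%:E))%E.
    apply: H => x _ m n mn; rewrite lee_fin ler_wpM2r ?sqr_ge0// ler_expR lerN2.
    by rewrite ler_wpM2r// lef_pV2 ?posrE// ler_nat.
  rewrite -(cvg_lim _ H)//; apply: lime_le; first by apply/cvg_ex; eexists; exact: H.
  by apply: nearW => n; exact: gle.
have fL : L2 f.
  split => //; apply/integrableP; split.
    by apply/measurable_EFinP; exact: measurable_cabs2.
  under eq_integral do rewrite abse_EFin ger0_norm ?sqr_ge0//.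
  by apply: (le_lt_trans E); rewrite ltry.
by split => //; rewrite -lee_fin -l2sqE.
Qed.

End Bessel.
(** * Band-limited functions *)

Lemma ae_neq {R : realType} (a : R) : {ae (@lebesgue_measure R), forall x : R, x != a}.
Proof.
exists [set a]; split.
- exact: measurable_set1.
- exact: lebesgue_measure_set1.
- by move=> x /= /negP; rewrite negbK => /eqP.
Qed.

Section PaleyWiener.
Context {R : realType}.
Local Notation mu := (@lebesgue_measure R).
Implicit Types (A B : set R) (f g F G : R -> R[i]) (e c : R).

Definition band c g := forall xi : R, c < `|xi| -> g xi = 0.

(** Inverse Fourier integral over the band. Having a value at every point, it is the representative
    of a band-limited function on which pointwise estimates are made. *)
Definition Uop c g (x : R) : R[i] := cint `[- c, c] (fun xi => g xi * cexpi (2 * pi * x * xi)).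

Lemma itvP_norm c (xi : R) : `[- c, c]%classic xi <-> `|xi| <= c.
Proof. by rewrite /= in_itv /= ler_norml. Qed.

Lemma band_restrict c g : band c g -> crestrict `[- c, c] g = g.
Proof.
move=> bg; apply/funext => xi; rewrite /crestrict; case: ifPn => // /negP h.
rewrite bg// ltNge; apply/negP => H; apply: h; rewrite inE.
exact/itvP_norm.
Qed.

Lemma band_crestrict c g : band c (crestrict `[- c, c] g).
Proof.
move=> xi cxi; rewrite /crestrict; case: ifPn => //; rewrite inE => /itvP_norm.
by rewrite leNgt cxi.
Qed.

Lemma L2_band_cintegrable c g : L2 g -> band c g -> cintegrable setT g.
Proof.
move=> gL bg; have mc := measurable_segment (- c) c.
rewrite -(band_restrict bg); apply/(cintegrable_mkcond g mc).
exact: L2_cintegrable mc (itv_measure_lty _ _) gL.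
Qed.

Lemma Uop_setT c g (x : R) : band c g ->
  Uop c g x = cint setT (fun xi => g xi * cexpi (2 * pi * x * xi)).
Proof.
move=> bg; rewrite /Uop cint_mkcond; apply: eq_cint => xi _.
rewrite /crestrict; case: ifPn => // /negP h.
rewrite bg ?mul0r// ltNge; apply/negP => H; apply: h; rewrite inE.
exact/itvP_norm.
Qed.

Lemma cmeas_Uop c g : cmeas g -> cmeas (Uop c g).
Proof.
move=> mg; apply: cmeas_cint; last exact: measurable_itv.
by apply: jcmeasM; [exact: (jcmeas_snd mg)|exact: jcmeas_cexpi].
Qed.

Lemma cmeas_mul_cexpi g (k : R) : cmeas g -> cmeas (fun xi => g xi * cexpi (k * xi)).
Proof.
by move=> mg; apply: cmeasM; [exact: mg|apply: cmeas_cexpi; exact: mulrl_measurable].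
Qed.

Lemma cintegrable_mul_cexpi A g (k : R) : measurable A -> cmeas g -> cintegrable A g ->
  cintegrable A (fun xi => g xi * cexpi (k * xi)).
Proof.
move=> mA mg ig; apply: (cintegrable_le mA (cmeas_mul_cexpi k mg) (cintegrable_cabs mA mg ig)).
by move=> xi _; rewrite cabsM cabs_cexpi mulr1.
Qed.

Lemma Rintegral_itv_cst c (k : R) : 0 <= c -> \int[mu]_(_ in `[- c, c]) k = 2 * c * k.
Proof.
move=> c0; have mc := measurable_segment (- c) c.
transitivity (k * fine (mu `[- c, c])); first exact: Rintegral_cst.
rewrite lebesgue_measure_itv /= lte_fin.
case: ltP => h /=; first by rewrite opprK; ring.
have -> : c = 0 by lra.
by rewrite !(mulr0, mul0r).
Qed.

Lemma Rintegral_cabs_band_sqr c g : 0 <= c -> L2 g ->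
  (\int[mu]_(xi in `[- c, c]) cabs (g xi)) ^+ 2 <= 2 * c * nrm2 setT g.
Proof.
move=> c0 gL; have mc := measurable_segment (- c) c.
have [] := @CauchySchwarz_real R `[- c, c] (fun=> 1) (fun xi => cabs (g xi)) mc.
- exact: measurable_cst.
- by apply: measurable_cabs; exact: L2_meas.
- by [].
- by move=> x; exact: cabs_ge0.
- by apply: rintegrable_cst => //; exact: itv_measure_lty.
- exact: L2_sqr.
move=> _; under eq_Rintegral do rewrite mul1r.
move=> /le_trans; apply.
rewrite expr1n Rintegral_itv_cst// mulr1.
by rewrite ler_wpM2l ?mulr_ge0//; apply: nrm2S.
Qed.

(** On a band of length [2 c] the L^2 norm controls the L^1 norm of the transform, hence the
    supremum of the function. *)
Lemma cabs_Uop_sqr_le c g (x : R) : 0 <= c -> L2 g ->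
  cabs (Uop c g x) ^+ 2 <= 2 * c * nrm2 setT g.
Proof.
move=> c0 gL; have mc := measurable_segment (- c) c.
have mg := L2_meas gL.
apply: le_trans (Rintegral_cabs_band_sqr c0 gL).
rewrite ler_pXn2r ?nnegrE ?cabs_ge0//; last by apply: Rintegral_ge0 => xi _; exact: cabs_ge0.
apply: ler_cabs_cint_bound => //.
- exact: cmeas_mul_cexpi.
- by apply: cintegrable_cabs => //; apply: L2_cintegrable => //; exact: itv_measure_lty.
- by move=> xi _; rewrite cabsM cabs_cexpi mulr1.
Qed.

(** Truncated transform and [Uop] are adjoint to each other, by Fubini: [F] is integrable on the set
    [A] of finite measure, and [g] is integrable because it lives on a bounded band. *)
Lemma ip_fint_Uop A c F g : measurable A -> (mu A < +oo)%E -> L2 F -> L2 g -> band c g ->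
  ip setT (fint A F) g = ip A F (Uop c g).
Proof.
move=> mA Aoo FL gL bg.
have mF := L2_meas FL; have iF := L2_cintegrable mA Aoo FL.
have mg := L2_meas gL; have ig := L2_band_cintegrable gL bg.
have mgc : cmeas (fun xi => conjc (g xi)) := cmeas_conj mg.
pose K xi s := F s * cexpi (- (2 * pi * xi * s)) * conjc (g xi).
have mK : jcmeas K.
  by apply: jcmeasM; [exact: (jcmeas_fint mF)|exact: (jcmeas_fst mgc)].
have Kle x y : setT x -> A y -> cabs (K x y) <= cabs (g x) * cabs (F y).
  by move=> _ _; rewrite /K !cabsM cabs_cexpi cabs_conj mulr1 mulrC.
have FK := cFubini measurableT mA mK (cintegrable_cabs measurableT mg ig)
  (cintegrable_cabs mA mF iF) Kle.
transitivity (cint setT (fun x => cint A (K x))).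
  apply: eq_cint => xi _; have i1 := cintegrable_fint xi mA mF iF.
  by rewrite /fint -(cintZr (conjc (g xi)) mA i1).
rewrite FK; apply: eq_cint => s _.
have i2 := cintegrable_mul_cexpi (2 * pi * s) measurableT mg ig.
rewrite (Uop_setT s bg) -(cint_conj measurableT i2).
rewrite -(cintZl (F s) measurableT (cintegrable_conj measurableT i2)).
apply: eq_cint => xi _; rewrite /K conjcM -cexpiN -mulrA (mulrC (cexpi _)).
congr (_ * (_ * cexpi (- _))); ring.
Qed.

Lemma cvg_nrm2_itvnn f : L2 f ->
  (fun n : nat => nrm2 `[- n%:R, n%:R] f) @ \oo --> nrm2 setT f.
Proof. by move=> [mf fi]; apply: cvg_Rintegral_itvnn => //; exact: measurable_cabs2. Qed.

(* Let [V_n f] be the transform of [f] truncated to [-n, n]. Bessel's inequality bounds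
   [|V_n f|^2] by the truncated norm of [f], and the cross term [<V_n f, g>] is that same
   truncated norm. *)
Lemma fourierL2_Uop c g : L2 g -> band c g -> L2 (Uop c g) ->
  nrm2 setT (Uop c g) = nrm2 setT g -> fourierL2 (Uop c g) g.
Proof.
move=> gL bg fL fg; split; first exact/Lp2E.
set f := Uop c g in fL fg *.
have mI (n : nat) := measurable_segment (- n%:R) (n%:R : R).
have vL n : L2 (fint `[- n%:R, n%:R] f) by have [] := @Bessel R f n%:R (ler0n _ _) fL.
have key (n : nat) : nrm2 setT (fun xi => fint `[- n%:R, n%:R] f xi - g xi) <=
    nrm2 setT g - nrm2 `[- n%:R, n%:R] f.
  rewrite nrm2B//; have [_ b] := @Bessel R f n%:R (ler0n _ _) fL.
  rewrite (@ip_fint_Uop _ c)// ?itv_measure_lty// -/f ip_self Re_real.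
  move: (nrm2 _ _) (nrm2 `[_, _] f) (nrm2 setT g) b => x y z; lra.
have lim : (fun n : nat => nrm2 setT g - nrm2 `[- n%:R, n%:R] f) @ \oo --> (0 : R).
  have H0 : (fun _ : nat => nrm2 setT g) @ \oo --> nrm2 setT g by exact: cvg_cst.
  have H1 := cvg_nrm2_itvnn fL; rewrite fg in H1.
  have H2 := cvgB H0 H1; rewrite subrr in H2.
  exact: H2.
have lim2 : (fun n : nat => nrm2 setT (fun xi => fint `[- n%:R, n%:R] f xi - g xi)) @ \oo --> (0 : R).
  apply: (squeeze_cvgr _ (cvg_cst 0) lim); apply: nearW => n.
  by rewrite nrm2_ge0 key.
rewrite (_ : (fun n => _) = (fun n : nat => (nrm2 setT (fun xi => fint `[- n%:R, n%:R] f xi - g xi))%:E)).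
  by apply: cvg_EFin; [exact: nearW|exact: lim2].
by apply/funext => n; rewrite -l2sqE//; apply: L2B.
Qed.

Lemma measurable_atan_affine (u : R) (n : nat) :
  measurable_fun setT (fun s : R => atan (2 * pi * (u - s) * n.+1%:R)).
Proof.
apply: continuous_measurable_fun => s.
have d : der (fun s : R => 2 * pi * n.+1%:R * (u + -1 * s)) (fun=> 2 * pi * n.+1%:R * (0 + -1)).
  exact: derZ (derD (der_cst u) (der_linear (-1))).
have := is_derive_continuous (der_comp (@is_derive1_atan R) d) (x := s).
by congr (continuous_at _ _); apply/funext => z; congr atan; ring.
Qed.

End PaleyWiener.

(** * The sinc kernel and its Fourier transform *)

Section SincKernel.
Context {R : realType}.
Local Notation mu := (@lebesgue_measure R).
Variables (c : R) (c0 : 0 < c).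

Lemma sinc_kernelN (u : R) : sinc_kernel c (- u) = sinc_kernel c u.
Proof.
rewrite /sinc_kernel oppr_eq0; case: eqP => // _.
by rewrite !mulrN sinN invrN mulrNN.
Qed.

Lemma cint_cexpi_sinc (u : R) :
  cint `[- c, c] (fun xi => cexpi (2 * pi * u * xi)) = (sinc_kernel c u)%:C.
Proof.
have cc : - c <= c by move: c0; lra.
have p0 : pi != 0 :> R by rewrite gt_eqF ?pi_gt0.
rewrite /sinc_kernel; case: eqP => [->|/eqP u0].
  rewrite (eq_cint (g := fun=> (1 : R)%:C)) => [|xi _]; last by rewrite mulr0 mul0r cexpi0.
  by rewrite cint_real (Rintegral_itv_cst _ (ltW c0)) mulr1.
set k := 2 * pi * u; have k0 : k != 0 by rewrite !mulf_neq0.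
have dS := derZ k^-1 (@der_sinscale R k).
have dC := derZ (- k^-1) (@der_cosscale R k).
apply: complex_eq.
- rewrite Re_cint (@eq_Rintegral _ _ _ mu `[- c, c] (fun x => k^-1 * (k * cos (k * x)))).
    rewrite (FTC_itv cc _ dS).
      rewrite Re_real mulrN sinN (_ : 2 * pi * c * u = k * c); last by rewrite /k; ring.
      have E (S q : R) : q != 0 -> (2 * q * u)^-1 * S - (2 * q * u)^-1 * - S = S / (q * u).
        by move=> q0; field; rewrite u0 q0.
      exact: E.
    apply: is_derive_continuous (derZ k^-1 (derZ k (@der_cosscale R k))).
  by move=> x _; rewrite cexpiE /= mulKf.
- rewrite Im_cint (@eq_Rintegral _ _ _ mu `[- c, c] (fun x => - k^-1 * (- k * sin (k * x)))).
    rewrite (FTC_itv cc _ dC).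
      by rewrite mulrN cosN subrr.
    apply: is_derive_continuous (derZ (- k^-1) (derZ (- k) (@der_sinscale R k))).
  by move=> x _; rewrite cexpiE /= mulNr mulNr mulrN opprK mulKf.
Qed.

Let one_band : R -> R[i] := crestrict `[- c, c] (fun=> 1).

Let one_bandL : L2 one_band.
Proof.
apply: (@L2_bounded R `[- c, c] _ 1).
- exact: measurable_itv.
- exact: itv_measure_lty.
- by apply: cmeas_restrict; [exact: measurable_itv|exact: cmeas_cst].
- by move=> x /mem_set cx; rewrite /one_band /crestrict cx cabs1.
- by move=> x cx; rewrite /one_band /crestrict memNset.
Qed.

Let fint_one_band (xi : R) : fint `[- c, c] one_band xi = (sinc_kernel c xi)%:C.
Proof.
rewrite -sinc_kernelN -cint_cexpi_sinc; apply: eq_cint => t /mem_set ct.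
by rewrite /one_band /crestrict ct mul1r mulrN mulNr.
Qed.

Let nrm2_one_band : nrm2 `[- c, c] one_band = 2 * c.
Proof.
rewrite /nrm2 (@eq_Rintegral _ _ _ mu _ (fun=> 1)).
  by rewrite (Rintegral_itv_cst _ (ltW c0)) mulr1.
by move=> x cx; rewrite /one_band /crestrict cx cabs1 expr1n.
Qed.

Lemma cvg_atan_scale (y : R) : 0 < y ->
  (fun n : nat => atan (y * n.+1%:R)) @ \oo --> (pi / 2 : R).
Proof.
move=> y0.
have H : (fun n : nat => y * n.+1%:R) @ \oo --> +oo.
  apply/cvgryPge => A; near=> n.
  have h : A / y <= n%:R by near: n; exact: nbhs_infty_ger.
  by rewrite mulrC -ler_pdivrMr// (le_trans h)// ler_nat.
exact: cvg_comp H (@cvgy_atan R).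
Unshelve. all: by end_near. Qed.

(** The kernel is the transform of the indicator of the band, so Bessel's inequality gives one
    direction. For the other, the damped energy equals the integral over the band of the Poisson
    mass [th n], which tends to 1 inside. The exact norm is what [fourierL2_Uop] asks for in order
    to place the kernel in [PW2]. *)
Lemma L2_sinc0 : L2 (fun s : R => (sinc_kernel c s)%:C) /\
  nrm2 setT (fun s : R => (sinc_kernel c s)%:C) = 2 * c.
Proof.
have [] := @Bessel R one_band c (ltW c0) one_bandL.
rewrite (_ : fint _ _ = fun s : R => (sinc_kernel c s)%:C); last first.
  by apply/funext => xi; rewrite fint_one_band.
rewrite nrm2_one_band => kL kle; split => //; apply/eqP; rewrite eq_le kle/=.
have cc : - c <= c by move: c0; lra.
have mc := measurable_segment (- c) c.
have mone := L2_meas one_bandL.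
have ione := L2_cintegrable mc (itv_measure_lty _ _) one_bandL.
pose th (n : nat) (s : R) : R := pi^-1 * atan (2 * pi * (c - s) * n.+1%:R) -
  pi^-1 * atan (2 * pi * (- c - s) * n.+1%:R).
have e0 (n : nat) : 0 < n.+1%:R^-1 :> R by rewrite invr_gt0.
have thE n s : \int[mu]_(t in `[- c, c]) poisson n.+1%:R^-1 (t - s) = th n s.
  rewrite (Rintegral_poisson s (e0 n) cc) /th !invrK.
  by congr (_ * atan _ - _ * atan _); ring.
have form n : \int[mu]_xi (wexp n.+1%:R^-1 xi * cabs (sinc_kernel c xi)%:C ^+ 2) =
    \int[mu]_(s in `[- c, c]) th n s.
  apply: (@complexI R); rewrite -[RHS]cint_real.
  under eq_Rintegral => xi _ do rewrite -fint_one_band.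
  rewrite (wexp_fint_sqr mc mone ione (e0 n)); apply: eq_cint => s /mem_set cs.
  rewrite {1}/one_band /crestrict cs (rmorph1 (@conjc R)) mul1r -thE -cint_real.
  apply: eq_cint => t /mem_set ct; rewrite /one_band /crestrict ct mul1r.
  by rewrite poissonBC.
have le n : \int[mu]_(s in `[- c, c]) th n s <= nrm2 setT (fun s : R => (sinc_kernel c s)%:C).
  rewrite -form; apply: ler_Rintegral => //.
  - apply: (rintegrable_le measurableT _ (L2_sqr measurableT kL)).
      by apply: measurable_funM; [exact: measurable_wexp|apply: measurable_cabs2; exact: L2_meas].
    move=> x _; rewrite normrM !ger0_norm ?sqr_ge0 ?wexp_ge0// ler_piMl ?sqr_ge0//.
    exact: wexp_le1 (ltW (e0 n)).
  - exact: L2_sqr.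
  - by move=> x _; rewrite ler_piMl ?sqr_ge0//; exact: wexp_le1 (ltW (e0 n)).
have mth n : measurable_fun setT (th n).
  by apply: measurable_funB; apply: measurable_funM;
    [exact: measurable_cst|exact: measurable_atan_affine|exact: measurable_cst|exact: measurable_atan_affine].
have [||||_ lim] := @dominated_cvg_real R `[- c, c] th (fun=> 1) (fun=> 1) mc mth.
- exact: measurable_cst.
(* At the two endpoints [th n] tends to 1/2 instead; they form a null set. *)
- apply: filterS2 (ae_neq c) (ae_neq (- c)) => s sc sc' /=;
    rewrite in_itv /= => /andP[h1 h2].
  have l1 : 0 < 2 * pi * (c - s).
    by rewrite !mulr_gt0 ?pi_gt0// subr_gt0 lt_neqAle sc.
  have l2 : 0 < - (2 * pi * (- c - s)).
    rewrite -mulrN (_ : - (- c - s) = s - - c); last by ring.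
    by rewrite !mulr_gt0 ?pi_gt0// subr_gt0 lt_neqAle eq_sym sc'.
  have H y : 0 < y -> (fun n : nat => pi^-1 * atan (y * n.+1%:R)) @ \oo --> pi^-1 * (pi / 2 : R).
    by move=> y0; apply: cvgMr; exact: cvg_atan_scale.
  have {}H := cvgD (H _ l1) (H _ l2).
  have E (q : R) : q != 0 -> q^-1 * (q / 2) + q^-1 * (q / 2) = 1 by move=> q0; field.
  rewrite (E _ (lt0r_neq0 (pi_gt0 R))) in H.
  rewrite (_ : (fun n => th n s) = (fun n : nat => pi^-1 * atan (2 * pi * (c - s) * n.+1%:R) +
    pi^-1 * atan (- (2 * pi * (- c - s)) * n.+1%:R))); first exact: H.
  by apply/funext => n; rewrite /th mulNr atanN mulrN.
- exact: rintegrable_cst mc (itv_measure_lty _ _).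
- apply: aeW => s n _; rewrite -thE ger0_norm; first exact: Rintegral_poisson_le1.
  by apply: Rintegral_ge0 => t _; exact: poisson_ge0.
have L : \int[mu]_(x in `[- c, c]) 1 = 2 * c :> R.
  by rewrite (Rintegral_itv_cst _ (ltW c0)) mulr1.
rewrite -L -(cvg_lim _ lim)//; apply: limr_le; first by apply/cvg_ex; eexists; exact: lim.
by apply: nearW => n; exact: le.
Qed.

(** The reproducing kernel of the band-limited functions at the point [t], as [PWrep_ip_sinc_at]
    shows. *)
Definition sinc_at (t : R) : R -> R[i] := fun s => (sinc_kernel c (s - t))%:C.

Lemma L2_sinc_at (t : R) : L2 (sinc_at t) /\ nrm2 setT (sinc_at t) = 2 * c.
Proof.
have [kL kn] := L2_sinc0; have mk := L2_meas kL.
have m2 : measurable_fun setT (fun s => cabs (sinc_at 0 s) ^+ 2).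
  by apply: measurable_cabs2; rewrite /sinc_at; under eq_fun do rewrite subr0.
have i2 : rintegrable setT (fun s => cabs (sinc_at 0 s) ^+ 2).
  by rewrite /sinc_at; under eq_fun do rewrite subr0; exact: L2_sqr.
have E (s : R) : sinc_at t s = sinc_at 0 (s + - t) by rewrite /sinc_at subr0.
split; last first.
  rewrite -kn /nrm2; under eq_Rintegral do rewrite E.
  rewrite (ge0_Rintegral_shift (- t) m2) => [|x]; last exact: sqr_ge0.
  by apply: eq_Rintegral => x _; rewrite /sinc_at subr0.
split.
  exact: (cmeas_comp mk (measurable_shift (- t))).
under eq_fun do rewrite E.
by apply: (ge0_rintegrable_shift (- t) m2) => // x; exact: sqr_ge0.
Qed.

Definition wave (t : R) : R -> R[i] := crestrict `[- c, c] (fun xi => cexpi (- (2 * pi * t * xi))).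

Lemma band_wave (t : R) : band c (wave t). Proof. exact: band_crestrict. Qed.

Lemma L2_wave (t : R) : L2 (wave t) /\ nrm2 setT (wave t) = 2 * c.
Proof.
have mc := measurable_segment (- c) c.
have E (x : R) : cabs (wave t x) = cabs (one_band x).
  by rewrite /wave /one_band /crestrict; case: ifP => //; rewrite cabs_cexpi cabs1.
split.
  apply: (@L2_le _ _ _ _ one_bandL) => [|x]; last by rewrite E.
  apply: cmeas_restrict => //; apply: cmeas_cexpi.
  by under eq_fun do rewrite -mulNr; exact: mulrl_measurable.
rewrite -nrm2_one_band /nrm2 [RHS]Rintegral_mkcond; apply: eq_Rintegral => x _.
rewrite E patchE; case: ifPn => // xc.
by rewrite /one_band /crestrict (negbTE xc) cabs0 expr0n.
Qed.

Lemma Uop_wave (t x : R) : Uop c (wave t) x = sinc_at t x.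
Proof.
rewrite /sinc_at -cint_cexpi_sinc; apply: eq_cint => xi /mem_set cx.
by rewrite /wave /crestrict cx -cexpiD; congr cexpi; ring.
Qed.

Lemma fourierL2_sinc_at (t : R) : fourierL2 (sinc_at t) (wave t).
Proof.
have [kL kn] := L2_sinc_at t; have [gL gn] := L2_wave t.
rewrite (_ : sinc_at t = Uop c (wave t)); last by apply/funext => x; rewrite Uop_wave.
apply: fourierL2_Uop => //; first exact: band_wave.
- by rewrite (_ : Uop c (wave t) = sinc_at t)//; apply/funext => x; rewrite Uop_wave.
- by rewrite gn -kn; congr nrm2; apply/funext => x; rewrite Uop_wave.
Qed.

End SincKernel.

(** * Fourier inversion almost everywhere *)

Section Inversion.
Context {R : realType}.
Local Notation mu := (@lebesgue_measure R).
Implicit Types (A B : set R) (f g F G : R -> R[i]) (e c a b : R).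

Lemma sqr_normE (x : R) : `|x| ^+ 2 = x ^+ 2.
Proof. by rewrite real_normK ?num_real. Qed.

(** Lebesgue differentiation: the primitive based at [- n] vanishes identically, while its
    derivative is [h] almost everywhere on the right of [- n]. Letting [n] vary exhausts the
    line. *)
Lemma ae_eq0_of_itv_integrals (h : R -> R) : measurable_fun setT h ->
  (forall a b, rintegrable `[a, b] h) ->
  (forall a b, a <= b -> \int[mu]_(x in `[a, b]) h x = 0) ->
  {ae mu, forall x, h x = 0}.
Proof.
move=> mh ih h0.
have loc : locally_integrable [set: R] h.
  split; [exact: mh|exact: openT|move=> K _ cK].
  have [M [_ HM]] := compact_bounded cK.
  have KM : K `<=` `[- (`|M| + 1), `|M| + 1].
    move=> x Kx /=; rewrite in_itv /= -ler_norml.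
    by apply: (HM (`|M| + 1)) => //; rewrite (le_lt_trans (ler_norm _))// ltrDl.
  have /integrableP[_] := ih (- (`|M| + 1)) (`|M| + 1).
  apply: le_lt_trans; apply: ge0_subset_integral => //.
  - exact: compact_measurable.
  - by do 2 apply: measurableT_comp => //; exact: (measurable_funTS mh).
have H (n : nat) : {ae mu, forall x : R, - n%:R < x -> h x = 0}.
  have := @FTC1 R h (BLeft (- n%:R)) (fun y => ih _ _) loc.
  apply: filterS => x /= H nx.
  have [|_ <-] := H; first by rewrite lte_fin.
  rewrite (_ : (fun y => _) = cst 0) ?derive1_cst//.
  apply/funext => y /=; have [ny|yn] := leP (- n%:R) y; first exact: h0.
  by rewrite set_itv_ge ?bnd_simp -?ltNge// Rintegral_set0.
apply: filterS (ae_foralln H) => x /(_ (Num.truncn `|x|).+1); apply.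
rewrite ltrNl; have := ler_norm (- x); rewrite normrN => /le_lt_trans; apply.
exact: truncnS_gt.
Qed.

(** At such a distance [|t| <= 2 |b - t|]. The bound is uniform in [e <= 1], as the limit [e -> 0]
    demands, whereas [poisson_bound] covers all [t] at the price of a constant of order [1 / e]. *)
Lemma poisson_far e b (t : R) : 0 < e -> e <= 1 -> 2 * `|b| + 1 <= `|t| ->
  poisson e (b - t) <= 2 / (1 + t ^+ 2).
Proof.
move=> e0 e1 bt; have p1 : 1 <= @pi R.
  by have := @pi_ge2 R; lra.
have t1 : 1 <= `|t| by have := normr_ge0 b; lra.
have t2 : 1 <= t ^+ 2 by rewrite -(sqr_normE t); nra.
have ut : t ^+ 2 <= 4 * (b - t) ^+ 2.
  have h : `|t| <= 2 * `|b - t|.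
    by have := ler_normB b (b - t); rewrite opprB addrCA subrr addr0; lra.
  rewrite -(sqr_normE t) -(sqr_normE (b - t)); have := normr_ge0 t; nra.
have u0 : 0 < 1 + t ^+ 2 by have := sqr_ge0 t; lra.
rewrite ler_pdivrMr ?poisson_den// mulrAC ler_pdivlMr//.
have h1 : (b - t) ^+ 2 <= pi ^+ 2 * (b - t) ^+ 2.
  by rewrite ler_peMl ?sqr_ge0//; nra.
have h2 : (2 * pi * (b - t)) ^+ 2 = 4 * (pi ^+ 2 * (b - t) ^+ 2) by ring.
rewrite h2; move: (pi ^+ 2 * _) h1 => q h1.
have := sqr_ge0 e; nra.
Qed.

Lemma poisson_bound e b L (t : R) : 0 < e -> e <= 1 -> `|b| <= L ->
  poisson e (b - t) <= (2 / e * (1 + (2 * L + 1) ^+ 2) + 2) * (1 + t ^+ 2)^-1.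
Proof.
move=> e0 e1 bL; have u0 : 0 < 1 + t ^+ 2 by have := sqr_ge0 t; lra.
have E0 : 0 < 2 / e by rewrite divr_gt0.
have [h|h] := leP (2 * `|b| + 1) `|t|.
  apply: (le_trans (poisson_far e0 e1 h)); rewrite ler_wpM2r ?invr_ge0 ?(ltW u0)//.
  by rewrite lerDr mulr_ge0 ?(ltW E0)//; have := sqr_ge0 (2 * L + 1); lra.
apply: (le_trans (poisson_le _ e0)); rewrite ler_pdivlMr//.
apply: (@le_trans _ _ (2 / e * (1 + (2 * L + 1) ^+ 2))); last by rewrite lerDl.
rewrite ler_wpM2l ?(ltW E0)// lerD2l -(sqr_normE t).
by rewrite ler_pXn2r ?nnegrE//; have := normr_ge0 b; lra.
Qed.

Lemma rintegrable_inv1sqr : rintegrable setT (fun t : R => (1 + t ^+ 2)^-1).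
Proof.
have p0 (t : R) : 0 < 1 + t ^+ 2 by have := sqr_ge0 t; lra.
have cf : continuous (fun t : R => (1 + t ^+ 2)^-1).
  move=> t; apply: (@continuousV R R (fun t : R => 1 + t ^+ 2)); first by rewrite gt_eqF.
  exact: (is_derive_continuous (derD (der_cst 1) (derM der_id der_id))).
apply/integrableP; split.
  by apply/measurable_EFinP; exact: continuous_measurable_fun.
under eq_integral do rewrite abse_EFin ger0_norm ?invr_ge0 ?(ltW (p0 _))//.
rewrite ge0_Rintegral_even//; last 2 first.
- by move=> t; rewrite invr_ge0 ltW.
- by move=> t; rewrite sqrrN.
rewrite (@FTC_halfline R _ atan (pi / 2))//.
- by rewrite -EFinM ltry.
- by move=> t; rewrite invr_ge0 ltW.
- exact: is_derive1_atan.
- exact: cvgy_atan.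
Qed.

Lemma Rintegral_itvab_cst a b (k : R) : a <= b -> \int[mu]_(_ in `[a, b]) k = k * (b - a).
Proof.
move=> ab; have mc := measurable_segment a b.
transitivity (k * fine (mu `[a, b])); first exact: Rintegral_cst.
rewrite lebesgue_measure_itv /= lte_fin.
case: ltP => h //=; have -> : a = b by apply/le_anti; rewrite ab h.
by rewrite subrr.
Qed.

(** The condition under which convolution with [poisson e] converges absolutely. It contains both
    L^1 and L^2, so one inversion theorem serves [PW1] and [PW2]. *)
Definition inv1sqr_integrable f :=
  cmeas f /\ rintegrable setT (fun t => cabs (f t) * (1 + t ^+ 2)^-1).

Lemma cintegrable_poisson f e b : inv1sqr_integrable f -> 0 < e -> e <= 1 ->
  cintegrable setT (fun t => f t * (poisson e (b - t))%:C).
Proof.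
move=> [mf fi] e0 e1.
apply: (cintegrable_le measurableT _
  (rintegrableZl (2 / e * (1 + (2 * `|b| + 1) ^+ 2) + 2) measurableT fi)).
  by apply: cmeasM => //; apply: cmeas_real; exact: (jmeas1 b (jmeas_poisson e0)).
move=> t _; rewrite cabsM cabs_real ger0_norm ?poisson_ge0// [leRHS]mulrCA.
by rewrite ler_wpM2l ?cabs_ge0// poisson_bound.
Qed.

Lemma cvg_atan_sg (y : R) :
  (fun n : nat => pi^-1 * atan (2 * pi * y * n.+1%:R)) @ \oo --> (pi^-1 * (Num.sg y * (pi / 2)) : R).
Proof.
apply: cvgMr; have p2 : 0 < 2 * pi :> R by rewrite mulr_gt0 ?pi_gt0.
have [y0|y0|<-] := ltgtP 0 y.
- by rewrite gtr0_sg// mul1r; apply: cvg_atan_scale; rewrite mulr_gt0.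
- rewrite ltr0_sg// mulN1r.
  rewrite (_ : (fun n => _) = (fun n : nat => - atan (2 * pi * - y * n.+1%:R))); last first.
    by apply/funext => n; rewrite mulrN mulNr atanN opprK.
  by apply: cvgN; apply: cvg_atan_scale; rewrite mulr_gt0// oppr_gt0.
- rewrite sgr0 mul0r (_ : (fun n => _) = (fun=> 0)); first exact: cvg_cst.
  by apply/funext => n; rewrite mulr0 mul0r atan0.
Qed.

(* Integrating the smoothed identity over [a, b] replaces the Poisson kernel by
   [th n], which tends boundedly to the indicator of [a, b] as [e n] tends to 0. *)
Lemma eq_cint_Uop c f g a b : inv1sqr_integrable f -> L2 g -> band c g ->
  (forall e x, 0 < e -> e <= 1 ->
    cint setT (fun xi => (wexp e xi)%:C * (g xi * cexpi (2 * pi * x * xi))) =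
    cint setT (fun t => f t * (poisson e (x - t))%:C)) ->
  a <= b -> cint `[a, b] (Uop c g) = cint `[a, b] f.
Proof.
move=> fI gL bg Hfg ab; have [mf fi] := fI.
have mg := L2_meas gL; have ig := L2_band_cintegrable gL bg.
have icg := cintegrable_cabs measurableT mg ig.
pose e (n : nat) : R := n.+1%:R^-1.
have e0 n : 0 < e n by rewrite invr_gt0.
have e1 n : e n <= 1 by rewrite invf_le1 ?ler1n.
have mI := measurable_segment a b.
have Ioo := itv_measure_lty a b.
pose L n x := cint setT (fun xi => (wexp (e n) xi)%:C * (g xi * cexpi (2 * pi * x * xi))).
pose M := \int[mu]_xi cabs (g xi).
have jL n : jcmeas (fun x xi : R => (wexp (e n) xi)%:C * (g xi * cexpi (2 * pi * x * xi))).
  apply: jcmeasM; first by apply: jcmeas_snd; apply: cmeas_real; exact: measurable_wexp.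
  by apply: jcmeasM; [exact: (jcmeas_snd mg)|exact: jcmeas_cexpi].
have Lle n x xi : cabs ((wexp (e n) xi)%:C * (g xi * cexpi (2 * pi * x * xi))) <= cabs (g xi).
  rewrite !cabsM cabs_cexpi mulr1 cabs_real ger0_norm ?wexp_ge0//.
  by rewrite ler_piMl ?cabs_ge0// wexp_le1// ltW.
have mL n : cmeas (L n) by exact: (cmeas_cint (jL n) measurableT).
have cL x : ccvg (fun n => L n x) (Uop c g x).
  rewrite (Uop_setT x bg).
  have [|||||_ //] := @dominated_ccvg R setT (fun n xi => (wexp (e n) xi)%:C * (g xi * cexpi (2 * pi * x * xi)))
     (fun xi => g xi * cexpi (2 * pi * x * xi)) (fun xi => cabs (g xi)) measurableT.
  - by move=> n; exact: (jcmeas1 x (jL n)).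
  - exact: cmeas_mul_cexpi.
  - apply: aeW => xi _; apply: (@ccvg_le _ _ _ (fun n => (1 - wexp (e n) xi) * cabs (g xi))).
      move=> n; rewrite -[X in _ - X]mul1r -mulrBl cabsM.
      rewrite -(rmorph1 (real_complex R)) -rmorphB cabs_real cabsM cabs_cexpi mulr1.
      by rewrite distrC ger0_norm// subr_ge0 wexp_le1// ltW.
    have H1 : (fun n => 1 - wexp (e n) xi) @ \oo --> (0 : R).
      have H0 : (fun _ : nat => 1 : R) @ \oo --> (1 : R) by exact: cvg_cst.
      by have H := cvgB H0 (@cvg_wexp R xi); rewrite subrr in H; exact: H.
    by rewrite -(mul0r (cabs (g xi))); apply: cvgMl; exact: H1.
  - exact: icg.
  - by apply: aeW => xi n _; exact: Lle.
have mU := cmeas_Uop c mg.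
have [|||_ lim1] := @dominated_ccvg R `[a, b] L (Uop c g) (fun=> M) mI mL mU.
- by apply: aeW => x _; exact: cL.
- exact: rintegrable_cst.
- apply: aeW => x n _; apply: ler_cabs_cint_bound => //.
  exact: (jcmeas1 x (jL n)).
pose th (n : nat) (t : R) : R := pi^-1 * atan (2 * pi * (b - t) * n.+1%:R) -
  pi^-1 * atan (2 * pi * (a - t) * n.+1%:R).
have thE n (t : R) : \int[mu]_(x in `[a, b]) poisson (e n) (x - t) = th n t.
  rewrite (Rintegral_poisson t (e0 n) ab) /th !invrK.
  by congr (_ * atan _ - _ * atan _); ring.
have th0 n t : 0 <= th n t by rewrite -thE; apply: Rintegral_ge0 => x _; exact: poisson_ge0.
have th1 n t : th n t <= 1 by rewrite -thE; exact: Rintegral_poisson_le1.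
pose B := `|a| + `|b|.
have xB x : `[a, b]%classic x -> `|x| <= B.
  rewrite /= in_itv /= /B => /andP[ax xb]; rewrite ler_norml.
  by have := ler_norm b; have := ler_norm (- a); rewrite normrN; have := normr_ge0 a; have := normr_ge0 b; lra.
have B0 : 0 <= B by rewrite addr_ge0.
have swap n : cint `[a, b] (L n) = cint setT (fun t => f t * (th n t)%:C).
  pose K (x t : R) := f t * (poisson (e n) (x - t))%:C.
  have mK : jcmeas K.
    by apply: jcmeasM; [exact: (jcmeas_snd mf)|apply: cmeas_real; exact: (jmeas_poisson (e0 n))].
  have Kle x y : `[a, b]%classic x -> setT y ->
      cabs (K x y) <= (2 / e n * (1 + (2 * B + 1) ^+ 2) + 2) * (cabs (f y) * (1 + y ^+ 2)^-1).
    move=> xab _; rewrite cabsM cabs_real ger0_norm ?poisson_ge0// [leRHS]mulrCA.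
    by rewrite ler_wpM2l ?cabs_ge0// poisson_bound// xB.
  have FK := cFubini mI measurableT mK (rintegrable_cst (2 / e n * (1 + (2 * B + 1) ^+ 2) + 2) mI Ioo) fi Kle.
  transitivity (cint `[a, b] (fun x => cint setT (K x))).
    by apply: eq_cint => x _; exact: Hfg.
  rewrite FK; apply: eq_cint => t _; rewrite -thE -cint_real.
  have i1 : cintegrable `[a, b] (fun x => (poisson (e n) (x - t))%:C).
    by apply: cintegrable_real mI _; apply: continuous_rintegrable_itv; exact: continuous_poisson.
  by rewrite -(cintZl (f t) mI i1).
(* Domination independent of [n]: far from [[a, b]] by [poisson_far], and near it because the
   Poisson mass is at most 1. *)
have thle n t : th n t <= (1 + (2 * B + 1) ^+ 2 + 2 * (b - a)) * (1 + t ^+ 2)^-1.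
  have u0 : 0 < 1 + t ^+ 2 by have := sqr_ge0 t; lra.
  have [h|h] := leP (2 * B + 1) `|t|; last first.
    apply: (le_trans (th1 n t)); rewrite ler_pdivlMr// mul1r.
    apply: (@le_trans _ _ (1 + (2 * B + 1) ^+ 2)); last by rewrite lerDl mulr_ge0// subr_ge0.
    by rewrite lerD2l -(sqr_normE t) ler_pXn2r ?nnegrE//; lra.
  rewrite -thE; apply: (@le_trans _ _ (\int[mu]_(x in `[a, b]) (2 / (1 + t ^+ 2)))).
    apply: ler_Rintegral => //.
    - apply: continuous_rintegrable_itv; exact: continuous_poisson.
    - exact: rintegrable_cst.
    - by move=> x xab; apply: poisson_far => //; have := xB x xab; lra.
  rewrite Rintegral_itvab_cst//.
  rewrite mulrAC ler_wpM2r ?invr_ge0 ?(ltW u0)// lerDr.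
  by have := sqr_ge0 (2 * B + 1); lra.
have mth n : measurable_fun setT (th n).
  by apply: measurable_funB; apply: measurable_funM;
    [exact: measurable_cst|exact: measurable_atan_affine|exact: measurable_cst|exact: measurable_atan_affine].
have cth t : t != a -> t != b -> (fun n => th n t) @ \oo --> ((t \in `[a, b]%classic)%:R : R).
  move=> ta tb; rewrite mem_setE in_itv /=.
  have H := cvgB (@cvg_atan_sg (b - t)) (@cvg_atan_sg (a - t)).
  rewrite (_ : _%:R = pi^-1 * (Num.sg (b - t) * (pi / 2)) - pi^-1 * (Num.sg (a - t) * (pi / 2))); first exact: H.
  have E (q : R) : q != 0 -> q^-1 * (q / 2) = 2^-1 by move=> q0; field.
  have {}E s : pi^-1 * (s * (pi / 2)) = s / 2 :> R.
    by rewrite mulrCA E// lt0r_neq0// pi_gt0.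
  rewrite !E; have [h1|h1|h1] := ltgtP a t; last by rewrite h1 eqxx in ta.
  - have [h2|h2|h2] := ltgtP t b; last by rewrite h2 eqxx in tb.
    + by rewrite gtr0_sg ?subr_gt0// ltr0_sg ?subr_lt0//=; lra.
    + by rewrite ltr0_sg ?subr_lt0// ltr0_sg ?subr_lt0//=; lra.
  - by rewrite gtr0_sg ?subr_gt0 ?(lt_le_trans h1)// gtr0_sg ?subr_gt0//=; lra.
have [|||||_ lim2] := @dominated_ccvg R setT (fun n t => f t * (th n t)%:C) (crestrict `[a, b] f)
  (fun t => (1 + (2 * B + 1) ^+ 2 + 2 * (b - a)) * (cabs (f t) * (1 + t ^+ 2)^-1)) measurableT.
- by move=> n; apply: cmeasM => //; exact: cmeas_real.
- exact: cmeas_restrict.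
- apply: filterS2 (ae_neq a) (ae_neq b) => t ta tb _.
  apply: (@ccvg_le _ _ _ (fun n => cabs (f t) * `|th n t - (t \in `[a, b]%classic)%:R|)).
    move=> n; rewrite /crestrict; case: ifP => _.
      by rewrite -[X in _ - X]mulr1 -mulrBr cabsM -(rmorph1 (real_complex R)) -rmorphB cabs_real.
    by rewrite !subr0 cabsM cabs_real.
  rewrite -(mulr0 (cabs (f t))); apply: cvgMr; apply/norm_cvg0P/subr_cvg0.
  exact: cth.
- exact: rintegrableZl.
- apply: aeW => t n _; rewrite cabsM cabs_real ger0_norm// [leRHS]mulrCA.
  by rewrite ler_wpM2l ?cabs_ge0.
rewrite (cint_mkcond `[a, b] f); apply: ccvg_unique lim1 _.
by apply: eq_ccvg lim2 => n; rewrite swap.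
Qed.

(** The two functions have equal integrals over every interval. The smoothed identity is the
    hypothesis because it can be checked before any inversion: directly by [fint_poisson] in L^1, as
    a limit of truncations in L^2. *)
Lemma ae_eq_Uop c f g : inv1sqr_integrable f -> L2 g -> band c g ->
  (forall e x, 0 < e -> e <= 1 ->
    cint setT (fun xi => (wexp e xi)%:C * (g xi * cexpi (2 * pi * x * xi))) =
    cint setT (fun t => f t * (poisson e (x - t))%:C)) ->
  {ae mu, forall x, f x = Uop c g x}.
Proof.
move=> fI gL bg Hfg; have [mf fi] := fI.
have mg := L2_meas gL; have ig := L2_band_cintegrable gL bg.
have mI a b : measurable (`[a, b]%classic : set R) by exact: measurable_itv.
have mU := cmeas_Uop c mg.
have iU a b : cintegrable `[a, b] (Uop c g).
  apply: (cintegrable_le (mI a b) mU (rintegrable_cst (\int[mu]_xi cabs (g xi)) (mI a b) (itv_measure_lty _ _))).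
  move=> x _; rewrite (Uop_setT x bg); apply: ler_cabs_cint_bound => //.
  - exact: cmeas_mul_cexpi.
  - exact: cintegrable_cabs.
  - by move=> xi _; rewrite cabsM cabs_cexpi mulr1.
have iF a b : cintegrable `[a, b] f.
  have fi' := rintegrableZl (1 + (`|a| + `|b|) ^+ 2) (mI a b) (rintegrableS (mI a b) measurableT (@subsetT _ _) fi).
  apply: (cintegrable_le (mI a b) mf fi') => t; rewrite /= in_itv /= => /andP[h1 h2].
  have u0 : 0 < 1 + t ^+ 2 by have := sqr_ge0 t; lra.
  rewrite mulrA ler_pdivlMr// mulrC ler_wpM2r ?cabs_ge0// lerD2l -(sqr_normE t).
  rewrite ler_pXn2r ?nnegrE// ?addr_ge0// ler_norml.
  have := ler_norm b; have := ler_norm (- a); rewrite normrN; have := normr_ge0 a; have := normr_ge0 b.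
  by move: (`|a|) (`|b|) => x y; lra.
have iD a b : cintegrable `[a, b] (fun x => f x - Uop c g x) by exact: cintegrableB.
have D0 a b : a <= b -> cint `[a, b] (fun x => f x - Uop c g x) = 0.
  by move=> ab; rewrite (cintB (mI a b) (iF a b) (iU a b)) (eq_cint_Uop fI gL bg Hfg ab) subrr.
have [mD1 mD2] : cmeas (fun x => f x - Uop c g x) by exact: cmeasB.
have R0 := ae_eq0_of_itv_integrals mD1 (fun a b => (iD a b).1)
  (fun a b ab => etrans (esym (Re_cint _ _)) (congr1 (@complex.Re R) (D0 a b ab))).
have I0 := ae_eq0_of_itv_integrals mD2 (fun a b => (iD a b).2)
  (fun a b ab => etrans (esym (Im_cint _ _)) (congr1 (@complex.Im R) (D0 a b ab))).
apply: filterS2 R0 I0 => x h1 h2; apply/eqP; rewrite -subr_eq0; apply/eqP.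
exact: complex_eq.
Qed.

End Inversion.

(** * Band-limited functions and their transforms *)

Section Representation.
Context {R : realType}.
Local Notation mu := (@lebesgue_measure R).
Implicit Types (A B : set R) (f g h k : R -> R[i]) (e c : R).

Lemma squeeze_cvg0 (u v : nat -> R) : (forall n, 0 <= u n) -> (forall n, u n <= v n) ->
  v @ \oo --> (0 : R) -> u @ \oo --> (0 : R).
Proof.
move=> u0 uv v0; have c0 : (fun _ : nat => 0 : R) @ \oo --> (0 : R) by exact: cvg_cst.
by apply: squeeze_cvgr c0 v0; apply: nearW => n; rewrite u0 uv.
Qed.

Lemma cvg0Ml (k : R) (u : nat -> R) : u @ \oo --> (0 : R) -> (fun n => k * u n) @ \oo --> (0 : R).
Proof. by move=> u0; rewrite -[X in _ --> X](mulr0 k); apply: cvgMr; exact: u0. Qed.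

Lemma cvg0D (u v : nat -> R) : u @ \oo --> (0 : R) -> v @ \oo --> (0 : R) ->
  (fun n => u n + v n) @ \oo --> (0 : R).
Proof. by move=> u0 v0; rewrite -[X in _ --> X](addr0 0); apply: cvgD; [exact: u0|exact: v0]. Qed.

Lemma measurable_inv1sqr : measurable_fun setT (fun t : R => (1 + t ^+ 2)^-1).
Proof.
apply: continuous_measurable_fun => t.
apply: (@continuousV R R (fun t : R => 1 + t ^+ 2)).
  by rewrite gt_eqF//; have := sqr_ge0 t; lra.
exact: (is_derive_continuous (derD (der_cst 1) (derM der_id der_id))).
Qed.

Lemma L2_inv1sqr f : L2 f -> inv1sqr_integrable f.
Proof.
move=> [mf fi]; split => //.
apply: (rintegrable_le measurableT _ (rintegrableD measurableT fi rintegrable_inv1sqr)).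
  apply: measurable_funM; first exact: measurable_cabs.
  exact: measurable_inv1sqr.
move=> t _; have u1 : 1 <= 1 + t ^+ 2 by have := sqr_ge0 t; lra.
have u0 : 0 < 1 + t ^+ 2 by lra.
have w1 : (1 + t ^+ 2)^-1 <= 1 by rewrite invf_le1.
have w0 : 0 < (1 + t ^+ 2)^-1 by rewrite invr_gt0.
rewrite ger0_norm ?mulr_ge0 ?cabs_ge0 ?(ltW w0)//.
move: (_^-1) w0 w1 (cabs (f t)) (cabs_ge0 (f t)) => w w0 w1 y y0.
by have := sqr_ge0 (y - w); have := sqr_ge0 y; nra.
Qed.

Lemma cintegrable_inv1sqr f : cmeas f -> cintegrable setT f -> inv1sqr_integrable f.
Proof.
move=> mf fi; split => //.
apply: (rintegrable_le measurableT _ (cintegrable_cabs measurableT mf fi)).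
  apply: measurable_funM; first exact: measurable_cabs.
  exact: measurable_inv1sqr.
move=> t _; have u1 : 1 <= 1 + t ^+ 2 by have := sqr_ge0 t; lra.
have u0 : 0 < 1 + t ^+ 2 by lra.
by rewrite ger0_norm ?mulr_ge0 ?cabs_ge0 ?invr_ge0 ?(ltW u0)// ler_piMr ?cabs_ge0// invf_le1.
Qed.

Lemma cabs_ip_le A f g : measurable A -> L2 f -> L2 g ->
  cabs (ip A f g) <= Num.sqrt (nrm2 A f * nrm2 A g).
Proof.
move=> mA fL gL; have := CauchySchwarz mA fL gL.
by rewrite -(ler_sqrt _ (mulr_ge0 (nrm2_ge0 A f) (nrm2_ge0 A g))) sqrtr_sqr ger0_norm ?cabs_ge0.
Qed.

Lemma ccvg_ip (h_ : nat -> R -> R[i]) g k : (forall n, L2 (h_ n)) -> L2 g -> L2 k ->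
  (fun n => nrm2 setT (fun x => h_ n x - g x)) @ \oo --> (0 : R) ->
  ccvg (fun n => ip setT (h_ n) k) (ip setT g k).
Proof.
move=> hL gL kL h0.
apply: (@ccvg_le _ _ _ (fun n => Num.sqrt (nrm2 setT (fun x => h_ n x - g x) * nrm2 setT k))).
  move=> n; rewrite -(ipBl measurableT (hL n) gL kL).
  by apply: cabs_ip_le => //; exact: L2B.
have H : (fun n => nrm2 setT (fun x => h_ n x - g x) * nrm2 setT k) @ \oo --> (0 * nrm2 setT k).
  exact: cvgMl h0.
rewrite mul0r in H; rewrite -(sqrtr0 R).
exact: (cvg_comp _ _ H (@sqrt_continuous R 0)).
Qed.

(* [g] is the Fourier transform of [f], normalized to vanish everywhere, and not only
   a.e., off the band. *)
Definition PWrep c f g := [/\ L2 f, L2 g, band c g, {ae mu, forall x, f x = Uop c g x} &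
  (fun n : nat => nrm2 setT (fun xi => fint `[- n%:R, n%:R] f xi - g xi)) @ \oo --> (0 : R)].

Lemma L2_fint_itvnn f (n : nat) : L2 f -> L2 (fint `[- n%:R, n%:R] f).
Proof. by move=> fL; have [] := @Bessel R f n%:R (ler0n _ _) fL. Qed.

Lemma fourierL2_nrm2 f g : L2 f -> fourierL2 f g -> L2 g /\
  (fun n : nat => nrm2 setT (fun xi => fint `[- n%:R, n%:R] f xi - g xi)) @ \oo --> (0 : R).
Proof.
move=> fL [/Lp2E gL lim]; split => //.
have E n : l2sq setT (fun xi => fint `[- n%:R, n%:R] f xi - g xi) =
    (nrm2 setT (fun xi => fint `[- n%:R, n%:R] f xi - g xi))%:E.
  by apply: l2sqE => //; apply: L2B => //; exact: L2_fint_itvnn.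
have lim' : (fun n : nat => (nrm2 setT (fun xi => fint `[- n%:R, n%:R] f xi - g xi))%:E) @ \oo --> 0%:E.
  by apply: cvg_trans lim; apply: near_eq_cvg; apply: nearW => n; exact: E.
exact: (fine_cvg lim').
Qed.

Lemma nrm2_fourierL2 f g : L2 f -> L2 g ->
  (fun n : nat => nrm2 setT (fun xi => fint `[- n%:R, n%:R] f xi - g xi)) @ \oo --> (0 : R) ->
  fourierL2 f g.
Proof.
move=> fL gL lim; split; first exact/Lp2E.
rewrite (_ : (fun n => _) = (fun n : nat => (nrm2 setT (fun xi => fint `[- n%:R, n%:R] f xi - g xi))%:E)).
  by apply: cvg_EFin; [exact: nearW|exact: lim].
by apply/funext => n; rewrite -l2sqE//; apply: L2B => //; exact: L2_fint_itvnn.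
Qed.

Lemma L2_wexp_cexpi e (r : R) : 0 < e -> L2 (fun xi => (wexp e xi)%:C * cexpi (r * xi)).
Proof.
move=> e0; have m : cmeas (fun xi => (wexp e xi)%:C * cexpi (r * xi)).
  by apply: cmeas_mul_cexpi; apply: cmeas_real; exact: measurable_wexp.
split => //; apply: (rintegrable_le measurableT (measurable_cabs2 m) (rintegrable_wexp e0)).
move=> x _; rewrite cabsM cabs_cexpi mulr1 cabs_real !ger0_norm ?sqr_ge0 ?wexp_ge0//.
by rewrite expr2 ler_piMr ?wexp_ge0// wexp_le1// ltW.
Qed.

(** For each truncation the smoothed identity is [fint_poisson]. As [n] grows, its frequency side
    converges because the truncated transforms converge in L^2, its other side because [f] times the
    Poisson kernel is integrable. *)
Lemma fourierL2_Uop_ae c f g : L2 f -> L2 g -> band c g ->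
  (fun n : nat => nrm2 setT (fun xi => fint `[- n%:R, n%:R] f xi - g xi)) @ \oo --> (0 : R) ->
  {ae mu, forall x, f x = Uop c g x}.
Proof.
move=> fL gL bg lim; apply: ae_eq_Uop => //; first exact: L2_inv1sqr.
move=> e x e0 e1; have mf := L2_meas fL; have mg := L2_meas gL.
have mI (n : nat) := measurable_segment (- n%:R) (n%:R : R).
(* Chosen so that pairing with [k] is the damped inversion integral at [x]. *)
pose k xi := (wexp e xi)%:C * cexpi (- (2 * pi * x) * xi).
have kL : L2 k := L2_wexp_cexpi _ e0.
have ipk h : ip setT h k = cint setT (fun xi => (wexp e xi)%:C * (h xi * cexpi (2 * pi * x * xi))).
  apply: eq_cint => xi _; rewrite /k conjcM conjc_real -cexpiN mulNr opprK.
  by rewrite mulrCA.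
have l1 := ccvg_ip (fun n => L2_fint_itvnn n fL) gL kL lim.
rewrite ipk in l1.
have fP := cintegrable_poisson x (L2_inv1sqr fL) e0 e1.
have mP : cmeas (fun t => f t * (poisson e (x - t))%:C).
  by apply: cmeasM => //; apply: cmeas_real; exact: (jmeas1 x (jmeas_poisson e0)).
have l2 := ccvg_cint_itvnn mP fP.
apply: ccvg_unique l1 _; apply: eq_ccvg l2 => n.
rewrite ipk; apply/esym/fint_poisson => //.
by apply: L2_cintegrable => //; exact: itv_measure_lty.
Qed.

Lemma PW2_rep c f : PW2 c f -> exists g, PWrep c f g.
Proof.
move=> [/Lp2E fL [g0 [H ae0]]].
have [g0L lim0] := fourierL2_nrm2 fL H.
have mc := measurable_segment (- c) c.
pose g := crestrict `[- c, c] g0.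
have gL : L2 g := L2_restrict mc g0L.
have bg : band c g by exact: band_crestrict.
have gg0 : {ae mu, forall xi, g xi = g0 xi}.
  apply: filterS ae0 => xi h; rewrite /g /crestrict; case: ifPn => // /negP xc.
  by rewrite h// ltNge; apply/negP => cx; apply: xc; rewrite inE; exact/itvP_norm.
have lim : (fun n : nat => nrm2 setT (fun xi => fint `[- n%:R, n%:R] f xi - g xi)) @ \oo --> (0 : R).
  rewrite (_ : (fun n => _) = (fun n : nat => nrm2 setT (fun xi => fint `[- n%:R, n%:R] f xi - g0 xi)))//.
  apply/funext => n; have vL := L2_fint_itvnn n fL; apply: eq_ae_nrm2 => //.
  - by apply: cmeasB; exact: L2_meas.
  - by apply: cmeasB; exact: L2_meas.
  - by apply: filterS gg0 => xi ->.
by exists g; split => //; exact: fourierL2_Uop_ae.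
Qed.

Lemma PWrep_PW2 c f g : PWrep c f g -> PW2 c f.
Proof.
move=> [fL gL bg _ lim]; split; first exact/Lp2E.
by exists g; split; [exact: nrm2_fourierL2|exact: aeW].
Qed.

(** Parseval: by [ip_fint_Uop], pairing the truncated transform of [f] with [g'] is pairing [f] with
    [f'] over [[-n, n]], and both sides converge. *)
Lemma PWrep_ip c f g f' g' : PWrep c f g -> PWrep c f' g' ->
  ip setT f f' = ip setT g g'.
Proof.
move=> [fL gL bg fU lim] [f'L g'L bg' f'U lim'].
have mI (n : nat) := measurable_segment (- n%:R) (n%:R : R).
have l1 := ccvg_ip (fun n => L2_fint_itvnn n fL) gL g'L lim.
have mff : cmeas (fun t => f t * conjc (f' t)).
  by apply: cmeasM; [exact: L2_meas|apply: cmeas_conj; exact: L2_meas].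
have l2 := ccvg_cint_itvnn mff (L2_ip measurableT fL f'L).
apply: ccvg_unique l2 _; apply: eq_ccvg l1 => n.
rewrite (ip_fint_Uop (mI n) (itv_measure_lty _ _) fL g'L bg').
apply: eq_ae_cint => //.
- by apply: cmeasM; [exact: L2_meas|apply: cmeas_conj; apply: cmeas_Uop; exact: L2_meas].
- by apply: filterS f'U => x ->.
Qed.

Lemma PWrep_nrm2 c f g : PWrep c f g -> nrm2 setT f = nrm2 setT g.
Proof. by move=> r; rewrite !nrm2E (PWrep_ip r r). Qed.

Lemma PWrep_sinc_at c (t : R) : 0 < c -> PWrep c (sinc_at c t) (wave c t).
Proof.
move=> c0; have [kL _] := L2_sinc_at c0 t; have [gL _] := L2_wave c0 t.
have [_ lim] := fourierL2_nrm2 kL (fourierL2_sinc_at c0 t).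
split => //; first exact: band_wave.
by apply: aeW => x; rewrite Uop_wave.
Qed.

(** Reproducing property, from Parseval and the explicit transform [wave c t] of the kernel. *)
Lemma PWrep_ip_sinc_at c f g (t : R) : 0 < c -> PWrep c f g -> ip setT f (sinc_at c t) = Uop c g t.
Proof.
move=> c0 r; have [_ gL bg _ _] := r; rewrite (PWrep_ip r (PWrep_sinc_at t c0)) (Uop_setT t bg).
apply: eq_cint => xi _; rewrite /wave /crestrict; case: ifPn => h.
  by rewrite -cexpiN opprK.
by rewrite -(band_restrict bg) /crestrict (negbTE h) !mul0r.
Qed.

Lemma fintD A f g (xi : R) : measurable A -> (mu A < +oo)%E -> L2 f -> L2 g ->
  fint A (fun x => f x + g x) xi = fint A f xi + fint A g xi.
Proof.
move=> mA Aoo fL gL.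
have i1 := cintegrable_fint xi mA (L2_meas fL) (L2_cintegrable mA Aoo fL).
have i2 := cintegrable_fint xi mA (L2_meas gL) (L2_cintegrable mA Aoo gL).
by rewrite /fint -(cintD mA i1 i2); apply: eq_cint => x _; rewrite mulrDl.
Qed.

Lemma fintZ A z f (xi : R) : measurable A -> (mu A < +oo)%E -> L2 f ->
  fint A (fun x => z * f x) xi = z * fint A f xi.
Proof.
move=> mA Aoo fL.
have i1 := cintegrable_fint xi mA (L2_meas fL) (L2_cintegrable mA Aoo fL).
by rewrite /fint -(cintZl z mA i1); apply: eq_cint => x _; rewrite mulrA.
Qed.

Lemma UopD c f g (x : R) : L2 f -> L2 g ->
  Uop c (fun xi => f xi + g xi) x = Uop c f x + Uop c g x.
Proof.
move=> fL gL; have mc := measurable_segment (- c) c.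
have i1 := cintegrable_mul_cexpi (2 * pi * x) mc (L2_meas fL) (L2_cintegrable mc (itv_measure_lty _ _) fL).
have i2 := cintegrable_mul_cexpi (2 * pi * x) mc (L2_meas gL) (L2_cintegrable mc (itv_measure_lty _ _) gL).
by rewrite /Uop -(cintD mc i1 i2); apply: eq_cint => xi _; rewrite mulrDl.
Qed.

Lemma UopZ c z f (x : R) : L2 f -> Uop c (fun xi => z * f xi) x = z * Uop c f x.
Proof.
move=> fL; have mc := measurable_segment (- c) c.
have i1 := cintegrable_mul_cexpi (2 * pi * x) mc (L2_meas fL) (L2_cintegrable mc (itv_measure_lty _ _) fL).
by rewrite /Uop -(cintZl z mc i1); apply: eq_cint => xi _; rewrite mulrA.
Qed.

Lemma PWrepD c f g f' g' : PWrep c f g -> PWrep c f' g' ->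
  PWrep c (fun x => f x + f' x) (fun x => g x + g' x).
Proof.
move=> [fL gL bg fU lim] [f'L g'L bg' f'U lim'].
have mI (n : nat) := measurable_segment (- n%:R) (n%:R : R).
split; [exact: L2D|exact: L2D|by move=> xi h; rewrite bg// bg'// addr0| |].
  by apply: filterS2 fU f'U => x -> ->; rewrite UopD.
have l2 := @cvg0D _ _ (@cvg0Ml 2 _ lim) (@cvg0Ml 2 _ lim').
apply: squeeze_cvg0 l2 => n; first exact: nrm2_ge0.
rewrite (_ : (fun xi => _) = (fun xi => (fint `[- n%:R, n%:R] f xi - g xi) +
    (fint `[- n%:R, n%:R] f' xi - g' xi))); last first.
  by apply/funext => xi; rewrite fintD ?itv_measure_lty// opprD addrACA.
by apply: nrm2D_le => //; apply: L2B => //; exact: L2_fint_itvnn.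
Qed.

Lemma PWrepZ c z f g : PWrep c f g -> PWrep c (fun x => z * f x) (fun x => z * g x).
Proof.
move=> [fL gL bg fU lim].
have mI (n : nat) := measurable_segment (- n%:R) (n%:R : R).
split; [exact: L2Z|exact: L2Z|by move=> xi h; rewrite bg// mulr0| |].
  by apply: filterS fU => x ->; rewrite UopZ.
have l2 := @cvg0Ml (cabs z ^+ 2) _ lim.
rewrite (_ : (fun n => _) = (fun n : nat => cabs z ^+ 2 *
   nrm2 setT (fun xi => fint `[- n%:R, n%:R] f xi - g xi))); first exact: l2.
apply/funext => n; rewrite -nrm2Z//; last by apply: L2B => //; exact: L2_fint_itvnn.
by congr nrm2; apply/funext => xi; rewrite fintZ ?itv_measure_lty// mulrBr.
Qed.

Lemma PWrep0 c : PWrep c (fun=> 0) (fun=> 0).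
Proof.
have mI (n : nat) := measurable_segment (- n%:R) (n%:R : R).
have U0 (A : set R) (k : R -> R[i]) : cint A (fun x => 0 * k x) = 0.
  by rewrite (eq_cint (g := fun=> 0)) ?cint0// => x _; rewrite mul0r.
split; [exact: L20|exact: L20|by []|by apply: aeW => x; rewrite /Uop U0|].
rewrite (_ : (fun n => _) = (fun=> 0)); first exact: cvg_cst.
apply/funext => n; rewrite /nrm2 /Rintegral integral0_eq// => x _.
by rewrite /fint U0 subr0 cabs0 expr0n.
Qed.

Lemma PWrep_sum c (I : Type) (r : seq I) (f_ g_ : I -> R -> R[i]) :
  (forall i, PWrep c (f_ i) (g_ i)) ->
  PWrep c (fun x => \sum_(i <- r) f_ i x) (fun x => \sum_(i <- r) g_ i x).
Proof.
move=> H; elim: r => [|i r IH].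
  by under eq_fun do rewrite big_nil; under [X in PWrep _ _ X]eq_fun do rewrite big_nil; exact: PWrep0.
under eq_fun do rewrite big_cons; under [X in PWrep _ _ X]eq_fun do rewrite big_cons.
exact: PWrepD.
Qed.

(** The transform of [f] is bounded and vanishes off the band, hence lies in L^2, and inversion
    gives [f = Uop c g] almost everywhere; Fubini over the band makes the sinc kernel appear. The
    case p = 1 is thereby reduced to convergence towards [Pc c f]. *)
Lemma PW1_Pc c f : 0 < c -> PW1 c f -> {ae mu, forall x, f x = Pc c f x}.
Proof.
move=> c0 [[mf fi] f0].
have iC : rintegrable setT (fun x => cabs (f x)).
  apply/integrableP; split; first by apply/measurable_EFinP; exact: measurable_cabs.
  apply: le_lt_trans fi; rewrite le_eqVlt; apply/orP; left; apply/eqP.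
  by apply: eq_integral => x _; rewrite powRr1 ?cabs_ge0// abse_EFin ger0_norm ?cabs_ge0.
have iF : cintegrable setT f by apply/cintegrableP.
pose g := fint setT f.
have mg : cmeas g by exact: cmeas_fint.
have bg : band c g by move=> xi; exact: f0.
have mc := measurable_segment (- c) c.
have gL : L2 g.
  apply: (@L2_bounded R `[- c, c] g (\int[mu]_t cabs (f t))) => //.
  - exact: itv_measure_lty.
  - by move=> xi _; exact: cabs_fint_le.
  - move=> xi h; apply: bg; rewrite ltNge; apply/negP => H; apply: h; exact/itvP_norm.
have fU : {ae mu, forall x, f x = Uop c g x}.
  apply: ae_eq_Uop => //; first exact: cintegrable_inv1sqr.
  by move=> e x e0 _; exact: fint_poisson.
apply: filterS fU => x ->.
pose K (xi t : R) := f t * cexpi (- (2 * pi * xi * t)) * cexpi (2 * pi * x * xi).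
have mK : jcmeas K.
  apply: jcmeasM; first exact: (jcmeas_fint mf).
  by apply: jcmeas_fst; apply: cmeas_cexpi; exact: mulrl_measurable.
have Kle y t : `[- c, c]%classic y -> setT t -> cabs (K y t) <= 1 * cabs (f t).
  by move=> _ _; rewrite /K !cabsM !cabs_cexpi !mulr1 mul1r.
have FK := cFubini mc measurableT mK (rintegrable_cst 1 mc (itv_measure_lty _ _)) iC Kle.
transitivity (cint `[- c, c] (fun xi => cint setT (K xi))).
  apply: eq_cint => xi _; have i1 := cintegrable_fint xi measurableT mf iF.
  by rewrite /g /fint -(cintZr (cexpi (2 * pi * x * xi)) measurableT i1).
rewrite FK; apply: eq_cint => t _; rewrite -(cint_cexpi_sinc c0).
have i2 : cintegrable `[- c, c] (fun xi => cexpi (2 * pi * (x - t) * xi)).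
  apply: (cintegrable_le mc _ (rintegrable_cst 1 mc (itv_measure_lty _ _))).
    by apply: cmeas_cexpi; exact: mulrl_measurable.
  by move=> xi _; rewrite cabs_cexpi.
rewrite -(cintZl (f t) mc i2); apply: eq_cint => xi _.
by rewrite /K -mulrA -cexpiD; congr (_ * cexpi _); ring.
Qed.

End Representation.
(** * Extrapolation of band-limited functions *)

Section Taylor.
Context {R : realType}.
Implicit Types (F f : R -> R) (n : nat).

Lemma derX n : der (fun x : R => x ^+ n.+1) (fun x => n.+1%:R * x ^+ n).
Proof.
elim: n => [|n IH]; first by apply: der_eq der_id _ => x; rewrite expr0 mulr1.
rewrite (_ : (fun x => _) = (fun x : R => id x * x ^+ n.+1)); last first.
  by apply/funext => x; rewrite exprS.
apply: der_eq (derM der_id IH) _ => x /=.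
by rewrite mulr1 mulrCA -exprS -[in RHS]natr1 mulrDl mul1r.
Qed.

Lemma der_sum n (F_ f_ : nat -> R -> R) : (forall k, der (F_ k) (f_ k)) ->
  der (fun x => \sum_(k < n) F_ k x) (fun x => \sum_(k < n) f_ k x).
Proof.
move=> H; elim: n => [|n IH].
  rewrite (_ : (fun x => _) = fun=> 0); last by apply/funext => x; rewrite big_ord0.
  by apply: der_eq (der_cst 0) _ => x; rewrite big_ord0.
rewrite (_ : (fun x => _) = fun x => \sum_(k < n) F_ k x + F_ n x); last first.
  by apply/funext => x; rewrite big_ord_recr.
by apply: der_eq (derD IH (H n)) _ => x; rewrite big_ord_recr.
Qed.

Lemma der_nonneg F f (x : R) : der F f -> (forall y, 0 <= y -> 0 <= f y) -> 0 <= x -> F 0 <= F x.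
Proof.
move=> dF f0 x0.
have [||y] := @MVT_segment R F f 0 x x0.
- by move=> y _; exact: dF.
- by apply: continuous_subspaceT; exact: is_derive_continuous dF.
rewrite in_itv /= => /andP[y0 _] E; rewrite -subr_ge0 E subr0.
by rewrite mulr_ge0// f0.
Qed.

(** Monotonicity of the difference with [x^(n+1) / (n+1)!] on the positive half-line gives one of
    four inequalities; replacing [F] by [- F] and [x] by [- x] gives the others. *)
Lemma ler_antiderivative n F f : der F f -> F 0 = 0 ->
  (forall x, `|f x| <= `|x| ^+ n / n`!%:R) ->
  forall x, `|F x| <= `|x| ^+ n.+1 / n.+1`!%:R.
Proof.
have fact0 k : k`!%:R != 0 :> R by rewrite pnatr_eq0 -lt0n fact_gt0.
have dP : der (fun x : R => n.+1`!%:R^-1 * x ^+ n.+1) (fun x => x ^+ n / n`!%:R).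
  apply: der_eq (derZ n.+1`!%:R^-1 (derX n)) _ => x.
  have n0 : n.+1%:R != 0 :> R by rewrite pnatr_eq0.
  rewrite factS natrM; move: (fact0 n) n0; move: n`!%:R n.+1%:R (x ^+ n) => p q y p0 q0.
  by field; rewrite p0 q0.
have H F1 f1 : der F1 f1 -> F1 0 = 0 -> (forall x, `|f1 x| <= `|x| ^+ n / n`!%:R) ->
    forall x, 0 <= x -> F1 x <= x ^+ n.+1 / n.+1`!%:R.
  move=> dF F0 fle x x0.
  have := @der_nonneg _ _ x (derD dP (derZ (-1) dF)).
  rewrite F0 expr0n /= !mulr0 addr0 mulN1r subr_ge0 mulrC; apply => // y y0.
  rewrite mulN1r subr_ge0; apply: le_trans (ler_norm _) _.
  by apply: le_trans (fle y) _; rewrite ger0_norm.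
have H2 F1 f1 : der F1 f1 -> F1 0 = 0 -> (forall x, `|f1 x| <= `|x| ^+ n / n`!%:R) ->
    forall x, 0 <= x -> `|F1 x| <= x ^+ n.+1 / n.+1`!%:R.
  move=> dF F0 fle x x0; rewrite ler_norml; apply/andP; split; last exact: H dF F0 fle x x0.
  rewrite lerNl -mulN1r; apply: (H _ _ (derZ (-1) dF)) => //; first by rewrite F0 mulr0.
  by move=> y; rewrite mulN1r normrN.
move=> dF F0 fle x; have [x0|x0] := leP 0 x.
  by rewrite (ger0_norm x0); exact: H2 dF F0 fle x x0.
rewrite (ltr0_norm x0).
have := H2 _ _ (der_comp dF (der_linear (-1))) _ _ (- x).
rewrite !mulN1r opprK; apply => //.
- by rewrite oppr0.
- by move=> y; rewrite mulN1r mulrN1 normrN -[X in X ^+ n]normrN.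
- by rewrite oppr_ge0 ltW.
Qed.

(** Taylor's theorem with unspecified coefficients: integrating the polynomial of the sine yields
    that of the cosine and conversely. Only degree and error matter, since the polynomial will be
    paired with vanishing moments. *)
Lemma trig_approx n : exists a b : nat -> R, forall x : R,
  `|cos x - \sum_(k < n) a k * x ^+ k| <= `|x| ^+ n / n`!%:R /\
  `|sin x - \sum_(k < n) b k * x ^+ k| <= `|x| ^+ n / n`!%:R.
Proof.
elim: n => [|n [a [b H]]].
  exists (fun=> 0), (fun=> 0) => x; rewrite !big_ord0 !subr0 expr0 fact0 divr1.
  by split; [exact: norm_cos_le1|exact: norm_sin_le1].
have dS (u : nat -> R) : der (fun x => \sum_(k < n) u k / k.+1%:R * x ^+ k.+1)
    (fun x => \sum_(k < n) u k * x ^+ k).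
  apply: der_eq (@der_sum n _ _ (fun k => derZ (u k / k.+1%:R) (derX k))) _ => x.
  by apply: eq_bigr => k _; rewrite mulrA divfK ?pnatr_eq0.
(* Coefficients of the primitive that takes the value [z] at 0. *)
pose ad (u : nat -> R) z k := if k is k'.+1 then u k' / k'.+1%:R else z.
have E (u : nat -> R) z x : \sum_(k < n.+1) ad u z k * x ^+ k =
    z + \sum_(k < n) u k / k.+1%:R * x ^+ k.+1.
  by rewrite big_ord_recl expr0 mulr1.
exists (ad (fun k => - b k) 1), (ad a 0) => x; rewrite !E; split.
- have d := derD (@is_derive_cos R) (derZ (-1) (derD (der_cst 1) (dS (fun k => - b k)))).
  rewrite -mulN1r; apply: (@ler_antiderivative n _ _ d).
    by rewrite cos0 big1 ?addr0 ?mulN1r ?subrr// => k _; rewrite expr0n mulr0.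
  move=> y; have [_] := H y; rewrite add0r -[X in X <= _ -> _]normrN.
  congr (`|_| <= _); rewrite opprB mulN1r addrC; congr (_ + _).
  by rewrite -sumrN; apply: eq_bigr => k _; rewrite mulNr opprK.
- have d := derD (@is_derive_sin R) (derZ (-1) (derD (der_cst 0) (dS a))).
  rewrite -mulN1r; apply: (@ler_antiderivative n _ _ d).
    by rewrite sin0 big1 ?addr0 ?mulr0 ?addr0// => k _; rewrite expr0n mulr0.
  by move=> y; have [] := H y; rewrite add0r mulN1r.
Qed.

Lemma cexpi_approx n : exists z : nat -> R[i], forall x : R,
  cabs (cexpi x - \sum_(k < n) z k * (x ^+ k)%:C) <= 2 * (`|x| ^+ n / n`!%:R).
Proof.
have [a [b H]] := trig_approx n; exists (fun k => a k +i* b k) => x.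
have [h1 h2] := H x; apply: le_trans (ler_cabs_ReIm _) _.
have E : \sum_(k < n) (a k +i* b k) * (x ^+ k)%:C =
    (\sum_(k < n) a k * x ^+ k) +i* (\sum_(k < n) b k * x ^+ k).
  elim: n {H h1 h2} => [|n IH]; first by rewrite !big_ord0.
  rewrite !big_ord_recr /= IH; apply: complex_eq; rewrite ?ReD ?ImD ?ReM ?ImM /=; ring.
by rewrite E cexpiE ReD ReN ImD ImN /=; lra.
Qed.

Lemma cabs_cexpiB1 (x : R) : cabs (cexpi x - 1) <= 2 * `|x|.
Proof.
apply: le_trans (ler_cabs_ReIm _) _; rewrite cexpiE ReD ReN ImD ImN /= subr0.
have h1 : `|cos x - 1| <= `|x|.
  have := @ler_antiderivative 0 _ _ (derD (@is_derive_cos R) (der_cst (-1))) _ _ x.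
  rewrite expr1 fact0 divr1; apply; first by rewrite cos0 subrr.
  by move=> y; rewrite addr0 normrN expr0 divr1 norm_sin_le1.
have h2 : `|sin x| <= `|x|.
  have := @ler_antiderivative 0 _ _ (@is_derive_sin R) (sin0 R) _ x.
  rewrite expr1 fact0 divr1; apply => y.
  by rewrite expr0 divr1 norm_cos_le1.
lra.
Qed.

End Taylor.

(** * Extrapolation along an arithmetic progression *)

Section Extrapolation.
Context {R : realType}.
Local Notation mu := (@lebesgue_measure R).
Implicit Types (c s y : R) (g : R -> R[i]).

(* The [k]-th finite difference of step [s] of [Uop c g]. *)
Definition Vop c g s k y : R[i] :=
  cint `[- c, c] (fun xi => g xi * cexpi (2 * pi * y * xi) * (cexpi (2 * pi * s * xi) - 1) ^+ k).

Lemma cabs_step_le2 (x : R) : cabs (cexpi x - 1) <= 2.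
Proof. by apply: le_trans (ler_cabsB _ _) _; rewrite cabs_cexpi cabs1. Qed.

Lemma cmeas_step s (k : nat) : cmeas (fun xi : R => (cexpi (2 * pi * s * xi) - 1) ^+ k).
Proof.
elim: k => [|k IH]; first exact: cmeas_cst.
under eq_fun do rewrite exprS; apply: cmeasM => //; apply: cmeasB; last exact: cmeas_cst.
by apply: cmeas_cexpi; exact: mulrl_measurable.
Qed.

(** Of the [k] factors, [m] are bounded by the small quantity [4 pi c |s|] and the others by 2. The
    full [2 ^+ k] is kept to match the bound on differences of low order. *)
Lemma cabs_step_small c s (xi : R) m k : (m <= k)%N -> `|xi| <= c ->
  cabs ((cexpi (2 * pi * s * xi) - 1) ^+ k) <= (4 * pi * c * `|s|) ^+ m * 2 ^+ k.
Proof.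
move=> mk xc; rewrite cabsX -(subnKC mk) !exprD mulrA.
have z1 : cabs (cexpi (2 * pi * s * xi) - 1) <= 4 * pi * c * `|s|.
  apply: le_trans (cabs_cexpiB1 _) _; rewrite !normrM (ger0_norm (pi_ge0 R)) ger0_norm//.
  have := pi_ge0 R; have := normr_ge0 s; move: (`|s|) (`|xi|) xc (@pi R) => a b bc p a0 p0.
  have -> : 4 * p * c * a = 2 * (2 * p * a * c) by ring.
  by rewrite ler_wpM2l// ler_wpM2l// !mulr_ge0.
apply: ler_pM; rewrite ?exprn_ge0 ?cabs_ge0//.
  apply: (@le_trans _ _ ((4 * pi * c * `|s|) ^+ m)).
    by rewrite lerXn2r ?nnegrE ?cabs_ge0// (le_trans (cabs_ge0 _) z1).
  by rewrite ler_peMr ?exprn_ge0 ?exprn_ege1 ?(le_trans (cabs_ge0 _) z1)// ler1n.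
by rewrite lerXn2r ?nnegrE ?cabs_ge0// cabs_step_le2.
Qed.

Lemma cintegrable_Vop c g s k y : cmeas g -> cintegrable `[- c, c] g ->
  cintegrable `[- c, c]
    (fun xi => g xi * cexpi (2 * pi * y * xi) * (cexpi (2 * pi * s * xi) - 1) ^+ k).
Proof.
move=> mg ig; have mc := measurable_segment (- c) c.
have icg := rintegrableZl (2 ^+ k) mc (cintegrable_cabs mc mg ig).
apply: (cintegrable_le mc _ icg).
  by apply: cmeasM; [exact: cmeas_mul_cexpi|exact: cmeas_step].
move=> xi _; rewrite !cabsM cabs_cexpi mulr1 mulrC cabsX.
by rewrite ler_wpM2r ?cabs_ge0// lerXn2r ?nnegrE ?cabs_ge0// cabs_step_le2.
Qed.

Lemma Vop0 c g s y : Vop c g s 0 y = Uop c g y.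
Proof. by apply: eq_cint => xi _; rewrite expr0 mulr1. Qed.

Lemma VopS c g s k y : cmeas g -> cintegrable `[- c, c] g ->
  Vop c g s k.+1 y = Vop c g s k (y + s) - Vop c g s k y.
Proof.
move=> mg ig; have mc := measurable_segment (- c) c.
have i1 := cintegrable_Vop s k (y + s) mg ig; have i2 := cintegrable_Vop s k y mg ig.
rewrite /Vop -(cintB mc i1 i2); apply: eq_cint => xi _.
have -> : 2 * pi * (y + s) * xi = 2 * pi * y * xi + 2 * pi * s * xi by ring.
by rewrite cexpiD exprS; ring.
Qed.

Section Grid.
Variables (c : R) (g : R -> R[i]) (G s : R) (m : nat).
Hypothesis mg : cmeas g.
Hypothesis ig : cintegrable `[- c, c] g.
Hypothesis gG : \int[mu]_(xi in `[- c, c]) cabs (g xi) <= G.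

(** What controls the extrapolation: the values at the first [m] grid points, and the smallness that
    the bounded spectrum forces on differences of order at least [m]. *)
Let E y := \sum_(j < m) cabs (Uop c g (y + j%:R * s)) + (4 * pi * c * `|s|) ^+ m * G.

Lemma cabs_Vop_small k y : (m <= k)%N -> 0 <= c ->
  cabs (Vop c g s k y) <= 2 ^+ k * ((4 * pi * c * `|s|) ^+ m * G).
Proof.
move=> mk c0; have mc := measurable_segment (- c) c.
have icg := cintegrable_cabs mc mg ig.
have b0 : 0 <= (4 * pi * c * `|s|) ^+ m * 2 ^+ k :> R.
  by rewrite mulr_ge0 ?exprn_ge0// !mulr_ge0// pi_ge0.
apply: (@le_trans _ _ (\int[mu]_(xi in `[- c, c])
    ((4 * pi * c * `|s|) ^+ m * 2 ^+ k * cabs (g xi)))).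
  apply: ler_cabs_cint_bound => //.
  - by apply: cmeasM; [exact: cmeas_mul_cexpi|exact: cmeas_step].
  - exact: rintegrableZl.
  - move=> xi /itvP_norm xc; rewrite !cabsM cabs_cexpi mulr1 mulrC.
    by rewrite ler_wpM2r ?cabs_ge0// cabs_step_small.
rewrite (@RintegralZl _ _ _ mu _ _ _ mc icg) mulrA [X in _ <= X * _]mulrC.
exact: ler_wpM2l.
Qed.

Lemma cabs_Vop_sum k y :
  cabs (Vop c g s k y) <= 2 ^+ k * \sum_(j < k.+1) cabs (Uop c g (y + j%:R * s)).
Proof.
elim: k y => [|k IH] y.
  by rewrite Vop0 big_ord1 mul0r addr0 expr0 mul1r.
rewrite VopS//; apply: le_trans (ler_cabsB _ _) _.
apply: le_trans (lerD (IH _) (IH _)) _.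
rewrite -mulrDr exprSr -mulrA ler_wpM2l ?exprn_ge0//.
set S := \sum_(j < k.+2) _.
have h1 : \sum_(j < k.+1) cabs (Uop c g (y + s + j%:R * s)) <= S.
  rewrite /S [X in _ <= X]big_ord_recl; apply: ler_wpDl; first exact: cabs_ge0.
  apply: ler_sum => j _.
  have -> : y + s + j%:R * s = y + (bump 0 j)%:R * s by rewrite /bump /= natrD; ring.
  by [].
have h2 : \sum_(j < k.+1) cabs (Uop c g (y + j%:R * s)) <= S.
  by rewrite /S [X in _ <= X]big_ord_recr /= lerDl cabs_ge0.
rewrite mulr_natl mulr2n; exact: (lerD h1 h2).
Qed.

(** Differences of order below [m] involve only the first [m] grid values; those of order at least
    [m] are small because of the band limit. A bound valid for every [k] is needed since each step
    of the extrapolation raises the order by one. *)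
Lemma cabs_Vop_le k y : 0 <= c -> cabs (Vop c g s k y) <= 2 ^+ k * E y.
Proof.
move=> c0; have mc := measurable_segment (- c) c.
have G0 : 0 <= G by apply: le_trans gG; apply: Rintegral_ge0 => x _; exact: cabs_ge0.
have b0 : 0 <= (4 * pi * c * `|s|) ^+ m * G.
  by rewrite mulr_ge0// exprn_ge0// !mulr_ge0// pi_ge0.
have [mk|km] := leqP m k.
  apply: le_trans (cabs_Vop_small y mk c0) _; rewrite ler_wpM2l ?exprn_ge0// lerDr.
  by apply: sumr_ge0 => j _; exact: cabs_ge0.
apply: le_trans (cabs_Vop_sum k y) _; rewrite ler_wpM2l ?exprn_ge0//.
apply: (@le_trans _ _ (\sum_(j < m) cabs (Uop c g (y + j%:R * s)))); last by rewrite lerDl.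
rewrite -(subnKC km) big_split_ord /= lerDl.
by apply: sumr_ge0 => j _; exact: cabs_ge0.
Qed.

(* Since [V k (y + s) = V k y + V k.+1 y], each step of length s costs a factor
   1 + 2 in the bound [2 ^+ k * E]. *)
Lemma cabs_Uop_grid r y : 0 <= c -> cabs (Uop c g (y + r%:R * s)) <= 3 ^+ r * E y.
Proof.
move=> c0.
have H k : cabs (Vop c g s k (y + r%:R * s)) <= 3 ^+ r * (2 ^+ k * E y).
  elim: r k => [|r IH] k; first by rewrite mul0r addr0 expr0 mul1r cabs_Vop_le.
  have -> : y + r.+1%:R * s = y + r%:R * s + s by rewrite -natr1; ring.
  have -> : Vop c g s k (y + r%:R * s + s) =
      Vop c g s k.+1 (y + r%:R * s) + Vop c g s k (y + r%:R * s).
    by rewrite (VopS _ _ _ mg ig) subrK.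
  apply: le_trans (ler_cabsD _ _) _; apply: le_trans (lerD (IH _) (IH _)) _.
  rewrite !exprS le_eqVlt; apply/orP; left; apply/eqP; ring.
by have := H 0%N; rewrite Vop0 expr0 mul1r.
Qed.

End Grid.
End Extrapolation.

(** * Extrapolation in mean, from ]-1, 1[ to bounded cells *)

Section ExtrapolationL1.
Context {R : realType}.
Local Notation mu := (@lebesgue_measure R).
Implicit Types (h : R -> R) (c : R) (g : R -> R[i]).
Local Notation I := (`]-1, 1[%classic : set R).

Lemma rintegrable_sum (A : set R) (n : nat) (F : 'I_n -> R -> R) : measurable A ->
  (forall j, rintegrable A (F j)) -> rintegrable A (fun x => \sum_(j < n) F j x).
Proof.
move=> mA iF; elim: n F iF => [|n IH] F iF.
  by under eq_fun do rewrite big_ord0; exact: integrable0.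
under eq_fun do rewrite big_ord_recl; apply: rintegrableD => //.
exact: (IH (fun j => F (lift ord0 j))).
Qed.

Lemma Rintegral_sum (A : set R) (n : nat) (F : 'I_n -> R -> R) : measurable A ->
  (forall j, rintegrable A (F j)) ->
  \int[mu]_(x in A) (\sum_(j < n) F j x) = \sum_(j < n) \int[mu]_(x in A) F j x.
Proof.
move=> mA; elim: n F => [|n IH] F iF.
  rewrite big_ord0; under eq_Rintegral do rewrite big_ord0.
  by rewrite /Rintegral integral0.
rewrite big_ord_recl -(IH (fun j => F (lift ord0 j)))//.
have i2 := rintegrable_sum (F := fun j => F (lift ord0 j)) mA (fun j => iF _).
rewrite -(@RintegralD _ _ _ mu _ _ _ mA (iF ord0) i2).
by apply: eq_Rintegral => x _; rewrite big_ord_recl.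
Qed.

Lemma Rintegral_shift_le (A B : set R) h (a : R) : measurable A -> measurable B ->
  measurable_fun setT h -> (forall x, 0 <= h x) -> rintegrable B h ->
  (forall y, A y -> B (y + a)) ->
  rintegrable A (fun y => h (y + a)) /\ \int[mu]_(y in A) h (y + a) <= \int[mu]_(x in B) h x.
Proof.
move=> mA mB mh h0 ih AB.
have mhB := measurable_restrictR mB mh.
have hB0 x : 0 <= (h \_ B) x by rewrite patchE; case: ifP.
have ihB := (rintegrable_mkcond h mB).1 ih.
have ish := ge0_rintegrable_shift a mhB hB0 ihB.
have E y : A y -> h (y + a) = (h \_ B) (y + a).
  by move=> Ay; rewrite patchE mem_set//; exact: AB.
have msh : measurable_fun setT (fun y : R => h (y + a)) := measurableT_comp mh (measurable_shift a).
have iA : rintegrable A (fun y => h (y + a)).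
  apply: (rintegrable_le mA msh (rintegrableS mA measurableT (@subsetT _ _) ish)) => y Ay.
  by rewrite -(E y Ay) ger0_norm.
split=> //; rewrite [leLHS]Rintegral_mkcond [leRHS]Rintegral_mkcond.
rewrite -(ge0_Rintegral_shift a mhB hB0); apply: ler_Rintegral => //.
  exact: (rintegrable_mkcond (fun y => h (y + a)) mA).1.
move=> y _; rewrite [leLHS]patchE; case: ifPn => [|_]; last exact: hB0.
by rewrite inE => /E ->.
Qed.

Lemma itv_lty (b1 b2 : bool) (x y : R) :
  (mu [set` Interval (BSide b1 x) (BSide b2 y)] < +oo)%E.
Proof. by rewrite lebesgue_measure_itv; case: ifP => _; rewrite -?EFinB ltry. Qed.

(* The cells are the integer translates, away from 0, of the two halves of ]-1, 1[. Moving from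
   a half by less than 1 in the direction of its cells does not leave ]-1, 1[. *)
Definition sgb (b : bool) : R := if b then 1 else -1.
Definition unit_start (b : bool) : set R := if b then `]-1, 0]%classic else `[0, 1[%classic.
Definition unit_cell (b : bool) (X : nat) : set R := [set x | unit_start b (x - sgb b * X%:R)].

Lemma measurable_unit_start b : measurable (unit_start b).
Proof. by case: b; exact: measurable_itv. Qed.

Lemma norm_sgb b : `|sgb b| = 1.
Proof. by case: b; rewrite /= ?normrN normr1. Qed.

Lemma unit_start_lty b : (mu (unit_start b) < +oo)%E.
Proof. by case: b; exact: itv_lty. Qed.

Lemma unit_start_shift b (t y : R) : 0 <= t < 1 -> unit_start b y -> I (y + sgb b * t).
Proof.
by move=> /andP[t0 t1]; case: b; rewrite /= !in_itv /= ?mul1r ?mulN1r => /andP[y0 y1];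
  apply/andP; split; lra.
Qed.

Lemma unit_cellE b X : unit_cell b X =
  if b then `](-1 + X%:R), X%:R]%classic else `[(- X%:R), (1 - X%:R)[%classic.
Proof.
apply/seteqP; case: b; split=> x; rewrite /unit_cell /= !in_itv /= ?mul1r ?mulN1r ?opprK.
- by rewrite ltrBrDr subr_le0.
- by rewrite ltrBrDr subr_le0.
- by rewrite -lerBlDr sub0r ltrBrDr.
- by rewrite -lerBlDr sub0r ltrBrDr.
Qed.

Lemma measurable_unit_cell b X : measurable (unit_cell b X).
Proof. by rewrite unit_cellE; case: b; exact: measurable_itv. Qed.

Lemma unit_cell_lty b X : (mu (unit_cell b X) < +oo)%E.
Proof. by rewrite unit_cellE; case: b; exact: itv_lty. Qed.

Lemma unit_start_cst b (k : R) : \int[mu]_(_ in unit_start b) k = k.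
Proof.
transitivity (k * fine (mu (unit_start b))).
  by apply: Rintegral_cst => //; exact: measurable_unit_start.
by case: b; rewrite lebesgue_measure_itv /= lte_fin ?ltrN10 ?ltr01 /= ?sub0r ?opprK ?subr0 mulr1.
Qed.

Lemma unit_cell_cover (x : R) : exists b X, unit_cell b X x.
Proof.
have [b bx] : exists b, x = sgb b * `|x|.
  have [x0|x0] := leP 0 x; first by exists true; rewrite mul1r ger0_norm.
  by exists false; rewrite mulN1r ltr0_norm// opprK.
have := truncn_itv (normr_ge0 x); rewrite -[_.+1%:R]natr1 => /andP[h1 h2].
(* For [X > 0] a cell is open on the side of 0 and closed on the other, so an integer [|x|] is
   itself the index, and any other point takes the next integer. *)
exists b; have [E|nE] := eqVneq `|x| (Num.truncn `|x|)%:R.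
  exists (Num.truncn `|x|); rewrite /unit_cell /= -E -bx.
  by rewrite subrr; case: b {bx}; rewrite /= in_itv /= ?lexx ?ltrN10 ?ltr01.
exists (Num.truncn `|x|).+1; rewrite /unit_cell /= {1}bx -[_.+1%:R]natr1 -mulrBr.
have h3 : (Num.truncn `|x|)%:R < `|x| by rewrite lt_neqAle eq_sym nE.
move: h2 h3; move: (`|x|) (_%:R) => u t h2 h3.
by case: b {bx} => /=; rewrite in_itv /= ?mul1r ?mulN1r; apply/andP; split; lra.
Qed.

Lemma cabs_Uop_integrable c g A : 0 <= c -> L2 g -> measurable A -> (mu A < +oo)%E ->
  rintegrable A (fun x => cabs (Uop c g x)).
Proof.
move=> c0 gL mA Aoo; have mg := L2_meas gL.
apply: (rintegrable_le mA _ (rintegrable_cst (2 * c * nrm2 setT g + 1) mA Aoo)).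
  by apply: measurable_cabs; exact: cmeas_Uop.
move=> x _; rewrite ger0_norm ?cabs_ge0//.
have := cabs_Uop_sqr_le x c0 gL; have := cabs_ge0 (Uop c g x).
move: (cabs _) (2 * c * _) => a d a0 ad; have := sqr_ge0 (a - 1); nra.
Qed.

(** The grid estimate is integrated over its starting point [y] in a half of ]-1, 1[. With steps of
    length [1 / M] the [M] data points stay inside ]-1, 1[, and [X * M] steps reach the cell. The
    number [M] remains free and is optimized afterwards. *)
Lemma Rintegral_Uop_cell c g G b X M : 0 <= c -> L2 g ->
  \int[mu]_(xi in `[- c, c]) cabs (g xi) <= G -> (0 < M)%N ->
  \int[mu]_(x in unit_cell b X) cabs (Uop c g x) <=
  3 ^+ (X * M) * (M%:R * \int[mu]_(x in I) cabs (Uop c g x) + (4 * pi * c / M%:R) ^+ M * G).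
Proof.
move=> c0 gL gG M0; have mg := L2_meas gL.
have mc := measurable_segment (- c) c.
have ig := L2_cintegrable mc (itv_measure_lty _ _) gL.
pose h x := cabs (Uop c g x).
have mh : measurable_fun setT h by apply: measurable_cabs; exact: cmeas_Uop.
have h0 x : 0 <= h x := cabs_ge0 _.
have mJ := measurable_unit_start b; have mK := measurable_unit_cell b X.
have mI : measurable I by exact: measurable_itv.
have Ml : M%:R != 0 :> R by rewrite pnatr_eq0 -lt0n.
have Mp : 0 < M%:R :> R by rewrite ltr0n.
have ih A : measurable A -> (mu A < +oo)%E -> rintegrable A h by exact: cabs_Uop_integrable.
pose h' (y : R) := h (y + sgb b * X%:R).
have mh' : measurable_fun setT h' := measurableT_comp mh (measurable_shift _).
have JK y : unit_start b y -> unit_cell b X (y + sgb b * X%:R).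
  by move=> Jy; rewrite /unit_cell /= addrK.
have [iJ _] := Rintegral_shift_le mJ mK mh h0 (ih _ mK (unit_cell_lty b X)) JK.
rewrite -/h' in iJ.
have h1 : \int[mu]_(x in unit_cell b X) h x <= \int[mu]_(y in unit_start b) h' y.
  have [_] := Rintegral_shift_le (a := - (sgb b * X%:R)) mK mJ mh' (fun x => h0 _) iJ (fun y Ky => Ky).
  by rewrite /h'; under eq_Rintegral do rewrite subrK.
pose s : R := sgb b / M%:R.
have sM : `|s| = M%:R^-1.
  by rewrite normrM normfV (ger0_norm (ltW Mp)) norm_sgb mul1r.
have shI (j : 'I_M) y : unit_start b y -> I (y + j%:R * s).
  rewrite /s mulrCA; apply: unit_start_shift.
  by rewrite divr_ge0//= ltr_pdivrMr// mul1r ltr_nat.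
have H (j : 'I_M) := Rintegral_shift_le mJ mI mh h0 (ih _ mI (itv_lty _ _ _ _)) (@shI j).
have h2 y : h' y <= 3 ^+ (X * M) * (\sum_(j < M) h (y + j%:R * s) + (4 * pi * c / M%:R) ^+ M * G).
  have := cabs_Uop_grid s M mg ig gG (X * M) y c0; rewrite sM.
  have -> : (X * M)%:R * s = sgb b * X%:R.
    by rewrite natrM /s; move: M%:R Ml (sgb b) X%:R => p p0 u v; field.
  by [].
apply: le_trans h1 _.
have iS : rintegrable (unit_start b) (fun y => \sum_(j < M) h (y + j%:R * s)).
  exact: (@rintegrable_sum _ M (fun j y => h (y + j%:R * s)) mJ (fun j => (H j).1)).
have iC : rintegrable (unit_start b) (fun=> (4 * pi * c / M%:R) ^+ M * G).
  exact: rintegrable_cst mJ (unit_start_lty b).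
have iSC := rintegrableD mJ iS iC.
apply: le_trans (ler_Rintegral mJ iJ (rintegrableZl (3 ^+ (X * M)) mJ iSC) (fun y _ => h2 y)) _.
rewrite (@RintegralZl _ _ _ mu _ _ _ mJ iSC) (@RintegralD _ _ _ mu _ _ _ mJ iS iC) unit_start_cst.
apply: ler_wpM2l; first exact: exprn_ge0.
rewrite lerD2r (@Rintegral_sum _ M (fun j y => h (y + j%:R * s)) mJ (fun j => (H j).1)).
apply: le_trans (ler_sum _ (fun j _ => (H j).2)) _.
by rewrite sumr_const card_ord mulr_natl.
Qed.

End ExtrapolationL1.

(** * Choice of the number of grid points *)

Section GrowthBounds.
Context {R : realType}.
Implicit Types (A B C L eta : R) (X q M n : nat).

Lemma pow_div_bounded B : 0 <= B -> exists2 C, 0 <= C & forall M, (0 < M)%N -> (B / M%:R) ^+ M <= C.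
Proof.
move=> B0; have B1 : 1 <= 1 + B by rewrite lerDl.
have B10 : 0 <= 1 + B by rewrite addr_ge0.
exists ((1 + B) ^+ (Num.truncn B).+1) => [|M M0]; first by rewrite exprn_ge0.
have Mp : 0 < M%:R :> R by rewrite ltr0n.
have BM : 0 <= B / M%:R by rewrite divr_ge0.
have [NM|MN] := leqP (Num.truncn B).+1 M.
  apply: (@le_trans _ _ 1); last by rewrite exprn_ege1.
  rewrite exprn_ile1// ler_pdivrMr// mul1r; apply: ltW.
  by apply: (lt_le_trans (truncnS_gt B)); rewrite ler_nat.
apply: (@le_trans _ _ ((1 + B) ^+ M)).
  rewrite lerXn2r ?nnegrE ?B10// ler_pdivrMr//.
  apply: (@le_trans _ _ (1 + B)); first by rewrite lerDr.
  by rewrite ler_peMr ?B10// ler1n.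
by rewrite ler_weXn2l// ltnW.
Qed.

Lemma pow_fact_bounded B : 0 <= B -> exists2 C, 0 <= C & forall n, B ^+ n / n`!%:R <= C.
Proof.
move=> B0; have B1 : 1 <= 1 + B by rewrite lerDl.
have B10 : 0 <= 1 + B by rewrite addr_ge0.
exists ((1 + B) ^+ (Num.truncn B)) => [|n]; first by rewrite exprn_ge0.
have fp k : 0 < k`!%:R :> R by rewrite ltr0n fact_gt0.
have small k : (k <= Num.truncn B)%N -> B ^+ k / k`!%:R <= (1 + B) ^+ (Num.truncn B).
  move=> kN; rewrite ler_pdivrMr//; apply: (@le_trans _ _ ((1 + B) ^+ (Num.truncn B))).
    apply: (@le_trans _ _ ((1 + B) ^+ k)); last by rewrite ler_weXn2l.
    by rewrite lerXn2r ?nnegrE ?B10// lerDr.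
  by rewrite ler_peMr ?exprn_ge0// ler1n fact_gt0.
elim: n => [|n IH]; first exact: small.
have [nN|Nn] := leqP n.+1 (Num.truncn B); first exact: small.
apply: le_trans IH; rewrite exprS factS natrM invfM mulrACA ler_piMl//.
  by rewrite divr_ge0 ?exprn_ge0// ltW.
rewrite ler_pdivrMr ?ltr0n// mul1r; apply: ltW; apply: lt_le_trans (truncnS_gt B) _.
by rewrite ler_nat.
Qed.

Lemma exists_pow L eta : 2 <= L -> 0 < eta -> eta <= 1 ->
  exists2 M, (0 < M)%N & L ^+ M * eta <= L /\ 1 <= L ^+ M * eta.
Proof.
move=> L2 e0 e1; have L0 : 0 < L by lra.
have ex : exists n, 1 <= L ^+ n * eta.
  exists (Num.truncn eta^-1).+1; rewrite -ler_pdivrMr// mul1r.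
  apply: ltW; apply: lt_trans (truncnS_gt _) _.
  apply: (@lt_le_trans _ _ (2 ^+ (Num.truncn eta^-1).+1)); first by rewrite -natrX ltr_nat ltn_expl.
  by rewrite lerXn2r ?nnegrE// ltW.
have [[|m] h hmin] := ex_minnP ex.
  (* A minimal exponent 0 means [eta = 1]; the exponent 1 is taken instead, as [M] must be
     positive. *)
  exists 1%N => //; rewrite expr1; split; first by rewrite ler_piMr// ltW.
  by move: h; rewrite expr0 mul1r => h; have := L2; nra.
exists m.+1 => //; split=> //; rewrite exprS -mulrA ler_piMr ?(ltW L0)//.
by rewrite leNgt; apply/negP => /ltW /hmin; rewrite ltnn.
Qed.

(** [M] is about the logarithm of [1 / eta] in base [L = 2 * 3 ^+ X]. Since [M <= 2 ^+ M], the
    growth [3 ^+ (X * M) * M] is at most [L ^+ M] and costs a single factor [eta]. The term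
    [(A / M) ^+ M] beats every geometric sequence, so it absorbs [3 ^+ (X * M)] and [L ^+ (q * M)],
    and the inverse of the latter is at most [eta ^+ q]. *)
Lemma optimal_order A X q : 0 <= A -> exists2 C, 0 <= C &
  forall eta, 0 < eta -> eta <= 1 -> exists2 M, (0 < M)%N &
    3 ^+ (X * M) * (M%:R * eta ^+ q.+1) <= C * eta ^+ q /\
    3 ^+ (X * M) * (A / M%:R) ^+ M <= C * eta ^+ q.
Proof.
move=> A0; pose K : R := 3 ^+ X; pose L := 2 * K.
have K1 : 1 <= K by rewrite exprn_ege1// ler1n.
have K0 : 0 <= K by lra.
have L2 : 2 <= L by rewrite /L; lra.
have [|CB CB0 HB] := @pow_div_bounded (K * A * L ^+ q).
  by rewrite !mulr_ge0// exprn_ge0//; lra.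
exists (L + CB) => [|eta e0 e1]; first by lra.
have eq0 : 0 <= eta ^+ q by rewrite exprn_ge0// ltW.
have [M M0 [hM1 hM2]] := exists_pow L2 e0 e1; exists M => //.
have XM : 3 ^+ (X * M) = K ^+ M by rewrite exprM.
rewrite XM; split.
  apply: (@le_trans _ _ (L * eta ^+ q)); last by rewrite ler_wpM2r// lerDl.
  rewrite exprS mulrA mulrA ler_wpM2r//; apply: le_trans hM1; rewrite ler_wpM2r ?(ltW e0)//.
  rewrite /L exprMn mulrC ler_wpM2r ?exprn_ge0//.
  by rewrite -natrX ler_nat ltnW// ltn_expl.
apply: (@le_trans _ _ (CB * eta ^+ q)); last by rewrite ler_wpM2r// lerDr; lra.
have Lq : 0 < L ^+ q by rewrite exprn_gt0//; lra.
have LM : 0 < (L ^+ q) ^+ M by rewrite exprn_gt0.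
have E : K ^+ M * (A / M%:R) ^+ M = (K * A * L ^+ q / M%:R) ^+ M * ((L ^+ q) ^+ M)^-1.
  by rewrite -exprMn -exprVn -exprMn; congr (_ ^+ _); rewrite mulrAC mulrA mulfK ?gt_eqF// mulrA.
rewrite E; apply: ler_pM; last 2 first.
- exact: HB.
- rewrite -[leLHS]mul1r ler_pdivrMr// -exprM mulnC exprM -exprMn exprn_ege1// mulrC.
  by [].
- by rewrite exprn_ge0// divr_ge0// !mulr_ge0// ltW.
- by rewrite invr_ge0 ltW.
Qed.

End GrowthBounds.

Section ExtrapolationBound.
Context {R : realType}.
Local Notation mu := (@lebesgue_measure R).

(** Extrapolation loses one power of [eta] out of [q + 1], an arbitrarily small proportion for large
    [q]. The constant depends on the cell but not on [g] or [eta], so one constant serves all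
    [psi n]. *)
Lemma Rintegral_Uop_cell_pow (c G K : R) (b : bool) (X q : nat) : 0 <= c -> 0 <= G -> 0 <= K ->
  exists2 C : R, 0 <= C & forall (g : R -> R[i]) (eta : R), L2 g ->
    \int[mu]_(xi in `[- c, c]) cabs (g xi) <= G -> 0 < eta -> eta <= 1 ->
    \int[mu]_(x in `]-1, 1[) cabs (Uop c g x) <= K * eta ^+ q.+1 ->
    \int[mu]_(x in unit_cell b X) cabs (Uop c g x) <= C * eta ^+ q.
Proof.
move=> c0 G0 K0; have A0 : 0 <= 4 * pi * c by rewrite !mulr_ge0// pi_ge0.
have [C C0 H] := optimal_order X q A0.
exists (C * (K + G)) => [|g eta gL gG e0 e1 small]; first by rewrite mulr_ge0// addr_ge0.
have [M M0 [h1 h2]] := H eta e0 e1.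
apply: le_trans (Rintegral_Uop_cell b X c0 gL gG M0) _.
apply: (@le_trans _ _ (3 ^+ (X * M) * (M%:R * (K * eta ^+ q.+1) + (4 * pi * c / M%:R) ^+ M * G))).
  by rewrite ler_wpM2l ?exprn_ge0// lerD2r ler_wpM2l.
move: h1 h2; move: (3 ^+ _) (M%:R) (eta ^+ q.+1) (eta ^+ q) ((_ / _) ^+ M) => k m u v w h1 h2.
have -> : k * (m * (K * u) + w * G) = K * (k * (m * u)) + k * w * G by ring.
have -> : C * (K + G) * v = K * (C * v) + C * v * G by ring.
by apply: lerD; [rewrite ler_wpM2l|rewrite ler_wpM2r].
Qed.

End ExtrapolationBound.
(** * Spectral properties of the prolate functions *)

Section Spectral.
Context {R : realType}.
Local Notation mu := (@lebesgue_measure R).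
Local Notation I := (`]-1, 1[%classic : set R).
Implicit Types (f g h : R -> R[i]).

Lemma measurable_I : measurable I. Proof. exact: measurable_itv. Qed.

Lemma Rintegral_I_cst (k : R) : \int[mu]_(_ in I) k = 2 * k.
Proof.
transitivity (k * fine (mu I)); first by apply: Rintegral_cst => //; exact: measurable_I.
have h : -1 < 1 :> R by lra.
by rewrite lebesgue_measure_itv /= lte_fin h /= opprK mulrC.
Qed.

Lemma Rintegral_cabs_I_sqr f : L2 f -> (\int[mu]_(x in I) cabs (f x)) ^+ 2 <= 2 * nrm2 I f.
Proof.
move=> fL; have Ioo : (mu I < +oo)%E := itv_lty _ _ _ _.
have [] := @CauchySchwarz_real R I (fun=> 1) (fun x => cabs (f x)) measurable_I.
- exact: measurable_cst.
- by apply: measurable_cabs; exact: L2_meas.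
- by move=> x.
- by move=> x; exact: cabs_ge0.
- exact: rintegrable_cst measurable_I Ioo.
- exact: L2_sqr measurable_I fL.
move=> _; rewrite expr1n Rintegral_I_cst mulr1.
by under eq_Rintegral do rewrite mul1r.
Qed.

Lemma nrm2_orth_sum A (m : nat) (a : 'I_m -> R[i]) (F : 'I_m -> R -> R[i]) : measurable A ->
  (forall i, L2 (F i)) -> (forall i j, i != j -> ip A (F i) (F j) = 0) ->
  nrm2 A (fun x => \sum_(i < m) a i * F i x) = \sum_(i < m) cabs (a i) ^+ 2 * nrm2 A (F i).
Proof.
move=> mA FL orth; have aL i : L2 (fun x => a i * F i x) by exact: L2Z.
have sL : L2 (fun x => \sum_(i < m) a i * F i x) by exact: L2_sum.
have E i : ip A (fun x => a i * F i x) (fun x => \sum_(j < m) a j * F j x) =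
    (cabs (a i) ^+ 2 * nrm2 A (F i))%:C.
  rewrite (ipZl _ mA (FL i) sL) (ipC mA sL (FL i)) (ip_suml _ mA aL (FL i)).
  rewrite (bigD1 i)//= big1 ?addr0; last first.
    by move=> j ji; rewrite (ipZl _ mA (FL j) (FL i)) orth// mulr0.
  rewrite (ipZl _ mA (FL i) (FL i)) ip_self conjcM conjc_real mulrA mulc_conj.
  by rewrite -rmorphM.
rewrite nrm2E (ip_suml _ mA aL sL) (eq_bigr _ (fun i _ => E i)).
by rewrite -rmorph_sum Re_real.
Qed.

(** For a step [s] with [s * M <= 1] the second-order term is at most half the first-order one. *)
Lemma le0_of_quad_bound (A s M : R) : 0 < s -> s * M <= 1 -> 0 <= A ->
  2 * (s * A) <= s ^+ 2 * A * M -> A <= 0.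
Proof.
move=> s0 sM A0; have -> : s ^+ 2 * A * M = s * A * (s * M) by ring.
have h1 : s * A * (s * M) <= s * A by rewrite ler_piMr// mulr_ge0// ltW.
by move=> H2; rewrite -(pmulr_rle0 _ s0); lra.
Qed.

Variables (c : R) (psi gam : nat -> R -> R[i]).
Hypotheses (c0 : 0 < c) (HP : PSWF c psi) (rep : forall n, PWrep c (psi n) (gam n)).

Lemma psiL n : L2 (psi n). Proof. by case: (rep n). Qed.
Lemma gamL n : L2 (gam n). Proof. by case: (rep n). Qed.
Lemma psi_Uop n : {ae mu, forall x, psi n x = Uop c (gam n) x}. Proof. by case: (rep n). Qed.

Definition lam n := nrm2 I (psi n).

Lemma lam_ge0 n : 0 <= lam n. Proof. exact: nrm2_ge0. Qed.

Lemma nrm2_psi n : nrm2 setT (psi n) = 1.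
Proof.
have [_ + _ _] := HP n; rewrite (l2normE measurableT (psiL n)) => h.
by rewrite -(sqr_sqrtr (nrm2_ge0 _ _)) h expr1n.
Qed.

Lemma psi_orth i j : i != j -> ip setT (psi i) (psi j) = 0.
Proof.
have H k n : (k < n)%N -> ip setT (psi n) (psi k) = 0 by have [_ _ + _] := HP n; apply.
rewrite neq_ltn => /orP[ij|ji]; last exact: H.
by rewrite (ipC measurableT (psiL j) (psiL i)) H// conjc0.
Qed.

Lemma nrm2_I_le n f g : PWrep c f g -> (forall k, (k < n)%N -> ip setT f (psi k) = 0) ->
  nrm2 I f <= lam n * nrm2 setT f.
Proof.
move=> r fo; have [fL _ _ _ _] := r; have [_ _ _ /(_ f (PWrep_PW2 r) fo)] := HP n.
rewrite !(l2normE measurableT) ?(l2normE measurable_I)//; try exact: psiL.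
rewrite nrm2_psi sqrtr1 divr1 -/(lam n) => H.
(* Maximality says nothing about a function of norm 0, for which both sides vanish. *)
have [f0|f0] := eqVneq (nrm2 setT f) 0.
  by rewrite f0 mulr0 -f0; apply: nrm2S => //; exact: measurable_I.
have fp : 0 < nrm2 setT f by rewrite lt_neqAle eq_sym f0 nrm2_ge0.
have sp : 0 < Num.sqrt (nrm2 setT f) by rewrite sqrtr_gt0.
have := H (lt0r_neq0 sp); rewrite ler_pdivrMr// -sqrtrM ?lam_ge0//.
by rewrite ler_sqrt// mulr_ge0 ?lam_ge0// ltW.
Qed.

(* First variation of the maximum at [psi n] in the direction [h]. *)
Lemma ip_I_eq0 n h g : PWrep c h g -> (forall k, (k <= n)%N -> ip setT h (psi k) = 0) ->
  ip I h (psi n) = 0.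
Proof.
move=> r ho; have [hL _ _ _ _] := r; have pL := psiL n; have mI := measurable_I.
pose a := ip I h (psi n); pose N := lam n * nrm2 setT h.
have N0 : 0 <= N by rewrite mulr_ge0 ?lam_ge0 ?nrm2_ge0.
(* The perturbation is [z * h]: the phase [conjc a] makes the first-order gain [2 t |a|^2], and
   [t * N <= 1] keeps the second-order loss below it. *)
pose t : R := (N + 1)^-1; have t0 : 0 < t by rewrite invr_gt0; lra.
pose z : R[i] := t%:C * conjc a; have zhL := L2Z z hL.
have o1 k : (k < n)%N -> ip setT (fun x => psi n x + z * h x) (psi k) = 0.
  move=> kn; rewrite (ipDl measurableT pL zhL (psiL k)) (ipZl _ measurableT hL (psiL k)).
  by rewrite ho ?(ltnW kn)// mulr0 addr0 psi_orth// gtn_eqF.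
have := nrm2_I_le (PWrepD (rep n) (PWrepZ z r)) o1.
rewrite (nrm2D mI pL zhL) (nrm2D measurableT pL zhL) (ipZr _ mI pL hL) (ipZr _ measurableT pL hL).
have E0 : 2 * complex.Re (conjc z * ip setT (psi n) h) = 0.
  by rewrite (ipC measurableT hL pL) (ho n (leqnn n)) conjc0 mulr0 mulr0.
rewrite E0 addr0.
rewrite (ipC mI hL pL) -/a (nrm2Z _ mI hL) (nrm2Z _ measurableT hL) nrm2_psi -/(lam n).
rewrite /z conjcM conjcK conjc_real -mulrA mulc_conj -rmorphM Re_real cabsM cabs_conj.
rewrite cabs_real exprMn sqr_normE => H.
suff A0 : cabs a ^+ 2 = 0.
  by apply: cabs_eq0; apply/eqP; rewrite -sqrf_eq0 A0.
have H2 : 2 * (t * cabs a ^+ 2) <= t ^+ 2 * cabs a ^+ 2 * N.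
  have P0 : 0 <= t ^+ 2 * cabs a ^+ 2 * nrm2 I h.
    exact: mulr_ge0 (mulr_ge0 (sqr_ge0 t) (sqr_ge0 _)) (nrm2_ge0 _ _).
  have E : lam n * (1 + t ^+ 2 * cabs a ^+ 2 * nrm2 setT h) = lam n + t ^+ 2 * cabs a ^+ 2 * N.
    by rewrite /N; ring.
  by rewrite -(lerD2l (lam n)) -E; apply: le_trans H; rewrite lerDl.
have tN : t * N <= 1 by rewrite /t mulrC ler_pdivrMr; lra.
apply/le_anti; rewrite sqr_ge0 andbT.
exact: (le0_of_quad_bound t0 tN (sqr_ge0 _) H2).
Qed.

Lemma psi_orth_I i j : i != j -> ip I (psi i) (psi j) = 0.
Proof.
have H k n : (k < n)%N -> ip I (psi n) (psi k) = 0.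
  move=> kn; apply: (ip_I_eq0 (rep n)) => l lk; apply: psi_orth.
  by rewrite gtn_eqF// (leq_ltn_trans lk kn).
rewrite neq_ltn => /orP[ij|ji]; last exact: H.
by rewrite (ipC measurable_I (psiL j) (psiL i)) H// conjc0.
Qed.

Lemma lam_decr k n : (k <= n)%N -> lam n <= lam k.
Proof.
move=> kn; have := nrm2_I_le (n := k) (rep n); rewrite nrm2_psi mulr1; apply.
by move=> l lk; rewrite psi_orth// gtn_eqF// (leq_trans lk kn).
Qed.

(** The minus sign sits on the coefficients so that the linearity lemmas for [PWrep] and [ip] apply
    as they stand. *)
Definition remainder n h x := h x + \sum_(k < n) - ip setT h (psi k) * psi k x.
Definition remainder_hat n h g xi := g xi + \sum_(k < n) - ip setT h (psi k) * gam k xi.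

Lemma PWrep_remainder n h g : PWrep c h g -> PWrep c (remainder n h) (remainder_hat n h g).
Proof.
move=> r; apply: PWrepD r _.
exact: (@PWrep_sum R c 'I_n (index_enum _) (fun k x => - ip setT h (psi k) * psi k x)
  (fun k x => - ip setT h (psi k) * gam k x) (fun k => PWrepZ (- ip setT h (psi k)) (rep k))).
Qed.

Lemma ip_remainder A n h f : measurable A -> L2 h -> L2 f ->
  ip A (remainder n h) f = ip A h f + \sum_(k < n) - ip setT h (psi k) * ip A (psi k) f.
Proof.
move=> mA hL fL; have sL (k : 'I_n) : L2 (fun x => - ip setT h (psi k) * psi k x) := L2Z _ (psiL k).
rewrite (ipDl mA hL (L2_sum _ sL) fL) (ip_suml _ mA sL fL); congr (_ + _).
by apply: eq_bigr => k _; rewrite (ipZl _ mA (psiL k) fL).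
Qed.

Lemma remainder_orth n k h : L2 h -> (k < n)%N -> ip setT (remainder n h) (psi k) = 0.
Proof.
move=> hL kn; rewrite (ip_remainder _ measurableT hL (psiL k)) (bigD1 (Ordinal kn))//= big1.
  by rewrite addr0 ip_self nrm2_psi mulr1 subrr.
by move=> j jk; rewrite psi_orth// mulr0.
Qed.

(** [remainder n.+1 h] is orthogonal to [psi 0, ..., psi n] on the line, so [ip_I_eq0] applies to
    it; orthogonality on ]-1, 1[ leaves only the term of [psi n]. With [h = sinc_at c t] this is the
    eigenvalue equation of the sinc kernel. *)
Lemma ip_I_psi n h g : PWrep c h g -> ip I h (psi n) = (lam n)%:C * ip setT h (psi n).
Proof.
move=> r; have [hL _ _ _ _] := r.
have := ip_I_eq0 (PWrep_remainder n.+1 r) (fun k => @remainder_orth n.+1 k h hL).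
rewrite (ip_remainder _ measurable_I hL (psiL n)) big_ord_recr /= big1.
  by rewrite add0r ip_self -/(lam n) mulNr => /eqP; rewrite subr_eq0 mulrC => /eqP.
by move=> k _; rewrite psi_orth_I ?mulr0// ltn_eqF.
Qed.

Lemma nrm2_remainder_le n h : L2 h -> nrm2 setT (remainder n h) <= nrm2 setT h.
Proof.
move=> hL; have sL (k : 'I_n) : L2 (fun x => - ip setT h (psi k) * psi k x) := L2Z _ (psiL k).
have rL : L2 (remainder n h) by apply: L2D hL _; exact: (L2_sum _ sL).
have E : ip setT h (remainder n h) = (nrm2 setT (remainder n h))%:C.
  rewrite -ip_self (ip_remainder _ measurableT hL rL) big1 ?addr0// => k _.
  by rewrite (ipC measurableT rL (psiL k)) (remainder_orth hL)// conjc0 mulr0.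
have := nrm2_ge0 setT (fun x => h x - remainder n h x).
by rewrite (nrm2B measurableT hL rL) E Re_real; lra.
Qed.

(** * Superexponential decay of [lam] *)

Lemma cintegrable_mul_bounded (g m : R -> R[i]) (B : R) : L2 g -> cmeas m ->
  (forall xi, `[- c, c]%classic xi -> cabs (m xi) <= B) ->
  cintegrable `[- c, c] (fun xi => g xi * m xi).
Proof.
move=> gL mm mB; have mc := measurable_segment (- c) c.
have mg := L2_meas gL.
have icg := cintegrable_cabs mc mg (L2_cintegrable mc (itv_measure_lty _ _) gL).
apply: (cintegrable_le mc (cmeasM mg mm) (rintegrableZl B mc icg)) => xi xc.
by rewrite cabsM mulrC ler_wpM2r ?cabs_ge0// mB.
Qed.

Lemma cmeas_pow j : cmeas (fun xi : R => (xi ^+ j)%:C).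
Proof. by apply: cmeas_real; exact: exprn_measurable. Qed.

Lemma cabs_pow_le j (xi : R) : `[- c, c]%classic xi -> cabs (xi ^+ j)%:C <= c ^+ j.
Proof.
move=> /itvP_norm xc; rewrite cabs_real normrX lerXn2r ?nnegrE//.
exact: le_trans xc.
Qed.

(** [n + 1] coefficients meet [n] linear conditions, so the moment matrix has a nonzero left
    kernel. *)
Lemma exists_vanishing_moments n : exists a : 'I_n.+1 -> R[i],
  (exists k, a k != 0) /\ forall j : 'I_n,
    cint `[- c, c] (fun xi => (\sum_(k < n.+1) a k * gam k xi) * (xi ^+ j)%:C) = 0.
Proof.
have mc := measurable_segment (- c) c.
pose M : 'M[R[i]]_(n.+1, n) :=
  \matrix_(k, j) cint `[- c, c] (fun xi => gam k xi * (xi ^+ j)%:C).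
have : kermx M != 0.
  rewrite kermx_eq0 /row_free; apply/eqP => rM.
  by have := rank_leq_col M; rewrite rM ltnn.
move=> /rowV0Pn[u /sub_kermxP uM u0]; exists (u 0); split.
  move: u0 => /eqP/matrixP u0; apply/existsP; apply: contra_notT u0.
  rewrite negb_exists => /forallP u0 i j; rewrite (ord1 i) mxE; apply/eqP.
  by have := u0 j; rewrite negbK.
move=> j; have E : \sum_k u 0 k * M k j = 0.
  by have := congr1 (fun A : 'rV_n => A 0 j) uM; rewrite !mxE.
rewrite -[RHS]E.
have ik (k : 'I_n.+1) : cintegrable `[- c, c] (fun xi => gam k xi * (xi ^+ j)%:C).
  exact: cintegrable_mul_bounded (gamL k) (cmeas_pow j) (@cabs_pow_le j).
have iz (k : 'I_n.+1) : cintegrable `[- c, c] (fun xi => u 0 k * (gam k xi * (xi ^+ j)%:C)).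
  exact: cintegrableZl mc (ik k).
transitivity (cint `[- c, c] (fun xi => \sum_(k < n.+1) u 0 k * (gam k xi * (xi ^+ j)%:C))).
  by apply: eq_cint => xi _; rewrite mulr_suml; apply: eq_bigr => k _; rewrite mulrA.
rewrite (cint_sum _ mc iz); apply: eq_bigr => k _.
by rewrite (cintZl _ mc (ik k)) mxE.
Qed.

(** A polynomial of degree below [n] in [xi] may be subtracted from the exponential without changing
    the integral; what remains is the Taylor error, with argument at most [2 pi c] for [|t| <= 1] on
    the band. *)
Lemma cabs_Uop_vanishing_moments n (g : R -> R[i]) (t : R) : L2 g ->
  (forall j : 'I_n, cint `[- c, c] (fun xi => g xi * (xi ^+ j)%:C) = 0) -> `|t| <= 1 ->
  cabs (Uop c g t) <= 2 * ((2 * pi * c) ^+ n / n`!%:R) * \int[mu]_(xi in `[- c, c]) cabs (g xi).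
Proof.
move=> gL g0 t1; have mc := measurable_segment (- c) c.
have mg := L2_meas gL; have igL := L2_cintegrable mc (itv_measure_lty _ _) gL.
have icg := cintegrable_cabs mc mg igL.
have [z Hz] := @cexpi_approx R n.
have ij (j : 'I_n) : cintegrable `[- c, c] (fun xi => g xi * (xi ^+ j)%:C).
  exact: cintegrable_mul_bounded gL (cmeas_pow j) (@cabs_pow_le j).
pose w (j : 'I_n) := z j * ((2 * pi * t) ^+ j)%:C.
have iw (j : 'I_n) : cintegrable `[- c, c] (fun xi => w j * (g xi * (xi ^+ j)%:C)).
  exact: cintegrableZl mc (ij j).
have iS := cintegrable_sum (index_enum _) mc iw.
have S0 : cint `[- c, c] (fun xi => \sum_(j < n) w j * (g xi * (xi ^+ j)%:C)) = 0.
  by rewrite (cint_sum _ mc iw) big1// => j _; rewrite (cintZl _ mc (ij j)) g0 mulr0.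
have ie := cintegrable_mul_cexpi (2 * pi * t) mc mg igL.
rewrite /Uop -[cint _ _]subr0 -S0 -(cintB mc ie iS).
pose B : R := 2 * ((2 * pi * c) ^+ n / n`!%:R).
rewrite -/B -(@RintegralZl _ _ _ mu _ _ _ mc icg).
apply: ler_cabs_cint_bound => //.
- apply: cmeasB; first exact: cmeas_mul_cexpi.
  by apply: cmeas_sum => j; apply: cmeasM; [exact: cmeas_cst|apply: cmeasM => //; exact: cmeas_pow].
- exact: rintegrableZl.
- move=> xi /itvP_norm xc.
  have -> : g xi * cexpi (2 * pi * t * xi) - \sum_(j < n) w j * (g xi * (xi ^+ j)%:C) =
      (cexpi (2 * pi * t * xi) - \sum_(j < n) z j * ((2 * pi * t * xi) ^+ j)%:C) * g xi.
    rewrite mulrBl [cexpi _ * _]mulrC mulr_suml; congr (_ - _); apply: eq_bigr => j _.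
    by rewrite [(_ * xi) ^+ j]exprMn rmorphM /w -!mulrA [g xi * _]mulrC.
  rewrite cabsM ler_wpM2r ?cabs_ge0//; apply: le_trans (Hz _) _.
  rewrite /B ler_wpM2l// ler_wpM2r ?invr_ge0//.
  have h : `|2 * pi * t * xi| <= 2 * pi * c.
    rewrite !normrM (ger0_norm (pi_ge0 R)) ger0_norm// -!mulrA ler_wpM2l// ler_wpM2l ?pi_ge0//.
    by rewrite -[leRHS]mul1r ler_pM.
  by rewrite lerXn2r ?nnegrE// (le_trans _ h).
Qed.

(* A normalized combination of psi 0, ..., psi n has at least the energy [lam n] on ]-1, 1[,
   and one of them has a transform with n vanishing moments. *)
Lemma lam_le n : lam n <= 16 * c * ((2 * pi * c) ^+ n / n`!%:R) ^+ 2.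
Proof.
have [a [[k0 ak0] mom]] := exists_vanishing_moments n.
pose hf x := \sum_(k < n.+1) a k * psi k x; pose hg xi := \sum_(k < n.+1) a k * gam k xi.
have r : PWrep c hf hg.
  exact: (@PWrep_sum R c 'I_n.+1 (index_enum _) (fun k x => a k * psi k x)
    (fun k x => a k * gam k x) (fun k => PWrepZ (a k) (rep k))).
have [hfL hgL _ hU _] := r.
pose S := \sum_(k < n.+1) cabs (a k) ^+ 2.
have ES : nrm2 setT hf = S.
  rewrite /hf (nrm2_orth_sum (F := fun k : 'I_n.+1 => psi k) a measurableT (fun k => psiL k)).
    by apply: eq_bigr => k _; rewrite nrm2_psi mulr1.
  by move=> i j ij; exact: psi_orth.
have S0 : 0 < S.
  rewrite /S (bigD1 k0)//= ltr_pwDl//; last by apply: sumr_ge0 => k _; exact: sqr_ge0.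
  rewrite lt_neqAle sqr_ge0 andbT eq_sym sqrf_eq0; apply: contra_neq ak0 => ?; exact: cabs_eq0.
have EI : nrm2 I hf = \sum_(k < n.+1) cabs (a k) ^+ 2 * lam k.
  rewrite /hf (nrm2_orth_sum (F := fun k : 'I_n.+1 => psi k) a measurable_I (fun k => psiL k))//.
  by move=> i j ij; exact: psi_orth_I.
have low : lam n * S <= nrm2 I hf.
  rewrite EI /S mulr_sumr ler_sum// => k _; rewrite mulrC ler_wpM2l ?sqr_ge0//.
  by apply: lam_decr; rewrite -ltnS.
pose G := \int[mu]_(xi in `[- c, c]) cabs (hg xi).
have G2 : G ^+ 2 <= 2 * c * S.
  by rewrite -ES (PWrep_nrm2 r); exact: Rintegral_cabs_band_sqr (ltW c0) hgL.
pose B : R := 2 * ((2 * pi * c) ^+ n / n`!%:R).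
have up : nrm2 I hf <= 2 * (B * G) ^+ 2.
  have mU := cmeas_Uop c (L2_meas hgL).
  have -> : nrm2 I hf = nrm2 I (Uop c hg).
    by apply: eq_ae_nrm2 (measurable_I) (L2_meas hfL) mU _; apply: filterS hU => x ->.
  rewrite -Rintegral_I_cst /nrm2; apply: ler_Rintegral; first exact: measurable_I.
  - apply: (rintegrable_le measurable_I (measurable_cabs2 mU)
      (rintegrable_cst (2 * c * nrm2 setT hg) measurable_I (itv_lty _ _ _ _))) => x _.
    by rewrite ger0_norm ?sqr_ge0// cabs_Uop_sqr_le// ltW.
  - exact: rintegrable_cst measurable_I (itv_lty _ _ _ _).
  - move=> x; rewrite /= in_itv /= => /andP[x0 x1].
    rewrite lerXn2r ?nnegrE ?cabs_ge0//.
      rewrite mulr_ge0//; last by apply: Rintegral_ge0 => y _; exact: cabs_ge0.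
      by rewrite /B mulr_ge0// divr_ge0// exprn_ge0// !mulr_ge0 ?pi_ge0// ltW.
    apply: cabs_Uop_vanishing_moments => //.
    by rewrite ler_norml !ltW.
(* The constant [16 c] is [2 * 2 ^+ 2 * (2 * c)]: the length of ]-1, 1[, the square of the factor 2
   in the Taylor error, and the length of the band. *)
rewrite -(ler_pM2r S0); apply: le_trans low (le_trans up _).
rewrite /B; move: (_ / _) => t.
have -> : 2 * (2 * t * G) ^+ 2 = 8 * t ^+ 2 * G ^+ 2 by ring.
have -> : 16 * c * t ^+ 2 * S = 8 * t ^+ 2 * (2 * c * S) by ring.
by rewrite ler_wpM2l// mulr_ge0// sqr_ge0.
Qed.

(** * Decay of the prolate functions and positivity of [lam] *)

Lemma norm_sinc_far (s t : R) : 2 <= `|t| -> -1 < s < 1 -> `|sinc_kernel c (s - t)| <= `|t|^-1.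
Proof.
move=> t2 /andP[s0 s1]; have h : `|t| <= 2 * `|s - t|.
  have := ler_normB s (s - t); rewrite opprB addrCA subrr addr0.
  have : `|s| <= 1 by rewrite ler_norml !ltW.
  by move: (`|t|) (`|s|) (`|s - t|) t2 => x y z; lra.
have tp : 0 < `|t| by lra.
have st : 0 < `|s - t| by move: (`|t|) (`|s - t|) tp h => x y; lra.
rewrite /sinc_kernel; case: eqP => [E|_]; first by rewrite E normr0 ltxx in st.
rewrite normrM normfV normrM (ger0_norm (pi_ge0 R)).
have pp : 0 < pi * `|s - t| by rewrite mulr_gt0 ?pi_gt0.
rewrite ler_pdivrMr//; apply: le_trans (norm_sin_le1 _) _.
rewrite mulrC ler_pdivlMr// mul1r; apply: le_trans h _.
by rewrite ler_wpM2r// pi_ge2.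
Qed.

(** The eigenvalue equation tested with [sinc_at c t], then Cauchy-Schwarz on ]-1, 1[, where that
    kernel is at most [1 / |t|]. One of the two factors [lam n] cancels against the energy of
    [psi n]. Stated without division, since positivity of [lam n] comes only later. *)
Lemma cabs_Uop_psi_far n (t : R) : 2 <= `|t| ->
  lam n * (cabs (Uop c (gam n) t) ^+ 2 * t ^+ 2) <= 2.
Proof.
move=> t2; have tp : 0 < `|t| by lra.
have t2p : 0 < t ^+ 2 by rewrite -sqr_normE exprn_gt0.
have rk := PWrep_sinc_at t c0; have [kL _ _ _ _] := rk.
have E := ip_I_psi n rk.
rewrite (ipC measurableT (psiL n) kL) (PWrep_ip_sinc_at t c0 (rep n)) in E.
have CS := CauchySchwarz measurable_I kL (psiL n); rewrite -/(lam n) in CS.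
rewrite E cabsM cabs_real cabs_conj ger0_norm ?lam_ge0// in CS.
have kI : nrm2 I (sinc_at c t) <= 2 * (t ^+ 2)^-1.
  rewrite -Rintegral_I_cst; apply: ler_Rintegral; first exact: measurable_I.
  - exact: L2_sqr measurable_I kL.
  - exact: rintegrable_cst measurable_I (itv_lty _ _ _ _).
  - move=> s; rewrite /= in_itv /= => s1; rewrite /sinc_at cabs_real -[t ^+ 2]sqr_normE -exprVn.
    by rewrite lerXn2r ?nnegrE ?invr_ge0// norm_sinc_far.
have [l0|l0] := eqVneq (lam n) 0; first by rewrite l0 mul0r.
have lp : 0 < lam n by rewrite lt_neqAle eq_sym l0 lam_ge0.
have H : (lam n * cabs (Uop c (gam n) t)) ^+ 2 <= 2 * (t ^+ 2)^-1 * lam n.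
  by apply: le_trans CS _; rewrite ler_wpM2r ?lam_ge0.
move: H t2p lp; move: (lam n) (t ^+ 2) (cabs _) => l u v H u0 lp.
rewrite exprMn expr2 -mulrA mulrC ler_pM2r// in H.
by rewrite mulrA -ler_pdivlMr.
Qed.

Lemma cabs_Uop_psi_sqr n (t : R) : cabs (Uop c (gam n) t) ^+ 2 <= 2 * c.
Proof.
by have := cabs_Uop_sqr_le t (ltW c0) (gamL n); rewrite -(PWrep_nrm2 (rep n)) nrm2_psi mulr1.
Qed.

Lemma Rintegral_cabs_gam n : \int[mu]_(xi in `[- c, c]) cabs (gam n xi) <= 2 * c + 1.
Proof.
have := Rintegral_cabs_band_sqr (ltW c0) (gamL n); rewrite -(PWrep_nrm2 (rep n)) nrm2_psi mulr1.
have c1 := ltW c0; move: (Rintegral _ _ _) => x; nra.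
Qed.

Lemma Rintegral_I_cabs_Uop f g : PWrep c f g ->
  (\int[mu]_(x in I) cabs (Uop c g x)) ^+ 2 <= 2 * nrm2 I f.
Proof.
move=> [fL gL _ fU _].
have -> : \int[mu]_(x in I) cabs (Uop c g x) = \int[mu]_(x in I) cabs (f x).
  apply: eq_ae_Rintegral measurable_I _ _ _.
  - by apply: measurable_cabs; apply: cmeas_Uop; exact: L2_meas gL.
  - by apply: measurable_cabs; exact: L2_meas fL.
  - by apply: filterS fU => x ->.
exact: Rintegral_cabs_I_sqr.
Qed.

Lemma Rintegral_I_cabs_psi n :
  \int[mu]_(x in I) cabs (Uop c (gam n) x) <= 2 * Num.sqrt (lam n).
Proof.
have := Rintegral_I_cabs_Uop (rep n); rewrite -/(lam n) -{1}(sqr_sqrtr (lam_ge0 n)).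
move: (Rintegral _ _ _) (Num.sqrt _) (sqrtr_ge0 (lam n)) => x y y0 H.
have [x0|x0] := leP 0 x; last by apply: (le_trans (ltW x0)); rewrite mulr_ge0.
by rewrite -(@ler_pXn2r _ 2) ?nnegrE ?mulr_ge0//; have := sqr_ge0 y; nra.
Qed.

(** If the energy on ]-1, 1[ were 0, the extrapolation bound would hold with every [eta], so [psi n]
    would vanish on all cells, against its norm 1. *)
Lemma lam_gt0 n : 0 < lam n.
Proof.
rewrite lt_neqAle lam_ge0 andbT eq_sym; apply/negP => /eqP l0.
have G0 : 0 <= 2 * c + 1 by have := c0; lra.
have mU : cmeas (Uop c (gam n)) by apply: cmeas_Uop; exact: L2_meas (gamL n).
have cell b X : {ae mu, forall x, unit_cell b X x -> cabs (Uop c (gam n) x) = 0}.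
  apply: Rintegral_eq0_ae (measurable_unit_cell b X) (measurable_cabs mU) (fun x => cabs_ge0 _) _ _.
    exact: cabs_Uop_integrable (ltW c0) (gamL n) (measurable_unit_cell b X) (unit_cell_lty b X).
  have [C C0 H] := @Rintegral_Uop_cell_pow R c _ 2 b X 1 (ltW c0) G0 (ler0n _ _).
  apply/le_anti/andP; split; last by apply: Rintegral_ge0 => x _; exact: cabs_ge0.
  apply/ler_addgt0Pr => e e0; rewrite add0r.
  (* Small enough for [C * eta <= e], and at most 1 as the extrapolation bound requires. *)
  pose eta : R := Num.min 1 (e / (C + 1)).
  have C1 : 0 < C + 1 by lra.
  have e1 : 0 < eta by rewrite lt_min ltr01 divr_gt0.
  apply: le_trans (H (gam n) eta (gamL n) (Rintegral_cabs_gam n) e1 _ _) _.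
  - by rewrite ge_min lexx.
  - by apply: le_trans (Rintegral_I_cabs_psi n) _; rewrite l0 sqrtr0 mulr0 mulr_ge0// exprn_ge0// ltW.
  - rewrite expr1; apply: (@le_trans _ _ ((C + 1) * eta)); first by rewrite ler_wpM2r ?(ltW e1)// lerDl.
    by rewrite mulrC -ler_pdivlMr// ge_min lexx orbT.
have all0 : {ae mu, forall x, Uop c (gam n) x = 0}.
  have A b := ae_foralln (cell b).
  apply: filterS2 (A true) (A false) => x h1 h2; apply: cabs_eq0.
  by have [[] [X xX]] := unit_cell_cover x; [exact: h1 xX|exact: h2 xX].
have : nrm2 setT (psi n) = 0.
  rewrite (@eq_ae_nrm2 _ setT _ (fun=> 0) measurableT (L2_meas (psiL n)) (cmeas_cst _)).
    by rewrite /nrm2 cabs0 expr0n /= Rintegral_cst// mul0r.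
  by apply: filterS2 (psi_Uop n) all0 => x -> ->.
by rewrite nrm2_psi => /eqP; rewrite oner_eq0.
Qed.

(** * Powers of [lam] and interpolated bounds *)

Lemma lam_le1 n : lam n <= 1.
Proof. by rewrite -(nrm2_psi n); apply: nrm2S (psiL n) => //; exact: measurable_I. Qed.

(* Of the [q + 2] factors [eta] of [sqrt (lam n)], extrapolation keeps [q + 1] and the weighted
   sum divides by [q] of them, which leaves one to sum over [n]. *)
Definition eta q n : R := Num.sqrt (lam n) `^ (q.+2%:R^-1).

Lemma eta_gt0 q n : 0 < eta q n.
Proof. by rewrite powR_gt0// sqrtr_gt0 lam_gt0. Qed.

Lemma eta_pow q n : eta q n ^+ q.+2 = Num.sqrt (lam n).
Proof. by rewrite -powR_mulrn ?powR_ge0// -powRrM mulVf ?powRr1 ?sqrtr_ge0// pnatr_eq0. Qed.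

Lemma eta_le1 q n : eta q n <= 1.
Proof.
rewrite -(@expr_le1 _ q.+2) ?(ltW (eta_gt0 q n))// eta_pow -sqrtr1.
by rewrite ler_sqrt// lam_le1.
Qed.

(** After raising to the power [q + 2], the factor [2 ^+ n] becomes a geometric sequence of ratio
    [2 ^+ q.+2], which the factorial in [lam_le] absorbs. *)
Lemma eta_decay q : exists2 D, 0 <= D & forall n, eta q n * 2 ^+ n <= D.
Proof.
have A0 : 0 <= 2 ^+ q.+2 * (2 * pi * c) :> R.
  by rewrite mulr_ge0 ?exprn_ge0// !mulr_ge0 ?pi_ge0// ltW.
have [C C0 H] := pow_fact_bounded A0.
have s0 := sqrtr_ge0 (16 * c).
exists (1 + Num.sqrt (16 * c) * C) => [|n]; first by rewrite addr_ge0// mulr_ge0.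
set D := 1 + _; have D1 : 1 <= D by rewrite lerDl mulr_ge0.
have D0 : 0 <= D by rewrite (le_trans ler01).
rewrite -(@ler_pXn2r _ q.+2) ?nnegrE ?mulr_ge0 ?exprn_ge0 ?(ltW (eta_gt0 q n))//.
apply: (@le_trans _ _ D); last by rewrite exprS ler_peMr// exprn_ege1.
apply: (@le_trans _ _ (Num.sqrt (16 * c) * C)); last by rewrite lerDr.
rewrite exprMn eta_pow -exprM mulnC exprM.
have t0 : 0 <= (2 * pi * c) ^+ n / n`!%:R :> R.
  by rewrite divr_ge0// exprn_ge0// !mulr_ge0 ?pi_ge0// ltW.
apply: (@le_trans _ _ (Num.sqrt (16 * c) * ((2 * pi * c) ^+ n / n`!%:R) * (2 ^+ q.+2) ^+ n)).
  rewrite ler_wpM2r ?exprn_ge0//.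
  rewrite -[X in _ <= _ * X](ger0_norm t0) -sqrtr_sqr -sqrtrM; last by rewrite mulr_ge0// ltW.
  have c16 : 0 <= 16 * c by rewrite mulr_ge0// ltW.
  by rewrite ler_sqrt ?lam_le// mulr_ge0 ?sqr_ge0.
by rewrite -mulrA ler_wpM2l// mulrAC -exprMn [_ * 2 ^+ _]mulrC.
Qed.

Lemma eta_sum q : exists2 D, 0 <= D & forall N, \sum_(n < N) eta q n <= D.
Proof.
have [D D0 H] := eta_decay q; exists (2 * D) => [|N]; first by rewrite mulr_ge0.
(* The subtracted tail of the geometric series makes the induction close. *)
suff E : \sum_(n < N) eta q n <= 2 * D - 2 * D * (2 ^+ N)^-1.
  by apply: le_trans E _; rewrite lerBlDr lerDl !mulr_ge0// invr_ge0 exprn_ge0.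
elim: N => [|N IH]; first by rewrite big_ord0 expr0 invr1 mulr1 subrr.
have p : 0 < 2 ^+ N :> R by rewrite exprn_gt0.
have h : eta q N <= D * (2 ^+ N)^-1 by rewrite ler_pdivlMr.
rewrite big_ord_recr /= exprS invfM; move: (2 ^+ N)^-1 h IH => w h; move: (\sum_(_ < N) _) => s IH.
have -> : 2 * D * (2^-1 * w) = D * w by field.
rewrite -mulrA in IH; move: (D * w) h IH => z h IH; lra.
Qed.

(** Scaled like [eta], whose power [q + 2] is [sqrt (lam n)]: here the power [q + 2] is
    [1 / sqrt (1 + t^2)]. The weight used is [wt q t ^+ q], of order [|t|^(- q / (q + 2))]. *)
Definition wt q (t : R) : R := (1 + t ^+ 2)^-1 `^ ((2 * q.+2)%:R^-1).

Lemma wt_gt0 q t : 0 < wt q t.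
Proof. by rewrite powR_gt0// invr_gt0; have := sqr_ge0 t; lra. Qed.

Lemma wt_pow q t : wt q t ^+ (2 * q.+2) = (1 + t ^+ 2)^-1.
Proof.
have t0 : 0 <= (1 + t ^+ 2)^-1 by rewrite invr_ge0; have := sqr_ge0 t; lra.
by rewrite -powR_mulrn ?powR_ge0// -powRrM mulVf ?powRr1// pnatr_eq0.
Qed.

Lemma measurable_wt q : measurable_fun setT (wt q).
Proof. exact: (measurableT_comp (measurable_powR _) measurable_inv1sqr). Qed.

(** With [r = wt q t / eta q n], the squared modulus is at most [K] by the uniform bound and at most
    [K * r ^+ (2 * q.+2)] by the decay. One of these two is at most [K * r ^+ (2 * q)], according to
    whether [r] exceeds 1. *)
Lemma cabs_Uop_psi_le q n t :
  cabs (Uop c (gam n) t) <= (10 * c + 4) * (wt q t ^+ q * (eta q n ^+ q)^-1).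
Proof.
have e0 := eta_gt0 q n; have w0 := wt_gt0 q t.
pose r := wt q t / eta q n; have r0 : 0 < r by rewrite divr_gt0.
(* [10 c] covers [|t| < 2], where [1 + t^2 <= 5] and the uniform bound is [2 c]; 3 covers
   [|t| >= 2], where [1 + t^2 <= 5/4 t^2] and the decay bound is 2. The final [10 c + 4] is [K + 1],
   which exceeds the square root of [K]. *)
have cp := c0; pose K := 10 * c + 3.
have rQ : lam n * r ^+ (2 * q.+2) = (1 + t ^+ 2)^-1.
  rewrite /r exprMn exprVn wt_pow [eta q n ^+ (2 * _)]exprM -exprM mulnC exprM eta_pow.
  by rewrite sqr_sqrtr ?lam_ge0// mulrCA mulfV ?mulr1// gt_eqF// lam_gt0.
set y := cabs _; have y0 : 0 <= y := cabs_ge0 _.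
have b1 : y ^+ 2 <= K by have := cabs_Uop_psi_sqr n t; rewrite -/y /K; move: (y ^+ 2) => z; lra.
have b2 : y ^+ 2 <= K * r ^+ (2 * q.+2).
  rewrite -(ler_pM2l (lam_gt0 n)) [leRHS]mulrCA rQ ler_pdivlMr; last by have := sqr_ge0 t; lra.
  have [t2|t2] := leP 2 `|t|.
    have := cabs_Uop_psi_far n t2; rewrite -/y.
    have t4 : 4 <= t ^+ 2 by rewrite -sqr_normE; nra.
    have -> : lam n * y ^+ 2 * (1 + t ^+ 2) = lam n * y ^+ 2 + lam n * (y ^+ 2 * t ^+ 2) by ring.
    have : lam n * (y ^+ 2 * 4) <= lam n * (y ^+ 2 * t ^+ 2).
      by rewrite ler_wpM2l ?lam_ge0// ler_wpM2l// sqr_ge0.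
    have -> : lam n * (y ^+ 2 * 4) = 4 * (lam n * y ^+ 2) by ring.
    by rewrite /K; move: (lam n * y ^+ 2) (lam n * _) => u v; lra.
  have t4 : t ^+ 2 <= 4 by rewrite -sqr_normE; have := normr_ge0 t; nra.
  have h : lam n * y ^+ 2 <= 2 * c.
    apply: le_trans (cabs_Uop_psi_sqr n t); rewrite -/y ler_piMl ?sqr_ge0 ?lam_le1//.
  have h0 : 0 <= lam n * y ^+ 2 by rewrite mulr_ge0 ?lam_ge0 ?sqr_ge0.
  by rewrite /K; move: (lam n * y ^+ 2) (t ^+ 2) h h0 t4 (sqr_ge0 t) => u v; nra.
have K0 : 0 <= K by rewrite /K; lra.
have b : y ^+ 2 <= K * (r ^+ q) ^+ 2.
  rewrite -exprM mulnC; have [r1|r1] := leP 1 r.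
    by apply: le_trans b1 _; rewrite ler_peMr// exprn_ege1.
  apply: le_trans b2 _; rewrite ler_wpM2l// ler_wiXn2l ?(ltW r0) ?(ltW r1)//.
  by rewrite leq_mul2l /= ltnW// leqW.
rewrite -exprVn -exprMn -/r.
have rq : 0 <= r ^+ q by rewrite exprn_ge0// ltW.
rewrite -(@ler_pXn2r _ 2) ?nnegrE ?mulr_ge0//; last by lra.
apply: le_trans b _; rewrite [leRHS]exprMn; apply: ler_wpM2r; first exact: sqr_ge0.
by rewrite /K; have := sqr_ge0 c; nra.
Qed.

(** * Summation over n and completeness *)

Lemma ae_unit_cells (P : R -> Prop) :
  (forall b X, {ae mu, forall x, unit_cell b X x -> P x}) -> {ae mu, forall x, P x}.
Proof.
move=> H; apply: filterS2 (ae_foralln (H true)) (ae_foralln (H false)) => x h1 h2.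
by have [[] [X xX]] := unit_cell_cover x; [exact: h1 xX|exact: h2 xX].
Qed.

(** Over a cell the integral of the n-th term is at most [C * eta q n], and these sum by [eta_sum].
    The constant [C] varies with the cell, which is harmless because the cells are countably many
    and [S] may depend on the point. *)
Lemma psi_weighted_sum_ae q : {ae mu, forall x, exists S, forall N,
  \sum_(n < N) cabs (Uop c (gam n) x) / eta q n ^+ q <= S}.
Proof.
apply: ae_unit_cells => b X.
have G0 : 0 <= 2 * c + 1 by have := c0; lra.
have [C C0 HC] := @Rintegral_Uop_cell_pow R c _ 2 b X q.+1 (ltW c0) G0 (ler0n _ _).
have [D D0 HD] := eta_sum q.
have mK : measurable (unit_cell b X : set R) by exact: measurable_unit_cell.
have Koo : (mu (unit_cell b X) < +oo)%E by exact: unit_cell_lty.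
have iU n := cabs_Uop_integrable (ltW c0) (gamL n) mK Koo.
have mU n : measurable_fun setT (fun x => cabs (Uop c (gam n) x)).
  by apply: measurable_cabs; apply: cmeas_Uop; exact: L2_meas (gamL n).
apply: (@ae_bounded_partial_sums _ _ (fun n x => cabs (Uop c (gam n) x) / eta q n ^+ q) (C * D)) => //.
- by move=> n; apply: measurable_funM => //; exact: measurable_cst.
- by move=> n x; rewrite divr_ge0 ?cabs_ge0// exprn_ge0// ltW// eta_gt0.
- by move=> n; under eq_fun do rewrite mulrC; exact: rintegrableZl.
- move=> N; apply: (@le_trans _ _ (\sum_(n < N) C * eta q n)); last first.
    by rewrite -mulr_sumr ler_wpM2l.
  apply: ler_sum => n _.
  have -> : \int[mu]_(x in unit_cell b X) (cabs (Uop c (gam n) x) / eta q n ^+ q) =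
      (eta q n ^+ q)^-1 * \int[mu]_(x in unit_cell b X) cabs (Uop c (gam n) x).
    rewrite -(@RintegralZl _ _ _ mu _ _ _ mK (iU n)).
    by apply: eq_Rintegral => x _; rewrite mulrC.
  have e0 := eta_gt0 q n.
  rewrite mulrC ler_pdivrMr ?exprn_gt0// -mulrA -exprS.
  apply: HC (gamL n) (Rintegral_cabs_gam n) e0 (eta_le1 q n) _.
  by rewrite eta_pow; exact: Rintegral_I_cabs_psi.
Qed.

Lemma cvg0_of_bounded_sums (u : nat -> R) (S : R) : (forall n, 0 <= u n) ->
  (forall N, \sum_(n < N) u n <= S) -> u @ \oo --> (0 : R).
Proof.
move=> u0 uS; apply: cvg_series_cvg_0; apply: nondecreasing_is_cvgn.
  by apply/nondecreasing_seqP => n; rewrite /series /= big_nat_recr//= lerDl.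
by exists S => _ [N _ <-]; rewrite /series /= big_mkord.
Qed.

(** The remainder of [sinc_at c x] after [N] terms is orthogonal to the first [N] functions, so its
    energy on ]-1, 1[ is at most [2 c * lam N]. Extrapolation makes its L^1 norms on a cell summable
    in [N]; the remainders then have a bounded sum at almost every [t] and tend to 0. The
    exceptional set depends on [x], which suffices for an integral in [t]. *)
Lemma psi_complete (x : R) : {ae mu, forall t, ccvg
  (fun N => \sum_(n < N) conjc (Uop c (gam n) x) * Uop c (gam n) t) (sinc_at c x t)}.
Proof.
have rk := PWrep_sinc_at x c0; have [kL _ _ _ _] := rk.
have rr N := PWrep_remainder N rk.
have hatL N : L2 (remainder_hat N (sinc_at c x) (wave c x)) by have [] := rr N.
pose f N := Uop c (remainder_hat N (sinc_at c x) (wave c x)).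
have nr N : nrm2 setT (remainder_hat N (sinc_at c x) (wave c x)) <= 2 * c.
  rewrite -(PWrep_nrm2 (rr N)); apply: le_trans (nrm2_remainder_le N kL) _.
  by have [_ ->] := L2_sinc_at c0 x.
have fE : {ae mu, forall t, forall N, f N t =
    sinc_at c x t - \sum_(n < N) conjc (Uop c (gam n) x) * Uop c (gam n) t}.
  apply: filterS2 (ae_foralln psi_Uop) (ae_foralln (fun N => let: And5 _ _ _ h _ := rr N in h)).
  move=> t h1 h2 N; rewrite /f -h2 /remainder; congr (_ + _); rewrite -sumrN.
  apply: eq_bigr => n _; rewrite h1 mulNr; congr (- (_ * _)).
  by rewrite (ipC measurableT (psiL n) kL) (PWrep_ip_sinc_at x c0 (rep n)).
have fS : {ae mu, forall t, exists S, forall N, \sum_(n < N) cabs (f n t) <= S}.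
  apply: ae_unit_cells => b X.
  have G0 : 0 <= 2 * c + 1 by have := c0; lra.
  (* [2 c + 1] bounds the L^1 norm of the transform, whose square is at most [4 c^2]. [2 c + 2]
     bounds the square root of [4 c], which arises from the energy [2 c * lam N] by Cauchy-Schwarz
     on ]-1, 1[. *)
  have [C C0 HC] := @Rintegral_Uop_cell_pow R c _ (2 * c + 2) b X 1 (ltW c0) G0 (addr_ge0 (mulr_ge0 (ler0n _ _) (ltW c0)) (ler0n _ _)).
  have [D D0 HD] := eta_sum 0.
  have mK : measurable (unit_cell b X : set R) by exact: measurable_unit_cell.
have Koo : (mu (unit_cell b X) < +oo)%E by exact: unit_cell_lty.
  have iU N := cabs_Uop_integrable (ltW c0) (hatL N) mK Koo.
  apply: (@ae_bounded_partial_sums _ _ (fun N t => cabs (f N t)) (C * D)) => //.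
  - by move=> N; apply: measurable_cabs; apply: cmeas_Uop; exact: L2_meas (hatL N).
  - by move=> N t; exact: cabs_ge0.
  - move=> M; apply: (@le_trans _ _ (\sum_(n < M) C * eta 0 n)); last first.
      by rewrite -mulr_sumr ler_wpM2l.
    apply: ler_sum => N _.
    rewrite -[eta 0 N]expr1; apply: HC (hatL N) _ (eta_gt0 0 N) (eta_le1 0 N) _.
      have := Rintegral_cabs_band_sqr (ltW c0) (hatL N).
      move=> /le_trans/(_ (ler_wpM2l (mulr_ge0 (ler0n _ 2) (ltW c0)) (nr N))).
      have cp := c0; move: (Rintegral _ _ _) => z; nra.
    rewrite eta_pow.
    have := Rintegral_I_cabs_Uop (rr N).
    have : nrm2 I (remainder N (sinc_at c x)) <= Num.sqrt (lam N) ^+ 2 * (2 * c).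
      rewrite sqr_sqrtr ?lam_ge0//.
      apply: le_trans (nrm2_I_le (rr N) (fun k => @remainder_orth N k _ kL)) _.
      by rewrite ler_wpM2l ?lam_ge0// (PWrep_nrm2 (rr N)).
    have cp := c0; move: (nrm2 _ _) (Num.sqrt _) (sqrtr_ge0 (lam N)) (Rintegral _ _ _) => u s s0 z hu hz.
    have [z0|z0] := leP 0 z; last by apply: (le_trans (ltW z0)); rewrite mulr_ge0//; lra.
    rewrite -(@ler_pXn2r _ 2) ?nnegrE ?mulr_ge0//; last by lra.
    apply: le_trans hz _; rewrite exprMn; have := sqr_ge0 s; have := sqr_ge0 c; nra.
apply: filterS2 fE fS => t Ht [S HS].
have := cvg0_of_bounded_sums (fun n => cabs_ge0 (f n t)) HS.
apply: cvg_trans; apply: near_eq_cvg; apply: nearW => N.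
by rewrite Ht -cabsN opprB.
Qed.
(** At a fixed [x], the partial sum is the integral of [f] against a partial sum of the kernel
    expansion, and the limit is taken under this integral. The weighted integrability of [f] gives
    both the existence of the coefficients and the dominating function. *)
Lemma PsiN_cvg q f : cmeas f -> rintegrable setT (fun t => cabs (f t) * wt q t ^+ q) ->
  {ae mu, forall x, ccvg (fun N => PsiN psi N f x) (Pc c f x)}.
Proof.
move=> mf fw; pose phi n := Uop c (gam n).
have mphi n : cmeas (phi n) by apply: cmeas_Uop; exact: L2_meas (gamL n).
have mphic n : cmeas (fun t => f t * conjc (phi n t)).
  by apply: cmeasM mf _; apply: cmeas_conj; exact: mphi.
have iphi n : cintegrable setT (fun t => f t * conjc (phi n t)).
  apply: (cintegrable_le measurableT (mphic n)
    (rintegrableZl ((10 * c + 4) * (eta q n ^+ q)^-1) measurableT fw)) => t _.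
  rewrite cabsM cabs_conj [leRHS]mulrCA ler_wpM2l ?cabs_ge0//.
  by rewrite -mulrA [X in _ <= _ * X]mulrC; exact: cabs_Uop_psi_le.
have ipE n : inner f (psi n) = cint setT (fun t => f t * conjc (phi n t)).
  apply: eq_ae_cint measurableT _ (mphic n) _.
    by apply: cmeasM mf _; apply: cmeas_conj; exact: L2_meas (psiL n).
  by apply: filterS (psi_Uop n) => t ->.
(* The exceptional set in [x] is chosen here and does not depend on [f]: outside it the weighted sum
   is bounded and every [psi n x] is the value of [Uop]. *)
apply: filterS2 (psi_weighted_sum_ae q) (ae_foralln psi_Uop) => x [S HS] psiE.
pose F N t := f t * conjc (\sum_(n < N.+1) conjc (phi n x) * phi n t).
have FE N t : F N t = \sum_(n < N.+1) phi n x * (f t * conjc (phi n t)).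
  rewrite /F (raddf_sum (@conjc R)) mulr_sumr; apply: eq_bigr => n _ /=.
  by rewrite conjcM conjcK mulrCA.
have iF (N : nat) (n : 'I_N.+1) : cintegrable setT (fun t => phi n x * (f t * conjc (phi n t))).
  exact: cintegrableZl measurableT (iphi n).
have PE N : cint setT (F N) = PsiN psi N f x.
  transitivity (cint setT (fun t => \sum_(n < N.+1) phi n x * (f t * conjc (phi n t)))).
    by apply: eq_cint => t _; exact: FE.
  rewrite (cint_sum _ measurableT (@iF N)); apply: eq_bigr => n _.
  by rewrite (cintZl _ measurableT (iphi n)) ipE mulrC psiE.
have mF N : cmeas (F N).
  apply: eq_cmeas (fun t => esym (FE N t)) _; apply: cmeas_sum => n.
  by apply: cmeasM; [exact: cmeas_cst|exact: mphic].
have mkt : cmeas (sinc_at c x) by have [kL _] := L2_sinc_at c0 x; exact: L2_meas kL.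
have ml : cmeas (fun t => f t * conjc (sinc_at c x t)) by apply: cmeasM mf _; exact: cmeas_conj.
have [||_ lim] := @dominated_ccvg R setT F (fun t => f t * conjc (sinc_at c x t))
  (fun t => (10 * c + 4) * S * (cabs (f t) * wt q t ^+ q)) measurableT mF ml _
  (rintegrableZl _ measurableT fw).
- apply: filterS (psi_complete x) => t Ht _.
  (* [PsiN] sums [N + 1] terms where [psi_complete] counts [N], hence the shift. *)
  have Ht' : ccvg (fun N => \sum_(n < N.+1) conjc (phi n x) * phi n t) (sinc_at c x t).
    by move: Ht; rewrite /ccvg -cvg_shiftS; exact.
  apply: ccvgZ; have e N : cabs (conjc (\sum_(n < N.+1) conjc (phi n x) * phi n t) - conjc (sinc_at c x t)) =
      cabs (\sum_(n < N.+1) conjc (phi n x) * phi n t - sinc_at c x t).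
    by rewrite -conjcB cabs_conj.
  by rewrite /ccvg; under eq_fun do rewrite e; exact: Ht'.
- apply: aeW => t N _; rewrite /F cabsM cabs_conj mulrCA ler_wpM2l ?cabs_ge0//.
  apply: le_trans (ler_cabs_sum _ _ _) _.
  apply: (@le_trans _ _ ((10 * c + 4) * wt q t ^+ q * \sum_(n < N.+1) cabs (phi n x) / eta q n ^+ q)).
    rewrite mulr_sumr; apply: ler_sum => n _; rewrite cabsM cabs_conj.
    apply: le_trans (ler_wpM2l (cabs_ge0 _) (cabs_Uop_psi_le q n t)) _.
    by rewrite le_eqVlt; apply/orP; left; apply/eqP; rewrite -/(phi n); ring.
  rewrite [leRHS]mulrAC ler_wpM2l ?HS//.
  by rewrite mulr_ge0 ?exprn_ge0// ?(ltW (wt_gt0 q t))//; have := c0; lra.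
have <- : cint setT (fun t => f t * conjc (sinc_at c x t)) = Pc c f x.
  apply: eq_cint => t _; rewrite /sinc_at conjc_real -opprB.
  by rewrite (sinc_kernelN c (x - t)).
by apply: eq_ccvg lim.
Qed.

End Spectral.

(** * Weighted integrability of L^p functions *)

Section Weight.
Context {R : realType}.
Local Notation mu := (@lebesgue_measure R).
Implicit Types (a s t : R).

Lemma der_powR G g a : der G g -> (forall x : R, 0 < G x) ->
  der (fun x => G x `^ a) (fun x => a * G x `^ (a - 1) * g x).
Proof.
move=> dG G0 x.
have := @is_derive1_comp R (fun y => y `^ a) G x _ _ (is_derive1_powR a (G0 x)) (dG x).
by [].
Qed.

Lemma cvg_powR_1sqr a : 0 < a -> (1 + t ^+ 2) `^ (- a) @[t --> +oo] --> (0 : R).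
Proof.
move=> a0; apply/cvgrPdist_le => e e0; near=> t.
rewrite sub0r normrN ger0_norm ?powR_ge0// powRN.
have t0 : 0 <= 1 + t ^+ 2 by have := sqr_ge0 t; lra.
have B0 : 0 <= e^-1 `^ a^-1 by exact: powR_ge0.
have tB : e^-1 `^ a^-1 <= 1 + t ^+ 2.
  apply: (@le_trans _ _ t); first by near: t; exact: nbhs_pinfty_ge.
  by have := sqr_ge0 (t - 1); have := sqr_ge0 t; nra.
have := ge0_ler_powR (ltW a0) B0 t0 tB; rewrite -powRrM mulVf ?gt_eqF// powRr1 ?invr_ge0 ?(ltW e0)// => h.
have p0 : 0 < (1 + t ^+ 2) `^ a by apply: lt_le_trans h; rewrite invr_gt0.
by rewrite -[leRHS]invrK lef_pV2 ?posrE ?invr_gt0.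
Unshelve. all: by end_near. Qed.

Lemma rintegrable_1sqr_powR s : 2^-1 < s -> rintegrable setT (fun t => (1 + t ^+ 2) `^ (- s)).
Proof.
move=> s2; pose a := s - 2^-1; have a0 : 0 < a by rewrite subr_gt0.
have p t : 0 < 1 + t ^+ 2 by have := sqr_ge0 t; lra.
have d1 : der (fun t : R => 1 + t * t) (fun t => 0 + (t * 1 + t * 1)) := derD (der_cst 1) (derM der_id der_id).
have p' t : 0 < 1 + t * t by exact: p.
have cp b : continuous (fun t : R => (1 + t ^+ 2) `^ b) := is_derive_continuous (der_powR b d1 p').
pose f t := `|t| * (1 + t ^+ 2) `^ (- a - 1).
have f0 t : 0 <= f t by rewrite mulr_ge0// powR_ge0.
have cf : continuous f.
  by move=> t; apply: continuousM; [exact: norm_continuous|exact: cp].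
have intf : rintegrable setT f.
  apply/integrableP; split; first by apply/measurable_EFinP; exact: continuous_measurable_fun.
  under eq_integral do rewrite abse_EFin ger0_norm//.
  rewrite ge0_Rintegral_even//; last by move=> t; rewrite /f normrN sqrrN.
  pose g t := t * (1 + t ^+ 2) `^ (- a - 1); pose F t := - (2 * a)^-1 * (1 + t ^+ 2) `^ (- a).
  have dF : der F g.
    apply: der_eq (derZ (- (2 * a)^-1) (der_powR (- a) d1 p')) _ => t.
    have E (b y z : R) : b != 0 -> - (2 * b)^-1 * (- b * z * (0 + (y * 1 + y * 1))) = y * z.
      by move=> b0; field.
    by rewrite E ?gt_eqF// /g -expr2.
  have cg : continuous g.
    by move=> t; apply: (@continuousM R R id (fun t => (1 + t ^+ 2) `^ (- a - 1))); [exact: cvg_id|exact: cp].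
  have -> : (\int[mu]_(x in `[0%R, +oo[) (f x)%:E = \int[mu]_(x in `[0%R, +oo[) (g x)%:E)%E.
    by apply: eq_integral => x; rewrite inE /= in_itv /= andbT => x0; rewrite /f /g ger0_norm.
  have FC := @ge0_continuous_FTC2y R g F 0 0.
  rewrite FC.
  - by rewrite -EFinB -EFinM ltry.
  - by move=> t t0; rewrite mulr_ge0// powR_ge0.
  - exact: continuous_subspaceT.
  - by rewrite -(mulr0 (- (2 * a)^-1)); apply: cvgMr; exact: cvg_powR_1sqr.
  - by move=> x _; case: (dF x).
  - by apply: cvg_at_right_filter; exact: (is_derive_continuous dF).
  - by move=> x _; rewrite derive1E; exact: derive_val.
have ib := rintegrableD measurableT (rintegrableZl 2 measurableT intf)
  (rintegrableZl 2 measurableT (@rintegrable_inv1sqr R)).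
apply: (rintegrable_le measurableT _ ib); first by exact: continuous_measurable_fun.
move=> t _; rewrite ger0_norm ?powR_ge0//.
have w0 : 0 <= (1 + t ^+ 2)^-1 by rewrite invr_ge0 ltW.
have [t1|t1] := leP 1 `|t|.
  apply: ler_wpDr; first by rewrite mulr_ge0.
  have E : (1 + t ^+ 2) `^ (- s) = (1 + t ^+ 2) `^ (- a - 1) * Num.sqrt (1 + t ^+ 2).
    rewrite -powR12_sqrt ?(ltW (p t))// -powRD; last by rewrite (gt_eqF (p t)) implybT.
    by congr (_ `^ _); rewrite /a; field.
  rewrite E /f mulrA mulrC ler_wpM2r ?powR_ge0//.
  have t2 : 1 <= t ^+ 2 by rewrite -sqr_normE; nra.
  have n0 : 0 <= 2 * `|t| by rewrite mulr_ge0.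
  rewrite -(@ler_pXn2r _ 2) ?nnegrE ?sqrtr_ge0// sqr_sqrtr ?(ltW (p t))// exprMn sqr_normE.
  by move: (t ^+ 2) t2 => z; lra.
apply: ler_wpDl; first by rewrite mulr_ge0.
apply: (@le_trans _ _ 1).
  rewrite -[X in _ <= X](powRr0 (1 + t ^+ 2)); apply: ler_powR; last by lra.
  by rewrite lerDl sqr_ge0.
by rewrite ler_pdivlMr// mul1r -(sqr_normE t); have := normr_ge0 t; nra.
Qed.

Lemma measurable_powR_cabs p (f : R -> R[i]) : cmeas f ->
  measurable_fun setT (fun t => cabs (f t) `^ p).
Proof. by move=> mf; exact: (measurableT_comp (measurable_powR _) (measurable_cabs mf)). Qed.

Lemma Lp_rintegrable p (f : R -> R[i]) : Lp p f -> rintegrable setT (fun t => cabs (f t) `^ p).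
Proof.
move=> [mf fi]; apply/integrableP; split.
  by apply/measurable_EFinP; exact: measurable_powR_cabs.
by under eq_integral do rewrite abse_EFin ger0_norm ?powR_ge0//.
Qed.

Lemma wtXE q t : wt q t ^+ q = (1 + t ^+ 2) `^ (- (q%:R / (2 * q.+2)%:R)).
Proof.
have t0 : 0 <= 1 + t ^+ 2 by have := sqr_ge0 t; lra.
rewrite -powR_mulrn ?powR_ge0// -powRrM -(powR_inv1 t0) -powRrM mulN1r.
by rewrite [_^-1 * _]mulrC.
Qed.

Lemma rintegrable_Lp_wt p (f : R -> R[i]) : 1 < p -> Lp p f ->
  exists q, rintegrable setT (fun t => cabs (f t) * wt q t ^+ q).
Proof.
move=> p1 fLp; have [mf _] := fLp.
(* [s > 1/2] amounts to [q / (q + 2) > 1 - 1 / p], that is [q > 2 (p - 1)], which [q > 2 p]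
   ensures. *)
have [q q2] : exists q : nat, 2 * p < q%:R.
  by exists (Num.truncn (2 * p)).+1; exact: truncnS_gt.
exists q.
have p0 : 0 < p by lra.
have p10 : 0 < p - 1 by lra.
pose p' := p / (p - 1); have p'0 : 0 < p' by rewrite divr_gt0.
pose s := q%:R / (2 * q.+2)%:R * p'.
have s2 : 2^-1 < s.
  have E : (2 * q.+2)%:R = 2 * (q%:R + 2) :> R by rewrite natrM -[q.+2]/(2 + q)%N natrD [X in _ * X]addrC.
  rewrite /s /p' E; move: (q%:R) q2 => x q2.
  have x2 : 0 < 2 * (x + 2) by lra.
  have -> : x / (2 * (x + 2)) * (p / (p - 1)) = x * p / (2 * (x + 2) * (p - 1)).
    by field; apply/andP; split; lra.
  by rewrite ltr_pdivlMr ?mulr_gt0//; nra.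
have ib := rintegrableD measurableT (rintegrableZl p^-1 measurableT (Lp_rintegrable fLp))
  (rintegrableZl p'^-1 measurableT (rintegrable_1sqr_powR s2)).
apply: (rintegrable_le measurableT _ ib).
  apply: measurable_funM; first exact: measurable_cabs.
  by apply: measurable_funX; exact: measurable_wt.
move=> t _; have w0 : 0 <= wt q t ^+ q by rewrite wtXE powR_ge0.
rewrite ger0_norm ?mulr_ge0 ?cabs_ge0//.
have pp : p^-1 + p'^-1 = 1 by rewrite /p'; field; apply/andP; split; lra.
apply: le_trans (conjugate_powR (cabs_ge0 (f t)) w0 p0 p'0 pp) _.
by rewrite wtXE -powRrM mulNr -/s ![_ / _]mulrC.
Qed.

End Weight.

(** * Convergence in L^p and in the Paley-Wiener space of exponent 1 *)

Lemma PSWF_rep (R : realType) (c : R) (psi : nat -> R -> R[i]) : PSWF c psi ->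
  exists gam, forall n, PWrep c (psi n) (gam n).
Proof.
move=> H; have ex n : exists g, PWrep c (psi n) g by have [h _ _ _] := H n; exact: PW2_rep h.
by have [gam Hgam] := choice ex; exists gam.
Qed.
Unset Implicit Arguments. Set Strict Implicit.
Local Close Scope complex_scope.

Theorem theorem1 (R : realType) (c : R) (hc : 0 < c)
    (psi : nat -> R -> R[i]) (hpsi : PSWF c psi) :
  (forall (p : R) (f : R -> R[i]), 1 < p -> Lp p f ->
     {ae (@lebesgue_measure R), forall x,
        ccvg (fun N : nat => PsiN psi N f x) (Pc c f x)}) /\
  (forall f : R -> R[i], PW1 c f ->
     {ae (@lebesgue_measure R), forall x,
        ccvg (fun N : nat => PsiN psi N f x) (f x)}).
Proof.
have [gam rep] := PSWF_rep hpsi; split=> [p f p1 fLp|f fPW].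
  have [q fq] := rintegrable_Lp_wt p1 fLp.
  have [mf _] := fLp; exact: (PsiN_cvg hc hpsi rep mf fq).
have [[mf _] _] := fPW; have [fLp _] := fPW.
(* For p = 1 the trivial weight [q = 0] is enough: [f] is integrable and the prolate functions are
   uniformly bounded. *)
have f1 : rintegrable setT (fun t => cabs (f t) * wt 0 t ^+ 0).
  rewrite (_ : (fun t => _) = (fun t => powR (cabs (f t)) 1)); first exact: Lp_rintegrable.
  by apply/funext => t; rewrite expr0 mulr1 powRr1// cabs_ge0.
by apply: filterS2 (PsiN_cvg hc hpsi rep mf f1) (PW1_Pc hc fPW) => x h ->.
Qed.
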